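(* Let $K$ be a field of characteristic $0$, $G$ the split simply connected simple group of type $\mathrm{F}_4$ over $K$, $V=V_{\omega_4}$ its $26$-dimensional irreducible representation, and $E$ a $3$-dimensional $K$-vector space. Let $\mathcal{R}_3\subset V\times G/P_2$ be the rank $3$ tautological subbundle over $G/P_2$, and let $Y\subset\operatorname{Hom}(E,V)$ be the image of the total space of $\operatorname{Hom}(E,\mathcal{R}_3)\subset\operatorname{Hom}(E,V)\times G/P_2$ under projection to $\operatorname{Hom}(E,V)$. Then the defining ideal of $Y$ in $K[\operatorname{Hom}(E,V)]$ is generated by quadrics. The defining equations are given by the representations $\bigwedge^2E\otimes V_{\omega_1}$ and $\operatorname{Sym}^2E\otimes(V_{\omega_4}\oplus K)$ in degree $2$.
   Context: Bourbaki numbering of the Dynkin diagram $1-2\Rightarrow3-4$. $V_{\omega}$ is the irreducible $G$-module of highest weight $\omega$; all are self-dual, so $K[\operatorname{Hom}(E,V)]=\operatorname{Sym}(E\otimes V^* )\cong\operatorname{Sym}(E\otimes V)$, whose degree $2$ part is $\bigwedge^2E\otimes\bigwedge^2V\oplus\operatorname{Sym}^2E\otimes\operatorname{Sym}^2V$. $P_i$ is the maximal parabolic subgroup stabilizing the highest weight line in $V_{\omega_i}$. The fiber of $\mathcal{R}_3$ at the base point of $G/P_2$ is the $3$-dimensional $P_2$-stable subspace of $V$ generated, under the Levi subgroup of $P_2$, by a highest weight vector of $V$. $Y$ has its reduced structure. *)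

(* Defs.v *)
From mathcomp Require Import all_boot all_order all_algebra.
From mathcomp Require Import mpoly.

Set Implicit Arguments.
Unset Strict Implicit.
Unset Printing Implicit Defensive.

Import GRing.Theory.
Local Open Scope ring_scope.

(* Nodes are numbered 0, 1, 2, 3 instead of 1, 2, 3, 4.  In Bourbaki's
   convention the (i, j) entry is <alpha_i, alpha_j^vee>; alpha_0 and alpha_1
   are the long simple roots. *)
Definition cartanF4 (i j : 'I_4) : int :=
  nth 0 (nth [::] [:: [:: 2; -1;  0;  0];
                     [:: -1; 2; -2;  0];
                     [:: 0; -1;  2; -1];
                     [:: 0;  0; -1;  2]] i) j.

Definition node1 : 'I_4 := inord 0.
Definition node2 : 'I_4 := inord 1.
Definition node3 : 'I_4 := inord 2.
Definition node4 : 'I_4 := inord 3.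

(* Chevalley generators of the split simple Lie algebra of type F4. *)
Inductive f4gen := Egen of 'I_4 | Fgen of 'I_4 | Hgen of 'I_4.

Definition brk (R : pzRingType) (n : nat) (A B : 'M[R]_n) : 'M[R]_n :=
  A *m B - B *m A.

(* By Serre's theorem this is a representation of the split simple Lie algebra
   of type F4 on column vectors.  In characteristic 0 these are the same as the
   finite-dimensional representations of the split simply connected group G,
   with the same submodules and the same morphisms. *)
Definition f4_rep (K : fieldType) (n : nat) (rho : f4gen -> 'M[K]_n) : Prop :=
  let e i := rho (Egen i) in
  let f i := rho (Fgen i) in
  let h i := rho (Hgen i) in
  [/\ forall i j, brk (h i) (h j) = 0,
      forall i j, brk (e i) (f j) = if i == j then h i else 0,
      forall i j, brk (h i) (e j) = (cartanF4 j i)%:~R *: e j /\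
                  brk (h i) (f j) = - (cartanF4 j i)%:~R *: f j &
      forall i j, i != j ->
        iter `|1 - cartanF4 j i|%N (brk (e i)) (e j) = 0 /\
        iter `|1 - cartanF4 j i|%N (brk (f i)) (f j) = 0].

(* The row space of U is a subspace of K^n, stable under each rho x. *)
Definition stable_space (K : fieldType) (n : nat) (rho : f4gen -> 'M[K]_n)
    (U : 'M[K]_n) : Prop :=
  forall x, (U *m (rho x)^T <= U)%MS.

Definition irreducible_rep (K : fieldType) (n : nat)
    (rho : f4gen -> 'M[K]_n) : Prop :=
  (0 < n)%N /\ forall U, stable_space rho U -> U = 0 \/ row_full U.

(* v is a highest weight vector, of weight the fundamental weight omega_k. *)
Definition hw_vector (K : fieldType) (n : nat) (rho : f4gen -> 'M[K]_n)
    (k : 'I_4) (v : 'cV[K]_n) : Prop :=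
  [/\ v != 0, forall i, rho (Egen i) *m v = 0 &
      forall i, rho (Hgen i) *m v = (i == k)%:R *: v].

Definition fundamental_rep (K : fieldType) (n : nat) (k : 'I_4)
    (rho : f4gen -> 'M[K]_n) : Prop :=
  [/\ f4_rep rho, irreducible_rep rho & exists v, hw_vector rho k v].

Definition trivial_rep (K : fieldType) (x : f4gen) : 'M[K]_1 := 0.

Definition sum_rep (K : fieldType) (m n : nat) (rho : f4gen -> 'M[K]_m)
    (sigma : f4gen -> 'M[K]_n) (x : f4gen) : 'M[K]_(m + n) :=
  block_mx (rho x) 0 0 (sigma x).

(* A nilpotent n x n matrix has n-th power 0, so this is its exponential. *)
Definition mx_exp (L : fieldType) (n : nat) (A : 'M[L]_n) : 'M[L]_n :=
  \sum_(k < n) (k`!%:R)^-1 *: A ^+ k.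

(* For a field extension L of K, the group G(L) of the split simply connected
   group G is generated by its simple root subgroups: the letter
   (true, i, t) stands for x_(alpha_i)(t) and (false, i, t) for
   x_(-alpha_i)(t).  Elements of G(L) are thus words in these letters, two
   words being the same element when they act equally in every
   finite-dimensional representation of G (see same_elt). *)
Definition gword (L : fieldType) := seq (bool * 'I_4 * L).

Definition letter_act (K L : fieldType) (iota : {rmorphism K -> L}) (n : nat)
    (rho : f4gen -> 'M[K]_n) (x : bool * 'I_4 * L) : 'M[L]_n :=
  let: (s, i, t) := x in
  mx_exp (t *: map_mx iota (rho (if s then Egen i else Fgen i))).

Definition gact (K L : fieldType) (iota : {rmorphism K -> L}) (n : nat)
    (rho : f4gen -> 'M[K]_n) (g : gword L) : 'M[L]_n :=
  foldr (fun x A => letter_act iota rho x *m A) 1%:M g.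

Definition same_elt (K L : fieldType) (iota : {rmorphism K -> L})
    (g g' : gword L) : Prop :=
  forall (n : nat) (rho : f4gen -> 'M[K]_n), f4_rep rho ->
    gact iota rho g = gact iota rho g'.

(* The element alpha_i^vee(t) of the maximal torus, as
   n_i(t) n_i(-1) where n_i(t) = x_i(t) x_{-i}(- t^-1) x_i(t). *)
Definition coroot_word (L : fieldType) (i : 'I_4) (t : L) : gword L :=
  [:: (true, i, t); (false, i, - t^-1); (true, i, t);
      (true, i, -1); (false, i, 1); (true, i, -1)].

Definition parabolic (K L : fieldType) (iota : {rmorphism K -> L}) (k : 'I_4)
    (g : gword L) : Prop :=
  forall (n : nat) (rho : f4gen -> 'M[K]_n) (v : 'cV[K]_n),
    fundamental_rep k rho -> hw_vector rho k v ->
    exists c : L, gact iota rho g *m map_mx iota v = c *: map_mx iota v.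

(* The points of G/P_k are the cosets; G(L)/P_k(L) = (G/P_k)(L). *)
Definition parabolic_coset (K L : fieldType) (iota : {rmorphism K -> L})
    (k : 'I_4) (g : gword L) : gword L -> Prop :=
  fun g' => exists2 p, parabolic iota k p & same_elt iota g' (g ++ p).

(* The Levi subgroup of P_k containing the maximal torus. *)
Inductive levi (L : fieldType) (k : 'I_4) : gword L -> Prop :=
| levi_nil : levi k [::]
| levi_root s i t g : i != k -> levi k g -> levi k ((s, i, t) :: g)
| levi_torus i t g : t != 0 -> levi k g -> levi k (coroot_word i t ++ g).

(* The fiber of R_3 at the base point of G/P_2: the span of the orbit of the
   highest weight vector v under the Levi subgroup. *)
Definition base_fiber (K L : fieldType) (iota : {rmorphism K -> L}) (n : nat)
    (rho : f4gen -> 'M[K]_n) (v : 'cV[K]_n) (x : 'cV[L]_n) : Prop :=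
  exists s : seq (L * gword L), (forall y, y \in s -> levi node2 y.2) /\
    x = \sum_(y <- s) y.1 *: (gact iota rho y.2 *m map_mx iota v).

(* The L-points (phi, g P_2) of the total space of Hom(E, R_3), E = K^r; the
   fiber of R_3 at g P_2 is the translate by g of the base fiber. *)
Definition hom_R3 (K L : fieldType) (iota : {rmorphism K -> L}) (n r : nat)
    (rho : f4gen -> 'M[K]_n) (v : 'cV[K]_n)
    (phi : 'M[L]_(n, r)) (C : gword L -> Prop) : Prop :=
  exists g : gword L, C = parabolic_coset iota node2 g /\
    forall u : 'cV[L]_r, exists2 y, base_fiber iota rho v y &
      phi *m u = gact iota rho g *m y.

Definition inY (K L : fieldType) (iota : {rmorphism K -> L}) (n r : nat)
    (rho : f4gen -> 'M[K]_n) (v : 'cV[K]_n) (phi : 'M[L]_(n, r)) : Prop :=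
  exists C : gword L -> Prop, hom_R3 iota rho v phi C.

(* K[Hom(K^r, K^n)] is {mpoly K[n * r]}: the variable of index mxvec_index a k
   is the (a, k) entry of phi. *)
Definition peval (K L : fieldType) (iota : {rmorphism K -> L}) (n r : nat)
    (p : {mpoly K[n * r]}) (phi : 'M[L]_(n, r)) : L :=
  mmap iota (fun i => mxvec phi 0 i) p.

(* Since Y is reduced, its ideal consists of the polynomials that vanish at its
   points over all field extensions of K. *)
Definition idealY (K : fieldType) (n r : nat) (rho : f4gen -> 'M[K]_n)
    (v : 'cV[K]_n) (p : {mpoly K[n * r]}) : Prop :=
  forall (L : fieldType) (iota : {rmorphism K -> L}) (phi : 'M[L]_(n, r)),
    inY iota rho v phi -> peval iota p phi = 0.

Definition idealY2 (K : fieldType) (n r : nat) (rho : f4gen -> 'M[K]_n)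
    (v : 'cV[K]_n) (p : {mpoly K[n * r]}) : Prop :=
  idealY rho v p /\ p \is 2.-homog.

Definition ideal_span (K : fieldType) (N : nat) (S : {mpoly K[N]} -> Prop)
    (p : {mpoly K[N]}) : Prop :=
  exists s : seq ({mpoly K[N]} * {mpoly K[N]}),
    (forall y, y \in s -> S y.2) /\ p = \sum_(y <- s) y.1 * y.2.

(* The image of S (x) B in Sym^2(E (x) V^* ), for S in E (x) E and B in
   V^* (x) V^*.  It maps isomorphically the pairs (skew, skew) onto
   /\^2 E (x) /\^2 V^* and the pairs (symmetric, symmetric) onto
   Sym^2 E (x) Sym^2 V^*, GL(E) x G-equivariantly. *)
Definition quadric (K : fieldType) (n r : nat) (S : 'M[K]_r) (B : 'M[K]_n) :
    {mpoly K[n * r]} :=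
  \sum_k \sum_l \sum_a \sum_b
     (S k l * B a b) *: ('X_(mxvec_index a k) * 'X_(mxvec_index b l)).

Definition skew_mx (K : fieldType) (n : nat) (A : 'M[K]_n) : Prop := A^T = - A.
Definition sym_mx (K : fieldType) (n : nat) (A : 'M[K]_n) : Prop := A^T = A.

(* j embeds the module sigma in the module V^* (x) V^* of bilinear forms on the
   module V of rho, on which the Lie algebra acts by
   (X B)(x, y) = - B (X x, y) - B (x, X y). *)
Definition form_embedding (K : fieldType) (m n : nat)
    (sigma : f4gen -> 'M[K]_m) (rho : f4gen -> 'M[K]_n)
    (j : {linear 'cV[K]_m -> 'M[K]_n}) : Prop :=
  injective j /\
  forall x w, j (sigma x *m w) = - ((rho x)^T *m j w + j w *m rho x).

(* The subspaces /\^2 E (x) j(W) and Sym^2 E (x) j(W) of the quadrics, for W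
   embedded by j in /\^2 V^*, respectively Sym^2 V^*. *)
Definition ext_quadrics (K : fieldType) (m n r : nat)
    (j : {linear 'cV[K]_m -> 'M[K]_n}) (p : {mpoly K[n * r]}) : Prop :=
  exists s : seq ('M[K]_r * 'cV[K]_m), (forall y, y \in s -> skew_mx y.1) /\
    p = \sum_(y <- s) quadric y.1 (j y.2).

Definition sym_quadrics (K : fieldType) (m n r : nat)
    (j : {linear 'cV[K]_m -> 'M[K]_n}) (p : {mpoly K[n * r]}) : Prop :=
  exists s : seq ('M[K]_r * 'cV[K]_m), (forall y, y \in s -> sym_mx y.1) /\
    p = \sum_(y <- s) quadric y.1 (j y.2).

(* Main.v *)
(* In an explicit model of V, let J be the ideal generated by the quadrics and I
   the ideal of Y.  The forms vanish on the fiber at the base point and span a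
   stable space, whence J <= I.  For the converse, the Casimir element of G acts
   on K[Hom(E, V)] by a differential operator of order 2.  Modulo J, it is a
   combination of the Casimir element of gl(E), of Eu^2 and of Eu, where Eu is
   the Euler field, because this holds for the symbols: the Casimir tensor is
   half the sum of the identity and of the swap of V (x) V, modulo the forms.
   If I is not contained in J, then some p in I but not in J is a highest
   weight vector for gl(E), of weight (l0, l1, l2), and is killed modulo J by the
   f_i, with a weight - mu.  A generic matrix can be column reduced, hence p has
   a monomial avoiding x_01, x_02 and x_12, so that
   l0 w0 + l1 w1 + l2 w2 - mu is a nonnegative combination of simple roots,
   where w0, w1, w2 are the first weights of V.  As mu and (l0, l1, l2) are
   dominant, the two values of the Casimir element agree only if this
   difference is 0.  Then the monomial is x_00^l0 x_11^l1 x_22^l2, and p does not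
   vanish at the point (e_0, e_1, e_2) of Y, a contradiction.  A general V is
   isomorphic to the model: the submodule generated by a pair of highest weight
   vectors is the graph of an isomorphism. *)

From HB Require Import structures.
From Stdlib Require Import Classical.
Require Import Defs.
From mathcomp Require Import all_boot all_order all_algebra.
From mathcomp Require Import mpoly ring zify.
Set Implicit Arguments.
Unset Strict Implicit.
Unset Printing Implicit Defensive.
Import GRing.Theory Num.Theory Order.TTheory.
Local Open Scope ring_scope.

(** * Matrices with integer entries *)

(** Normalize the long roots to squared length 2. The Casimir element acts on V_lambda by (lambda,
    lambda + 2 rho), hence on V by 12, and its tensor acts on a component V_lambda of V (x) V by
    half of (lambda, lambda + 2 rho) - 24. On V_{2 omega_4} and V_{omega_3} this is 1 and 0, the
    values of half of identity plus swap on Sym^2 and /\^2. The remaining components V_{omega_4}, K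
    and V_{omega_1}, with values -6, -12 and -3, are exactly those that the forms cut out; the
    argument rests on this coincidence. A factor 48 keeps everything integral. The two group actions
    are treated differently. Column reduction must preserve the values of p, so the raising
    operators of gl(E) have to kill p itself, while for the f_i it is enough to be killed modulo J.
    Complete reducibility is replaced by products of factors [CE - c], which make a highest weight
    vector modulo J into a true one and act on it modulo J by a nonzero scalar. Finite
    dimensionality is replaced by gradings with values in the natural numbers. *)

Definition ient (A : seq (seq int)) (i j : nat) : int := nth 0 (nth [::] A i) j.

Fixpoint padd T (add : T -> T -> T) (u v : seq T) : seq T :=
  match u, v with
  | [::], _ => v
  | _, [::] => u
  | x :: u', y :: v' => add x y :: padd add u' v'
  end.

Definition ladd : seq (seq int) -> seq (seq int) -> seq (seq int) :=
  padd (padd intZmod.addz).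

Definition lscale (c : int) (A : seq (seq int)) : seq (seq int) :=
  if c == 0 then [::] else map (map (intRing.mulz c)) A.

(** Zero factors are skipped here and in [lscale], and absent rows or entries stand for 0: the
    matrices are sparse, and this keeps their products cheap to evaluate. *)
Fixpoint rowmul (r : seq int) (B : seq (seq int)) : seq int :=
  match r, B with
  | x :: r', b :: B' =>
      if x == 0 then rowmul r' B'
      else padd intZmod.addz (map (intRing.mulz x) b) (rowmul r' B')
  | _, _ => [::]
  end.

Definition lmul (A B : seq (seq int)) := map (fun r => rowmul r B) A.

Definition ltr (n : nat) (A : seq (seq int)) : seq (seq int) :=
  mkseq (fun j => map (fun r => nth 0 r j) A) n.

(** A matrix has many encodings, because trailing zeros may be omitted; hence the test that the
    difference has only zero entries. *)
Definition leqm (A B : seq (seq int)) : bool :=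
  all (all (pred1 0)) (ladd A (lscale (-1) B)).

Lemma nth_padd T (add : T -> T -> T) (z : T) : (forall x, add z x = x) ->
  (forall x, add x z = x) -> forall u v i,
  nth z (padd add u v) i = add (nth z u i) (nth z v i).
Proof.
move=> z1 z2; elim=> [|x u IH] [|y v] [|i] //=; rewrite ?nth_nil ?z1 ?z2 //.
Qed.

Lemma padd0r T (add : T -> T -> T) u : padd add u [::] = u.
Proof. by case: u. Qed.

Lemma size_padd T (add : T -> T -> T) u v :
  size (padd add u v) = maxn (size u) (size v).
Proof.
elim: u v => [|x u IH] [|y v] //=; rewrite ?max0n ?maxn0 //.
by rewrite IH maxnSS.
Qed.

Lemma ient_add A B i j : ient (ladd A B) i j = ient A i j + ient B i j.
Proof.
rewrite /ient /ladd (nth_padd (z := [::])); last exact: padd0r; last by [].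
by rewrite (nth_padd (z := 0)) // => x; [apply: add0r | apply: addr0].
Qed.

Lemma ient_scale c A i j : ient (lscale c A) i j = c * ient A i j.
Proof.
rewrite /ient /lscale; have [->|_] := eqVneq; first by rewrite !nth_nil mul0r.
case: (ltnP i (size A)) => iA; last first.
  by rewrite (nth_default _ iA) nth_nil (nth_default [::]) ?size_map // nth_nil mulr0.
rewrite (nth_map [::]) //; set r := nth _ A i.
case: (ltnP j (size r)) => jr; last by rewrite !nth_default ?size_map // mulr0.
by rewrite (nth_map 0).
Qed.

Lemma nth_rowmul n r B j : (size B <= n)%N ->
  nth 0 (rowmul r B) j = \sum_(k < n) nth 0 r k * ient B k j.
Proof.
elim: r B n => [|x r IH] [|b B] n sB.
- by rewrite nth_nil; apply/esym/big1 => k _; rewrite nth_nil mul0r.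
- by rewrite nth_nil; apply/esym/big1 => k _; rewrite nth_nil mul0r.
- by rewrite nth_nil; apply/esym/big1 => k _; rewrite /ient !nth_nil mulr0.
case: n sB => // n sB; rewrite big_ord_recl.
have := IH B n sB; set s := \sum_(k < n) _ => IHs.
rewrite /=.
case: eqP => [->|_]; first by rewrite mul0r add0r IHs.
rewrite (nth_padd (z := 0)); [|by move=> y; apply: add0r|by move=> y; apply: addr0].
rewrite IHs; congr (_ + _); rewrite /ient /=.
by case: (ltnP j (size b)) => jb; [rewrite (nth_map 0) | rewrite !nth_default ?size_map // mulr0].
Qed.

Lemma ient_mul n A B i j : (size B <= n)%N ->
  ient (lmul A B) i j = \sum_(k < n) ient A i k * ient B k j.
Proof.
move=> sB; rewrite {1}/ient /lmul.
case: (ltnP i (size A)) => iA; last first.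
  rewrite (nth_default _ (_ : size _ <= i)%N) ?size_map // nth_nil big1 // => k _.
  by rewrite /ient (nth_default _ iA) nth_nil mul0r.
by rewrite (nth_map [::]) // (nth_rowmul _ _ sB).
Qed.

Lemma ient_tr n A i j : (i < n)%N -> ient (ltr n A) i j = ient A j i.
Proof.
move=> ltin; rewrite /ient /ltr nth_mkseq //.
case: (ltnP j (size A)) => jA; first by rewrite (nth_map [::]).
by rewrite (nth_default 0) ?size_map // (nth_default [::] jA) nth_nil.
Qed.

Lemma leqmP A B i j : leqm A B -> ient A i j = ient B i j.
Proof.
move=> /allP AB; apply/eqP; rewrite -subr_eq0 -[X in _ - X]mul1r -mulNr.
rewrite -ient_scale -ient_add /ient; set C := ladd _ _ in AB *.
case: (ltnP i (size C)) => iC; last by rewrite (nth_default _ iC) nth_nil.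
have /allP := AB _ (mem_nth [::] iC); set r := nth _ C i => rP.
case: (ltnP j (size r)) => jr; last by rewrite nth_default.
exact: rP (mem_nth 0 jr).
Qed.

(* Expressions in integer matrices; they are evaluated both over a ring and on
   lists of rows, where identities are decided by computation. *)
Inductive mexp :=
| MZ of seq (seq int)
| MAdd of mexp & mexp
| MMul of mexp & mexp
| MScale of int & mexp
| MTr of mexp.

Section MatrixExpressions.
Variables (R : pzRingType) (n : nat).

Definition zmx (A : seq (seq int)) : 'M[R]_n := \matrix_(i, j) (ient A i j)%:~R.

Fixpoint meval_mx (e : mexp) : 'M[R]_n :=
  match e with
  | MZ A => zmx A
  | MAdd a b => meval_mx a + meval_mx b
  | MMul a b => meval_mx a *m meval_mx b
  | MScale c a => c%:~R *: meval_mx a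
  | MTr a => (meval_mx a)^T
  end.

(** Truncating the data to [n] rows gives [size_meval_seq], which lets the sum in [ient_mul] run
    over ['I_n]. *)
Fixpoint meval_seq (e : mexp) : seq (seq int) :=
  match e with
  | MZ A => take n A
  | MAdd a b => ladd (meval_seq a) (meval_seq b)
  | MMul a b => lmul (meval_seq a) (meval_seq b)
  | MScale c a => lscale c (meval_seq a)
  | MTr a => ltr n (meval_seq a)
  end.

Lemma size_meval_seq e : (size (meval_seq e) <= n)%N.
Proof.
elim: e => [A|a IHa b IHb|a IHa b IHb|c a IHa|a IHa] /=.
- by rewrite size_take; case: ltnP.
- by rewrite size_padd geq_max IHa IHb.
- by rewrite size_map.
- by rewrite /lscale; case: ifP => // _; rewrite size_map.
- by rewrite size_mkseq.
Qed.

Lemma meval_mxE e (i j : 'I_n) : meval_mx e i j = (ient (meval_seq e) i j)%:~R.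
Proof.
elim: e i j => [A|a IHa b IHb|a IHa b IHb|c a IHa|a IHa] i j /=.
- by rewrite mxE /ient nth_take.
- by rewrite mxE IHa IHb ient_add intrD.
- rewrite mxE (ient_mul _ _ _ (size_meval_seq b)) rmorph_sum.
  by apply: eq_bigr => k _; rewrite IHa IHb -intrM.
- by rewrite mxE IHa ient_scale intrM.
- by rewrite mxE IHa ient_tr.
Qed.

Lemma mx_reflect e1 e2 : leqm (meval_seq e1) (meval_seq e2) ->
  meval_mx e1 = meval_mx e2.
Proof.
by move=> e12; apply/matrixP => i j; rewrite !meval_mxE (leqmP _ _ e12).
Qed.

Definition MBrk a b := MAdd (MMul a b) (MScale (-1) (MMul b a)).

Lemma meval_brk a b : meval_mx (MBrk a b) = brk (meval_mx a) (meval_mx b).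
Proof. by rewrite /brk /= scaleN1r. Qed.

Definition MSum (T : Type) (s : seq T) (F : T -> mexp) : mexp :=
  foldr (fun x e => MAdd (F x) e) (MZ [::]) s.

Lemma zmx0 : zmx [::] = 0.
Proof. by apply/matrixP => i j; rewrite !mxE /ient !nth_nil. Qed.

Lemma meval_sum (T : Type) (s : seq T) F :
  meval_mx (MSum s F) = \sum_(x <- s) meval_mx (F x).
Proof.
by elim: s => [|x s IH] /=; rewrite ?big_nil ?zmx0 // big_cons IH.
Qed.

End MatrixExpressions.

Definition lookup (s : seq (nat * nat * int)) (i j : nat) : int :=
  foldr (fun t acc => if (t.1.1 == i) && (t.1.2 == j) then t.2 else acc) 0 s.

Definition dense (n : nat) (s : seq (nat * nat * int)) : seq (seq int) :=
  mkseq (fun i => let r := filter (fun t => t.1.1 == i) s in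
                  mkseq (lookup r i) n) n.

Definition ldiag (n : nat) (f : nat -> int) : seq (seq int) :=
  mkseq (fun i => mkseq (fun j => if i == j then f i else 0) n) n.

Lemma zmx_diag (R : pzRingType) n f (i j : 'I_n) :
  zmx R n (ldiag n f) i j = if i == j then (f i)%:~R else 0.
Proof. by rewrite mxE /ient /ldiag !nth_mkseq //= -val_eqE; case: ifP. Qed.

Definition cartN (i j : nat) : int :=
  nth 0 (nth [::] [:: [:: 2; -1;  0;  0];
                     [:: -1; 2; -2;  0];
                     [:: 0; -1;  2; -1];
                     [:: 0;  0; -1;  2]] i) j.

Lemma cartanE (i j : 'I_4) : cartanF4 i j = cartN i j.
Proof. by []. Qed.

(** * Deciding the Serre relations by computation *)

Section CheckRep.
Variables (n : nat) (e f h : nat -> mexp).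

Definition f4_check : bool :=
  let eqm a b := leqm (meval_seq n a) (meval_seq n b) in
  let Z := MZ [::] in
  all (fun i => all (fun j =>
    [&& eqm (MBrk (h i) (h j)) Z,
        eqm (MBrk (e i) (f j)) (if i == j then h i else Z),
        eqm (MBrk (h i) (e j)) (MScale (cartN j i) (e j)),
        eqm (MBrk (h i) (f j)) (MScale (- cartN j i) (f j)) &
        (i != j) ==>
          eqm (iter `|1 - cartN j i|%N (MBrk (e i)) (e j)) Z &&
          eqm (iter `|1 - cartN j i|%N (MBrk (f i)) (f j)) Z])
  (iota 0 4)) (iota 0 4).

Definition rep_of (R : pzRingType) (x : f4gen) : 'M[R]_n :=
  meval_mx R n (match x with Egen i => e i | Fgen i => f i | Hgen i => h i end).

Lemma f4_checkP (K : fieldType) : f4_check -> f4_rep (rep_of K).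
Proof.
move=> chk.
have mi (i : 'I_4) : (i : nat) \in iota 0 4 by rewrite mem_iota /= add0n.
have it k a b : meval_mx K n (iter k (MBrk a) b) =
    iter k (brk (meval_mx K n a)) (meval_mx K n b).
  by elim: k => //= k IH; rewrite -[LHS]/(meval_mx K n (MBrk _ _)) meval_brk IH.
have chk2 (i j : 'I_4) := allP (allP chk _ (mi i)) _ (mi j).
split=> [i j|i j|i j|i j ij]; have /and5P[c1 c2 c3 c4 c5] := chk2 i j.
- by rewrite /= -meval_brk (mx_reflect _ c1) /= zmx0.
- rewrite -meval_brk (mx_reflect _ c2) -val_eqE; case: ifP => //= _.
  exact: zmx0.
- rewrite -!meval_brk (mx_reflect _ c3) (mx_reflect _ c4) /= mulrNz.
  by rewrite -cartanE.
- have /andP[c6 c7] := implyP c5 ij.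
  by rewrite cartanE -!it (mx_reflect _ c6) (mx_reflect _ c7) /= zmx0.
Qed.

End CheckRep.

(** * An irreducibility criterion for graded modules *)

Section GradedModule.
Variables (K : fieldType) (n : nat) (rho : f4gen -> 'M[K]_n.+1).

Lemma stable_rowP U (u : 'rV_n.+1) x : stable_space rho U ->
  (u <= U)%MS -> (u *m (rho x)^T <= U)%MS.
Proof. by move=> stU uU; apply: submx_trans (stU x); apply: submxMr. Qed.

(* Any vector killed by all the e_i is a multiple of the first basis vector,
   which generates the module under the f_i. *)
Lemma graded_irreducible (lev : 'I_n.+1 -> nat) (L : 'I_4 -> 'M[K]_n.+1) (c : K) :
  c != 0 ->
  (forall i a b, rho (Egen i) a b != 0 -> lev b = (lev a).+1) ->
  \sum_i L i *m rho (Egen i) = c *: (1%:M - delta_mx ord0 ord0) ->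
  (forall a : 'I_n.+1, a != ord0 -> exists i (b : 'I_n.+1) k,
     [/\ (b < a)%N, k != 0 & col b (rho (Fgen i)) = k *: delta_mx a 0]) ->
  irreducible_rep rho.
Proof.
move=> c0 levE Lsum gen; split=> // U stU.
have [->|] := eqVneq U 0; [by left | move=> U0; right].
have killed (u : 'rV_n.+1) : (forall i, u *m (rho (Egen i))^T = 0) ->
    u = u 0 ord0 *: delta_mx 0 ord0.
  move=> ue; have : u *m (\sum_i L i *m rho (Egen i))^T = 0.
    rewrite raddf_sum mulmx_sumr big1 // => i _.
    by rewrite /= trmx_mul mulmxA ue mul0mx.
  rewrite Lsum linearZ /= -scalemxAr => /eqP; rewrite scaler_eq0 (negPf c0) /=.
  rewrite linearB /= trmx1 trmx_delta mulmxBr mulmx1 subr_eq0 => /eqP uE.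
  rewrite {1}uE; apply/rowP => a; rewrite !mxE (bigD1 ord0) //= big1 => [|b b0].
    by rewrite !mxE !eqxx /= addr0.
  by rewrite !mxE (negPf b0) mulr0.
have hit (u : 'rV_n.+1) i a : (u *m (rho (Egen i))^T) 0 a != 0 ->
    exists2 b, u 0 b != 0 & rho (Egen i) a b != 0.
  move=> ua; have [/existsP[b /andP[]]|/existsPn nob] :=
    boolP [exists b, (u 0 b != 0) && (rho (Egen i) a b != 0)]; first by exists b.
  case/eqP: ua; rewrite mxE big1 // => b _; rewrite mxE.
  by move: (nob b); rewrite negb_and !negbK => /orP[] /eqP ->; rewrite ?mul0r ?mulr0.
have e0U : (delta_mx (0 : 'I_1) ord0 <= U)%MS.
  have fin (u : 'rV_n.+1) : (u <= U)%MS -> u != 0 ->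
      (forall i, u *m (rho (Egen i))^T = 0) -> (delta_mx (0 : 'I_1) ord0 <= U)%MS.
    move=> uU u0 /killed uE; have u00 : u 0 ord0 != 0.
      by apply: contraNneq u0 => u00; rewrite uE u00 scale0r.
    by rewrite -[delta_mx _ _](scalerK u00) -uE scalemx_sub.
  have [u uU u0] : exists2 u : 'rV_n.+1, (u <= U)%MS & u != 0.
    have /existsP[i Ui] : [exists i, row i U != 0].
      apply: contraNT U0 => /existsPn Ui; apply/eqP/row_matrixP => i.
      by rewrite row0; apply/eqP; move: (Ui i); rewrite negbK.
    by exists (row i U); rewrite ?row_sub.
  have : forall a, u 0 a != 0 -> (lev a <= \max_a lev a)%N.
    by move=> a _; apply: leq_bigmax.
  (* Each application of some e_i lowers the levels in the support by one, so a nonzero vector of U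
     killed by all the e_i is reached after finitely many steps. *)
  elim: (\max_a lev a)%N u uU u0 => [|d IH] u uU u0 ud.
    apply: (fin u) => // i; apply/rowP => a; rewrite [RHS]mxE.
    apply/eqP/negPn/negP => /hit[b ub eb].
    by move: (ud b ub); rewrite (levE _ _ _ eb).
  have [/existsP[i ui]|/existsPn ue] := boolP [exists i, u *m (rho (Egen i))^T != 0].
    apply: (IH _ (stable_rowP _ stU uU) ui) => a /hit[b ub eb].
    by move: (ud b ub); rewrite (levE _ _ _ eb).
  by apply: (fin u) => // i; apply/eqP; move: (ue i); rewrite negbK.
have eU (a : 'I_n.+1) : (delta_mx (0 : 'I_1) a <= U)%MS.
  have [m] := ubnP a; elim: m a => // m IH a am.
  have [->//|a0] := eqVneq a ord0.
  have [i [b [k [ba k0 colb]]]] := gen a a0.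
  have -> : delta_mx (0 : 'I_1) a =
      k^-1 *: (delta_mx (0 : 'I_1) b *m (rho (Fgen i))^T).
    apply: trmx_inj; rewrite linearZ /= trmx_mul trmxK !trmx_delta -colE colb.
    by rewrite scalerA mulVf // scale1r.
  apply: scalemx_sub; apply: stable_rowP => //; apply: IH.
  by apply: leq_trans ba _; rewrite -ltnS.
by rewrite -sub1mx; apply/row_subP => a; rewrite row1; apply: eU.
Qed.

End GradedModule.

(** * Explicit models of the modules *)

(* The entry c in row i and column j of a sparse matrix is encoded by (i, j, c). *)
Definition e26_data : seq (seq (nat * nat * int)) := [::
  [:: (3,4,1); (5,6,1); (7,8,1); (16,18,1); (19,20,1); (21,22,1)];
  [:: (2,3,1); (6,9,1); (8,10,1); (14,16,1); (17,19,1); (22,23,1)];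
  [:: (1,2,1); (3,5,1); (4,6,1); (9,11,1); (10,12,2); (10,13,1); (12,14,1); (15,17,1);
    (19,21,1); (20,22,1); (23,24,1)];
  [:: (0,1,1); (5,7,1); (6,8,1); (9,10,1); (11,12,1); (11,13,2); (13,15,1); (14,17,1);
    (16,19,1); (18,20,1); (24,25,1)]].
Definition f26_data : seq (seq (nat * nat * int)) := [::
  [:: (4,3,1); (6,5,1); (8,7,1); (18,16,1); (20,19,1); (22,21,1)];
  [:: (3,2,1); (9,6,1); (10,8,1); (16,14,1); (19,17,1); (23,22,1)];
  [:: (2,1,1); (5,3,1); (6,4,1); (11,9,1); (12,10,1); (14,12,2); (14,13,1); (17,15,1);
    (21,19,1); (22,20,1); (24,23,1)];
  [:: (1,0,1); (7,5,1); (8,6,1); (10,9,1); (13,11,1); (15,12,1); (15,13,2); (17,14,1);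
    (19,16,1); (20,18,1); (25,24,1)]].
Definition e52_data : seq (seq (nat * nat * int)) := [::
  [:: (0,1,1); (6,8,1); (9,11,1); (12,14,1); (13,15,1); (16,17,1); (19,20,1); (22,24,2);
    (22,25,1); (24,28,1); (29,32,1); (33,35,1); (36,38,1); (37,39,1); (40,41,1); (43,44,1);
    (50,51,1)];
  [:: (1,2,1); (4,6,1); (7,9,1); (10,12,1); (15,18,1); (17,21,1); (19,22,1); (20,24,1);
    (20,25,2); (20,26,2); (25,29,1); (28,32,1); (30,33,1); (34,36,1); (39,42,1); (41,45,1);
    (44,46,1); (49,50,1)];
  [:: (2,3,2); (3,4,1); (5,7,1); (9,13,1); (11,15,1); (12,16,2); (14,17,2); (16,19,1);
    (17,20,1); (18,23,1); (21,25,1); (21,26,2); (21,27,1); (26,30,1); (29,33,2); (31,34,1);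
    (32,35,2); (33,37,1); (35,39,1); (36,40,1); (38,41,1); (45,47,1); (46,48,2); (48,49,1)];
  [:: (3,5,1); (4,7,2); (6,9,2); (7,10,1); (8,11,2); (9,12,1); (11,14,1); (13,16,1); (15,17,1);
    (18,21,1); (23,26,1); (23,27,2); (27,31,1); (30,34,1); (33,36,1); (35,38,1); (37,40,2);
    (39,41,2); (40,43,1); (41,44,1); (42,45,2); (45,46,1); (47,48,1)]].
Definition f52_data : seq (seq (nat * nat * int)) := [::
  [:: (1,0,1); (8,6,1); (11,9,1); (14,12,1); (15,13,1); (17,16,1); (20,19,1); (24,22,1);
    (28,24,2); (28,25,1); (32,29,1); (35,33,1); (38,36,1); (39,37,1); (41,40,1); (44,43,1);
    (51,50,1)];
  [:: (2,1,1); (6,4,1); (9,7,1); (12,10,1); (18,15,1); (21,17,1); (22,19,1); (25,20,1);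
    (29,24,1); (29,25,2); (29,26,2); (32,28,1); (33,30,1); (36,34,1); (42,39,1); (45,41,1);
    (46,44,1); (50,49,1)];
  [:: (3,2,1); (4,3,2); (7,5,1); (13,9,1); (15,11,1); (16,12,1); (17,14,1); (19,16,2);
    (20,17,2); (23,18,1); (26,21,1); (30,25,1); (30,26,2); (30,27,1); (33,29,1); (34,31,1);
    (35,32,1); (37,33,2); (39,35,2); (40,36,1); (41,38,1); (47,45,1); (48,46,1); (49,48,2)];
  [:: (5,3,1); (7,4,1); (9,6,1); (10,7,2); (11,8,1); (12,9,2); (14,11,2); (16,13,1); (17,15,1);
    (21,18,1); (27,23,1); (31,26,1); (31,27,2); (34,30,1); (36,33,1); (38,35,1); (40,37,1);
    (41,39,1); (43,40,2); (44,41,2); (45,42,1); (46,45,2); (48,47,1)]].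
Definition wt26 : seq (seq int) := [::
  [:: 0; 0; 0; 1]; [:: 0; 0; 1; -1]; [:: 0; 1; -1; 0]; [:: 1; -1; 1; 0]; [:: -1; 0; 1; 0]; [::
  1; 0; -1; 1]; [:: -1; 1; -1; 1]; [:: 1; 0; 0; -1]; [:: -1; 1; 0; -1]; [:: 0; -1; 1; 1]; [:: 0;
  -1; 2; -1]; [:: 0; 0; -1; 2]; [:: 0; 0; 0; 0]; [:: 0; 0; 0; 0]; [:: 0; 1; -2; 1]; [:: 0; 0; 1;
  -2]; [:: 1; -1; 0; 1]; [:: 0; 1; -1; -1]; [:: -1; 0; 0; 1]; [:: 1; -1; 1; -1]; [:: -1; 0; 1;
  -1]; [:: 1; 0; -1; 0]; [:: -1; 1; -1; 0]; [:: 0; -1; 1; 0]; [:: 0; 0; -1; 1]; [:: 0; 0; 0;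
  -1]].
Definition wt52 : seq (seq int) := [::
  [:: 1; 0; 0; 0]; [:: -1; 1; 0; 0]; [:: 0; -1; 2; 0]; [:: 0; 0; 0; 1]; [:: 0; 1; -2; 2]; [:: 0;
  0; 1; -1]; [:: 1; -1; 0; 2]; [:: 0; 1; -1; 0]; [:: -1; 0; 0; 2]; [:: 1; -1; 1; 0]; [:: 0; 1;
  0; -2]; [:: -1; 0; 1; 0]; [:: 1; -1; 2; -2]; [:: 1; 0; -1; 1]; [:: -1; 0; 2; -2]; [:: -1; 1;
  -1; 1]; [:: 1; 0; 0; -1]; [:: -1; 1; 0; -1]; [:: 0; -1; 1; 1]; [:: 1; 1; -2; 0]; [:: -1; 2;
  -2; 0]; [:: 0; -1; 2; -1]; [:: 2; -1; 0; 0]; [:: 0; 0; -1; 2]; [:: 0; 0; 0; 0]; [:: 0; 0; 0;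
  0]; [:: 0; 0; 0; 0]; [:: 0; 0; 0; 0]; [:: -2; 1; 0; 0]; [:: 1; -2; 2; 0]; [:: 0; 1; -2; 1];
  [:: 0; 0; 1; -2]; [:: -1; -1; 2; 0]; [:: 1; -1; 0; 1]; [:: 0; 1; -1; -1]; [:: -1; 0; 0; 1];
  [:: 1; -1; 1; -1]; [:: 1; 0; -2; 2]; [:: -1; 0; 1; -1]; [:: -1; 1; -2; 2]; [:: 1; 0; -1; 0];
  [:: -1; 1; -1; 0]; [:: 0; -1; 0; 2]; [:: 1; 0; 0; -2]; [:: -1; 1; 0; -2]; [:: 0; -1; 1; 0];
  [:: 0; -1; 2; -2]; [:: 0; 0; -1; 1]; [:: 0; 0; 0; -1]; [:: 0; 1; -2; 0]; [:: 1; -1; 0; 0]; [::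
  -1; 0; 0; 0]].
(* The entry (i, b, c) at position a - 1 says that f_i maps the b-th basis
   vector to c times the a-th one. *)
Definition path26 : seq (nat * nat * int) := [::
  (3,0,1); (2,1,1); (1,2,1); (0,3,1); (2,3,1); (0,5,1); (3,5,1); (0,7,1); (1,6,1); (1,8,1);
  (2,9,1); (2,10,1); (3,11,1); (2,12,2); (3,13,2); (1,14,1); (2,15,1); (0,16,1); (1,17,1);
  (0,19,1); (2,19,1); (0,21,1); (1,22,1); (2,23,1); (3,24,1)].
Definition path52 : seq (nat * nat * int) := [::
  (0,0,1); (1,1,1); (2,2,1); (2,3,2); (3,3,1); (1,4,1); (2,5,1); (0,6,1); (1,7,1); (3,7,2);
  (0,9,1); (1,10,1); (2,9,1); (0,12,1); (0,13,1); (2,12,1); (0,16,1); (1,15,1); (2,16,2);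
  (0,19,1); (1,17,1); (1,19,1); (2,18,1); (0,22,1); (1,20,1); (2,21,1); (3,23,1); (0,24,2);
  (1,25,2); (2,26,2); (3,27,2); (0,29,1); (1,30,1); (2,31,1); (0,33,1); (1,34,1); (2,33,2);
  (0,36,1); (0,37,1); (2,36,1); (0,40,1); (1,39,1); (3,40,2); (0,43,1); (1,41,1); (1,44,1);
  (2,45,1); (2,46,1); (2,48,2); (1,49,1); (0,50,1)].

(* Matrices L_i such that the sum of the L_i e_i is 6 (1 - E_00). *)
Definition L26_data : seq (seq (nat * nat * int)) := [::
  [:: (4,3,6); (6,5,6); (8,7,6); (18,16,6); (20,19,6); (22,21,6)];
  [:: (3,2,6); (9,6,6); (10,8,6); (16,14,6); (19,17,6); (23,22,6)];
  [:: (2,1,6); (5,3,6); (11,9,6); (12,10,4); (13,10,-2); (14,12,6); (17,15,6); (21,19,6);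
    (24,23,6)];
  [:: (1,0,6); (7,5,6); (12,11,-2); (13,11,4); (15,13,6); (25,24,6)]].
Definition L52_data : seq (seq (nat * nat * int)) := [::
  [:: (1,0,6); (8,6,6); (11,9,6); (14,12,6); (15,13,6); (17,16,6); (20,19,6); (24,22,12);
    (25,22,-18); (26,22,12); (27,22,-6); (28,24,6); (32,29,6); (35,33,6); (38,36,6); (39,37,6);
    (41,40,6); (44,43,6); (51,50,6)];
  [:: (2,1,6); (6,4,6); (9,7,6); (12,10,6); (18,15,6); (21,17,6); (22,19,6); (24,20,-18);
    (25,20,36); (26,20,-24); (27,20,12); (29,25,6); (33,30,6); (36,34,6); (42,39,6); (45,41,6);
    (46,44,6); (50,49,6)];
  [:: (3,2,3); (4,3,6); (7,5,6); (13,9,6); (16,12,3); (19,16,6); (23,18,6); (24,21,24);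
    (25,21,-48); (26,21,36); (27,21,-18); (30,26,6); (34,31,6); (37,33,6); (40,36,6); (47,45,6);
    (48,46,3); (49,48,6)];
  [:: (5,3,6); (10,7,6); (24,23,-12); (25,23,24); (26,23,-18); (27,23,12); (31,27,6); (43,40,6)]].
(** A form with an entry at (a, b) has there minus the sum of the a-th and b-th weights of V as its
    weight: omega_1 for this skew form, omega_4 and 0 for the two symmetric ones that follow. *)
Definition form52_hw : seq (nat * nat * int) := [:: (25,18,-1); (24,20,1); (23,22,-1);
  (22,23,1); (20,24,-1); (18,25,1)].
Definition form26_hw : seq (nat * nat * int) := [:: (25,13,1); (24,15,-1); (23,17,1);
  (22,19,-1); (21,20,1); (20,21,1); (19,22,-1); (17,23,1); (15,24,-1); (13,25,1)].
Definition form1_hw : seq (nat * nat * int) :=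
  [:: (25,0,1); (24,1,-1); (23,2,1); (22,3,-1); (21,4,1); (20,5,1); (19,6,-1); (18,7,-1);
    (16,8,1); (17,9,1); (14,10,-1); (15,11,-1); (12,12,2); (13,12,1); (12,13,1); (13,13,2);
    (10,14,-1); (11,15,-1); (8,16,1); (9,17,1); (7,18,-1); (6,19,-1); (5,20,1); (4,21,1);
    (3,22,-1); (2,23,1); (1,24,-1); (0,25,1)].
(* The entry (i, u) at position t - 4 says that the root vectors of index t are
   the brackets of e_i, respectively f_i, with those of index u. *)
Definition root_rec : seq (nat * nat) := [::
  (1,0); (2,1); (3,2); (2,4); (2,5); (3,5); (2,7); (3,7); (3,8); (1,10); (3,10); (3,12); (3,13);
  (3,14); (2,16); (3,16); (3,18); (2,20); (1,21); (0,22)].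
(* 48 times the Casimir element is the sum of the root_coef_t (e_t f_t + f_t e_t)
   and of the 24 weight_gram_ij h_i h_j. *)
Definition root_coef : seq int := [::
  48; 48; 24; 24; -48; -24; -24; 24; 12; 24; -12; -24; -6; 12; 6; 3; -6; -3; 6; 3; -6; 3; -3; 3].
Definition weight_gram : seq (seq int) := [:: [:: 4; 6; 4; 2]; [:: 6; 12; 8; 4]; [:: 4; 8; 6;
  3]; [:: 2; 4; 3; 2]].
(* The t-th functional takes the value 6 at the t-th form and 0 at the others. *)
Definition dual52 : seq (seq (nat * nat * int)) := [::
  [:: (18,25,6)]; [:: (16,25,-6)]; [:: (14,25,6)]; [:: (12,25,-3)]; [:: (10,25,6)]; [::
    (11,25,6)]; [:: (8,25,-6)]; [:: (9,25,-6)]; [:: (7,25,6)]; [:: (6,25,6)]; [:: (9,24,6)]; [::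
    (5,25,-6)]; [:: (6,24,-6)]; [:: (4,25,-6)]; [:: (5,24,6)]; [:: (3,25,6)]; [:: (4,24,6)]; [::
    (3,24,-6)]; [:: (2,25,-6)]; [:: (4,23,-6)]; [:: (3,23,6)]; [:: (2,24,6)]; [:: (4,22,6)]; [::
    (1,25,6)]; [:: (2,23,6); (3,22,-6)]; [:: (0,25,-6); (1,24,6); (2,23,-6)]; [:: (0,25,6);
    (1,24,-6)]; [:: (0,25,-6)]; [:: (3,21,6)]; [:: (2,22,6)]; [:: (1,23,6)]; [:: (0,24,6)]; [::
    (2,21,-6)]; [:: (1,22,-6)]; [:: (0,23,-6)]; [:: (1,21,6)]; [:: (0,22,6)]; [:: (1,20,6)]; [::
    (0,21,-6)]; [:: (1,19,-6)]; [:: (0,20,-6)]; [:: (0,19,6)]; [:: (1,17,6)]; [:: (0,18,6)]; [::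
    (0,16,-6)]; [:: (0,17,-6)]; [:: (0,14,6)]; [:: (0,15,6)]; [:: (0,12,-3)]; [:: (0,10,6)]; [::
    (0,8,-6)]; [:: (0,7,6)]].
Definition dual27 : seq (seq (nat * nat * int)) := [::
  [:: (13,25,6)]; [:: (11,25,-6)]; [:: (9,25,6)]; [:: (6,25,-6)]; [:: (5,25,6)]; [:: (4,25,6)];
    [:: (3,25,-6)]; [:: (4,24,-6)]; [:: (3,24,6)]; [:: (2,25,6)]; [:: (2,24,-6)]; [::
    (1,25,-6)]; [:: (0,25,-2); (1,24,2); (2,23,4)]; [:: (0,25,4); (1,24,2); (2,23,-2)]; [::
    (1,23,-6)]; [:: (0,24,-6)]; [:: (1,22,6)]; [:: (0,23,6)]; [:: (1,21,-6)]; [:: (0,22,-6)];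
    [:: (0,21,6)]; [:: (0,20,6)]; [:: (0,19,-6)]; [:: (0,17,6)]; [:: (0,15,-6)]; [:: (0,13,6)];
    [:: (0,25,2); (1,24,-2); (2,23,2)]].
(* The differences of omega_4 and of the weights of V, in simple roots. *)
Definition root26 : seq (seq int) := [::
  [:: 0; 0; 0; 0]; [:: 0; 0; 0; 1]; [:: 0; 0; 1; 1]; [:: 0; 1; 1; 1]; [:: 1; 1; 1; 1]; [:: 0; 1;
  2; 1]; [:: 1; 1; 2; 1]; [:: 0; 1; 2; 2]; [:: 1; 1; 2; 2]; [:: 1; 2; 2; 1]; [:: 1; 2; 2; 2];
  [:: 1; 2; 3; 1]; [:: 1; 2; 3; 2]; [:: 1; 2; 3; 2]; [:: 1; 2; 4; 2]; [:: 1; 2; 3; 3]; [:: 1; 3;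
  4; 2]; [:: 1; 2; 4; 3]; [:: 2; 3; 4; 2]; [:: 1; 3; 4; 3]; [:: 2; 3; 4; 3]; [:: 1; 3; 5; 3];
  [:: 2; 3; 5; 3]; [:: 2; 4; 5; 3]; [:: 2; 4; 6; 3]; [:: 2; 4; 6; 4]].

Definition e26 (i : nat) := dense 26 (nth [::] e26_data i).
Definition f26 (i : nat) := dense 26 (nth [::] f26_data i).
Definition h26 (i : nat) := ldiag 26 (fun a => ient wt26 a i).
Definition e52 (i : nat) := dense 52 (nth [::] e52_data i).
Definition f52 (i : nat) := dense 52 (nth [::] f52_data i).
Definition h52 (i : nat) := ldiag 52 (fun a => ient wt52 a i).

Definition rho26 (R : pzRingType) : f4gen -> 'M[R]_26 :=
  rep_of 26 (fun i => MZ (e26 i)) (fun i => MZ (f26 i)) (fun i => MZ (h26 i)) R.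
Definition rho52 (R : pzRingType) : f4gen -> 'M[R]_52 :=
  rep_of 52 (fun i => MZ (e52 i)) (fun i => MZ (f52 i)) (fun i => MZ (h52 i)) R.

Lemma rho26_rep (K : fieldType) : f4_rep (rho26 K).
Proof. by apply: f4_checkP; vm_compute. Qed.

Lemma rho52_rep (K : fieldType) : f4_rep (rho52 K).
Proof. by apply: f4_checkP; vm_compute. Qed.

Lemma intr_eq0_char0 (K : fieldType) (c : int) :
  [pchar K] =i pred0 -> (c%:~R == 0 :> K) = (c == 0).
Proof.
move=> charK; have c0 := (pcharf0P K).1 charK.
case: c => m; first by rewrite -[_%:~R]/(m%:R) c0.
by rewrite NegzE mulrNz oppr_eq0 -[_%:~R]/(m.+1%:R) c0.
Qed.

(** The depth of each basis vector along [path] serves as the grading in [graded_irreducible]. *)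
Fixpoint levels (path : seq (nat * nat * int)) (acc : seq nat) : seq nat :=
  match path with
  | [::] => acc
  | t :: p => levels p (rcons acc (nth 0%N acc t.1.2).+1)
  end.

(** * Certificates for irreducible highest weight modules *)

Section HighestWeightCheck.
Variables (n : nat) (e f : nat -> seq (seq int)) (wt : seq (seq int)).
Variables (path : seq (nat * nat * int)) (L : nat -> seq (seq int)) (k : nat).

Definition hw_check : bool :=
  let lev := nth 0%N (levels path [:: 0%N]) in
  let N := n.+1 in
  [&& all (fun i => let E := e i in all (fun a => all (fun b =>
        (ient E a b != 0) ==> (lev b == (lev a).+1)) (iota 0 N)) (iota 0 N)) (iota 0 4),
      all (fun i => ient wt 0 i == (i == k)%:Z) (iota 0 4),
      all (fun a => let t := nth (0%N, 0%N, 0) path a.-1 in let F := f t.1.1 in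
        [&& t.2 != 0, (t.1.2 < a)%N, (t.1.1 < 4)%N &
         all (fun b => ient F b t.1.2 == if b == a then t.2 else 0)
           (iota 0 N)]) (iota 1 n) &
      leqm (meval_seq N (MSum (iota 0 4) (fun i => MMul (MZ (L i)) (MZ (e i)))))
           (meval_seq N (MZ (ldiag N (fun a => if a == 0%N then 0 else 6))))].

Definition rep_data R := rep_of n.+1 (fun i => MZ (e i)) (fun i => MZ (f i))
  (fun i => MZ (ldiag n.+1 (fun a => ient wt a i))) R.

Lemma mem_iota0 N (a : 'I_N) : (a : nat) \in iota 0 N.
Proof. by rewrite mem_iota add0n /=. Qed.

Lemma hw_checkP (K : fieldType) : [pchar K] =i pred0 -> hw_check ->
  irreducible_rep (rep_data K) /\
  forall j : 'I_4, j = k :> nat -> hw_vector (rep_data K) j (delta_mx ord0 0).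
Proof.
move=> charK /and4P[levE wt0 gen Lsum].
have eE i (a b : 'I_n.+1) : rep_data K (Egen i) a b != 0 ->
    nth 0%N (levels path [:: 0%N]) b = (nth 0%N (levels path [:: 0%N]) a).+1.
  rewrite mxE intr_eq0_char0 // => nz; apply/eqP.
  have /allP/(_ _ (mem_iota0 a))/allP/(_ _ (mem_iota0 b)) :=
    allP levE _ (mem_iota0 i).
  by move=> /implyP; apply.
split; last first.
  move=> j jk; split.
  - apply/negP => /eqP/matrixP/(_ ord0 0) /eqP.
    by rewrite !mxE !eqxx /= oner_eq0.
  - move=> i; rewrite -colE; apply/colP => a; rewrite mxE [RHS]mxE.
    apply/eqP/negPn/negP => /eE.
    suff -> : nth 0%N (levels path [:: 0%N]) (ord0 : 'I_n.+1) = 0%N by [].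
    suff h p acc : (0 < size acc)%N -> nth 0%N (levels p acc) 0 = nth 0%N acc 0.
      exact: h.
    elim: p acc => //= t p IH acc acc0; rewrite IH ?size_rcons //.
    by rewrite nth_rcons acc0.
  - move=> i; rewrite -colE; apply/colP => a; rewrite mxE /= zmx_diag !mxE andbT.
    case: eqP => [->|]; last by rewrite mulr0.
    rewrite (eqP (allP wt0 _ (mem_iota0 i))) mulr1 -val_eqE /= jk.
    by case: eqP.
apply: (@graded_irreducible _ _ _ (fun a => nth 0%N (levels path [:: 0%N]) a)
  (fun i => zmx K n.+1 (L i)) 6%:~R _ eE).
- by rewrite intr_eq0_char0.
- have LE := mx_reflect K Lsum; rewrite meval_sum in LE.
  rewrite !big_ord_recl big_ord0 -[RHS]addr0; move: LE.
  rewrite [iota 0 4]/= !big_cons big_nil => ->; rewrite addr0.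
  apply/matrixP => a b; rewrite zmx_diag !mxE -!val_eqE /=.
  have [<-|ab] := eqVneq (a : nat) b.
    by case: eqP => _; rewrite ?subrr ?mulr0 // subr0 mulr1.
  case: eqP => [a0|_]; last by rewrite subr0 mulr0.
  by rewrite a0 in ab; rewrite eq_sym (negPf ab) subr0 mulr0.
move=> a a0; have a1 : (a : nat) \in iota 1 n.
  by rewrite mem_iota lt0n -[0%N]/(val (ord0 : 'I_n.+1)) val_eqE a0 /= add1n.
move/allP: gen => /(_ _ a1); set t := nth _ path _.
move=> /and4P[t0 ta t4 /allP fE].
have tn : (t.1.2 < n.+1)%N by apply: ltn_trans ta _.
exists (Ordinal t4), (Ordinal tn), t.2%:~R; split; rewrite ?intr_eq0_char0 //.
apply/colP => b; rewrite !mxE andbT (eqP (fE _ (mem_iota0 b))) -val_eqE /=.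
by case: eqP => _; rewrite ?mulr1 ?mulr0.
Qed.

End HighestWeightCheck.

Lemma node4E : node4 = 3%N :> nat. Proof. exact: inordK. Qed.
Lemma node1E : node1 = 0%N :> nat. Proof. exact: inordK. Qed.
Lemma node2E : node2 = 1%N :> nat. Proof. exact: inordK. Qed.

Lemma rho26_fundamental (K : fieldType) : [pchar K] =i pred0 ->
  irreducible_rep (rho26 K) /\ hw_vector (rho26 K) node4 (delta_mx ord0 0).
Proof.
move=> charK; have chk : hw_check 25 e26 f26 wt26 path26
  (fun i => dense 26 (nth [::] L26_data i)) 3 by vm_compute.
have [irr hw] := hw_checkP charK chk; split; first exact: irr.
exact: (hw _ node4E).
Qed.

Lemma rho52_fundamental (K : fieldType) : [pchar K] =i pred0 ->
  irreducible_rep (rho52 K) /\ hw_vector (rho52 K) node1 (delta_mx ord0 0).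
Proof.
move=> charK; have chk : hw_check 51 e52 f52 wt52 path52
  (fun i => dense 52 (nth [::] L52_data i)) 0 by vm_compute.
have [irr hw] := hw_checkP charK chk; split; first exact: irr.
exact: (hw _ node1E).
Qed.

(** * The forms and the Casimir element *)

Definition lact (X B : seq (seq int)) : seq (seq int) :=
  lscale (-1) (ladd (lmul (ltr 26 X) B) (lmul B X)).

(* Descends from a highest weight form along the paths of [path], dividing by
   the same factors as in the module, so that the forms obtained transform like
   the basis of the module. *)
Definition descend (B0 : seq (seq int)) (path : seq (nat * nat * int)) :=
  foldl (fun acc t => rcons acc
    (map (map (fun x => (x %/ t.2)%Z)) (lact (f26 t.1.1) (nth [::] acc t.1.2))))
    [:: B0] path.

Definition forms52 := descend (dense 26 form52_hw) path52.
Definition forms27 :=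
  rcons (descend (dense 26 form26_hw) path26) (dense 26 form1_hw).

Section FormCheck.
Variables (m : nat) (E F H : nat -> seq (seq int)) (sgn : int).
Variables (forms : seq (seq (seq int))) (dual : seq (seq (nat * nat * int))).

(** The last three conditions give, in this order, the symmetry type of the forms, their vanishing
    on the span of the first three basis vectors, which is the base fiber of R_3, and their linear
    independence in characteristic 0. *)
Definition form_check : bool :=
  let Bs := forms in
  let inter X M c := leqm
    (meval_seq 26 (MScale (-1) (MAdd (MMul (MTr (MZ X)) (MZ (nth [::] Bs c)))
                                     (MMul (MZ (nth [::] Bs c)) (MZ X)))))
    (meval_seq 26 (MSum (iota 0 m) (fun r => MScale (ient M r c) (MZ (nth [::] Bs r))))) in
  [&& all (fun i => let X := e26 i in let M := E i in all (inter X M) (iota 0 m)) (iota 0 4),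
      all (fun i => let X := f26 i in let M := F i in all (inter X M) (iota 0 m)) (iota 0 4),
      all (fun i => let X := h26 i in let M := H i in all (inter X M) (iota 0 m)) (iota 0 4),
      all (fun c => leqm (meval_seq 26 (MTr (MZ (nth [::] Bs c))))
                         (meval_seq 26 (MScale sgn (MZ (nth [::] Bs c))))) (iota 0 m),
      all (fun c => all (fun a => all (fun b => ient (nth [::] Bs c) a b == 0)
        (iota 0 3)) (iota 0 3)) (iota 0 m) &
      all (fun c => all (fun d =>
        all (fun t => (t.1.1 < 26)%N && (t.1.2 < 26)%N) (nth [::] dual c) &&
        (foldr (fun t s => intZmod.addz (intRing.mulz t.2 (ient (nth [::] Bs d) t.1.1 t.1.2)) s)
           0 (nth [::] dual c) == if c == d then 6 else 0)) (iota 0 m)) (iota 0 m)].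

Definition formK (R : pzRingType) (c : nat) : 'M[R]_26 := zmx R 26 (nth [::] forms c).

Definition formrep (R : pzRingType) : f4gen -> 'M[R]_m :=
  rep_of m (fun i => MZ (E i)) (fun i => MZ (F i)) (fun i => MZ (H i)) R.

Hypothesis chk : form_check.

Lemma form_checkP (R : pzRingType) x (c : 'I_m) :
  - ((rho26 R x)^T *m formK R c + formK R c *m rho26 R x) =
  \sum_r formrep R x r c *: formK R r.
Proof.
have inter X M : leqm
    (meval_seq 26 (MScale (-1) (MAdd (MMul (MTr (MZ X)) (MZ (nth [::] forms c)))
                                     (MMul (MZ (nth [::] forms c)) (MZ X)))))
    (meval_seq 26 (MSum (iota 0 m) (fun r => MScale (ient M r c) (MZ (nth [::] forms r))))) ->
    - ((zmx R 26 X)^T *m formK R c + formK R c *m zmx R 26 X) =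
    \sum_r zmx R m M r c *: formK R r.
  move=> /(mx_reflect R); rewrite meval_sum -[m in iota 0 m]subn0 -/(index_iota 0 m).
  rewrite big_mkord [meval_mx _ _ _]/= scaleN1r => ->.
  by apply: eq_bigr => r _; rewrite mxE.
have /and5P[cE cF cH _ _] := chk.
case: x => i; [have := cE|have := cF|have := cH];
  move=> /allP/(_ _ (mem_iota0 i))/allP/(_ _ (mem_iota0 c)); exact: inter.
Qed.

Lemma form_tr (R : pzRingType) (c : 'I_m) : (formK R c)^T = sgn%:~R *: formK R c.
Proof.
have /and5P[_ _ _ cT _] := chk.
exact: (mx_reflect R (allP cT _ (mem_iota0 c))).
Qed.

Lemma form_base (R : pzRingType) (c : 'I_m) (a b : 'I_26) :
  (a < 3)%N -> (b < 3)%N -> formK R c a b = 0.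
Proof.
move=> a3 b3; have /and5P[_ _ _ _ /andP[cB _]] := chk.
have := allP (allP (allP cB _ (mem_iota0 c)) a _) b.
by rewrite !mem_iota mxE => /(_ a3 b3)/eqP->.
Qed.

Lemma form_free (K : fieldType) (u : 'I_m -> K) : [pchar K] =i pred0 ->
  \sum_c u c *: formK K c = 0 -> forall c, u c = 0.
Proof.
move=> charK us c; have /and5P[_ _ _ _ /andP[_ cD]] := chk.
have [/allP b26 _] := andP (allP (allP cD _ (mem_iota0 c)) _ (mem_iota0 c)).
have coord (d : 'I_m) : \sum_(t <- nth [::] dual c)
    t.2%:~R * formK K d (inord t.1.1) (inord t.1.2) = if c == d then 6%:~R else 0.
  have /andP[_ /eqP e] := allP (allP cD _ (mem_iota0 c)) _ (mem_iota0 d).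
  have -> : (if c == d then 6%:~R else 0 : K) = (if c == d :> nat then 6 else 0 : int)%:~R.
    by rewrite -val_eqE; case: ifP.
  rewrite -e; elim: (nth _ dual c) b26 => [|t s IH] b26; first by rewrite big_nil.
  rewrite big_cons IH => [|x xs]; last by apply: b26; rewrite inE xs orbT.
  have /andP[t1 t2] := b26 t (mem_head _ _).
  by rewrite /= intrD intrM mxE !inordK.
have : \sum_(t <- nth [::] dual c) t.2%:~R *
    (\sum_d u d *: formK K d) (inord t.1.1) (inord t.1.2) = 0.
  by rewrite us big1 // => t _; rewrite mxE mulr0.
under eq_bigr => t _ do rewrite summxE mulr_sumr.
rewrite exchange_big /= (bigD1 c) //= [X in _ + X]big1 => [|d dc]; last first.
  under eq_bigr => t _ do rewrite mxE mulrCA.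
  by rewrite -mulr_sumr coord eq_sym (negPf dc) mulr0.
under eq_bigr => t _ do rewrite mxE mulrCA.
rewrite -mulr_sumr coord eqxx addr0 => /eqP.
by rewrite mulf_eq0 intr_eq0_char0 // orbF => /eqP.
Qed.

End FormCheck.

Lemma forms52_check : form_check 52 e52 f52 h52 (-1) forms52 dual52.
Proof. by vm_compute. Qed.

Lemma forms27_check : form_check 27 e26 f26 h26 1 forms27 dual27.
Proof. by vm_compute. Qed.

(** * Root vectors and the Casimir tensor *)

Definition lbrk (A B : seq (seq int)) := ladd (lmul A B) (lscale (-1) (lmul B A)).

Definition eroots := foldl (fun acc r => rcons acc (lbrk (e26 r.1) (nth [::] acc r.2)))
  (mkseq e26 4) root_rec.
Definition froots := foldl (fun acc r => rcons acc (lbrk (f26 r.1) (nth [::] acc r.2)))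
  (mkseq f26 4) root_rec.

Definition root_e (R : pzRingType) (t : nat) : 'M[R]_26 := zmx R 26 (nth [::] eroots t).
Definition root_f (R : pzRingType) (t : nat) : 'M[R]_26 := zmx R 26 (nth [::] froots t).

(** The weighted sum of the [e_t, f_t] is 48 times the element of the Cartan subalgebra
    corresponding to 2 rho. Its coefficient at h_i is (omega_i, 2 rho), that is 16, 30, 21, 11 for
    long roots of squared length 2. *)
Definition root_check : bool :=
  let es := eroots in let fs := froots in
  [&& all (fun t => if (t < 4)%N then leqm (nth [::] es t) (e26 t) && leqm (nth [::] fs t) (f26 t)
       else let r := nth (0, 0) root_rec (t - 4) in
       [&& (r.1 < 4), (r.2 < t),
        leqm (meval_seq 26 (MZ (nth [::] es t)))
             (meval_seq 26 (MBrk (MZ (e26 r.1)) (MZ (nth [::] es r.2)))) &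
        leqm (meval_seq 26 (MZ (nth [::] fs t)))
             (meval_seq 26 (MBrk (MZ (f26 r.1)) (MZ (nth [::] fs r.2))))])%N (iota 0 24) &
      leqm (meval_seq 26 (MSum (iota 0 24) (fun t => MScale (nth 0 root_coef t)
              (MBrk (MZ (nth [::] es t)) (MZ (nth [::] fs t))))))
           (meval_seq 26 (MSum (iota 0 4) (fun i => MScale (48 * nth 0 [:: 16; 30; 21; 11] i)%R
              (MZ (h26 i)))))].

Lemma root_checkT : root_check. Proof. by vm_compute. Qed.

Definition outer (u v : seq int) : seq (seq int) :=
  map (fun x => if x == 0 then [::] else map (intRing.mulz x) v) u.

Lemma ient_outer u v i j : ient (outer u v) i j = nth 0 u i * nth 0 v j.
Proof.
rewrite /ient /outer; case: (ltnP i (size u)) => iu; last first.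
  by rewrite (nth_default [::]) ?size_map // nth_nil (nth_default _ iu) mul0r.
rewrite (nth_map 0) //; case: eqP => [->|_]; first by rewrite nth_nil mul0r.
case: (ltnP j (size v)) => jv; first by rewrite (nth_map 0).
by rewrite (nth_default _ jv) mulr0 nth_default // size_map.
Qed.

Definition unitv (a : nat) : seq int := mkseq (fun i => (i == a)%:Z) 26.

Definition casimir : seq (int * seq (seq int) * seq (seq int)) :=
  flatten [seq [:: (nth 0 root_coef t, nth [::] eroots t, nth [::] froots t);
                   (nth 0 root_coef t, nth [::] froots t, nth [::] eroots t)] | t <- iota 0 24]
  ++ [seq (24 * ient weight_gram i j, h26 i, h26 j) | i <- iota 0 4, j <- iota 0 4].

Definition lsum T (s : seq T) (F : T -> seq (seq int)) :=
  foldr (fun x acc => ladd (F x) acc) [::] s.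

Lemma ient_sum T (s : seq T) F i j : ient (lsum s F) i j = \sum_(x <- s) ient (F x) i j.
Proof.
elim: s => [|x s IH]; first by rewrite big_nil /ient !nth_nil.
by rewrite big_cons /= ient_add IH.
Qed.

Definition all_forms := forms52 ++ forms27.

Lemma size_forms52 : size forms52 = 52%N.
Proof. by vm_compute. Qed.

Opaque forms52 forms27.

Lemma nth_forms52 c : (c < 52)%N -> nth [::] all_forms c = nth [::] forms52 c.
Proof. by move=> c52; rewrite /all_forms nth_cat size_forms52 c52. Qed.

Lemma nth_forms27 c : nth [::] all_forms (52 + c) = nth [::] forms27 c.
Proof. by rewrite /all_forms nth_cat size_forms52 ltnNge leq_addr addKn. Qed.

(** With the output indices a and b fixed, the Casimir tensor is a bilinear form in the two input
    vectors, so it can be compared with the 79 forms. *)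
Definition casimir_tensor_mx (a b : nat) : seq (seq int) :=
  lsum casimir (fun t => lscale t.1.1 (outer (nth [::] t.1.2 a) (nth [::] t.2 b))).

Definition swap_mx (a b : nat) : seq (seq int) :=
  lscale 24 (ladd (outer (unitv a) (unitv b)) (outer (unitv b) (unitv a))).

(* The coordinates on the forms of the skew and of the symmetric part of M. *)
Definition form_coef (M : seq (seq int)) : seq (int * nat) :=
  (* The divisor 12 is the 6 of the dual functionals times 2, because M - M^T and M + M^T double the
     two parts of M. The outcome is tested by [casimir_check], so the division needs no proof of
     exactness. *)
  let coord sgn s := (foldr (fun t z => t.2 *
    (ient M t.1.1 t.1.2 + sgn * ient M t.1.2 t.1.1) + z) 0 s %/ 12)%Z in
  [seq t <- [seq (coord (-1) (nth [::] dual52 c), c) | c <- iota 0 52] ++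
            [seq (coord 1 (nth [::] dual27 c), 52 + c)%N | c <- iota 0 27] | t.1 != 0].

Lemma form_coef_lt M : all (fun t => t.2 < 79)%N (form_coef M).
Proof.
apply/allP => t; rewrite mem_filter mem_cat => /andP[_ /orP[]] /mapP[c].
  by rewrite mem_iota => c52 -> /=; apply: leq_trans c52 _.
by rewrite mem_iota => c27 -> /=; rewrite -[79%N]/(52 + 27)%N ltn_add2l.
Qed.

Definition tensor_coef (a b : nat) : seq (int * nat) :=
  form_coef (ladd (casimir_tensor_mx a b) (lscale (-1) (swap_mx a b))).

Definition casimir_check : bool :=
  let forms := all_forms in
  all (fun a => all (fun b => leqm (casimir_tensor_mx a b)
    (ladd (swap_mx a b) (lsum (tensor_coef a b) (fun t => lscale t.1 (nth [::] forms t.2)))))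
    (iota 0 26)) (iota 0 26).

Lemma casimir_checkT : casimir_check. Proof. by vm_compute. Qed.

Lemma casimir_entry (a b c d : 'I_26) : ient (casimir_tensor_mx a b) c d =
  ient (ladd (swap_mx a b)
    (lsum (tensor_coef a b) (fun t => lscale t.1 (nth [::] all_forms t.2)))) c d.
Proof. exact: leqmP (allP (allP casimir_checkT _ (mem_iota0 a)) _ (mem_iota0 b)). Qed.

Lemma tensor_coef_lt a b : all (fun t => t.2 < 79)%N (tensor_coef a b).
Proof. exact: form_coef_lt. Qed.

Lemma sum_casimir (R : pzRingType) (V : nmodType) (F : int -> 'M[R]_26 -> 'M[R]_26 -> V) :
  \sum_(t <- casimir) F t.1.1 (zmx R 26 t.1.2) (zmx R 26 t.2) =
  \sum_(t < 24) (F (nth 0 root_coef t) (root_e R t) (root_f R t) +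
                  F (nth 0 root_coef t) (root_f R t) (root_e R t)) +
  \sum_(i < 4) \sum_(j < 4) F (24 * ient weight_gram i j) (rho26 R (Hgen i)) (rho26 R (Hgen j)).
Proof.
rewrite /casimir big_cat big_flatten big_map; congr (_ + _).
  rewrite -[iota 0 24]/(index_iota 0 24) big_mkord.
  by apply: eq_bigr => t _; rewrite big_cons big_seq1.
rewrite big_allpairs_dep -[iota 0 4]/(index_iota 0 4) big_mkord.
by apply: eq_bigr => i _; rewrite big_mkord.
Qed.

Opaque casimir tensor_coef all_forms eroots froots.

Lemma ient_unitv a b (c d : 'I_26) :
  ient (outer (unitv a) (unitv b)) c d = (c == a :> nat)%:Z * (d == b :> nat)%:Z.
Proof. by rewrite ient_outer !nth_mkseq. Qed.

(* The tensor of the Casimir element acts on V (x) V as half the sum of the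
   identity and the swap, up to the equations of the cone; the factor 48 clears
   denominators. *)
Lemma casimir_tensor (R : pzRingType) (a b : 'I_26) : exists s : seq (int * nat),
  all (fun t => t.2 < 79)%N s /\ forall c d : 'I_26,
  \sum_(t <- casimir) t.1.1%:~R * (zmx R 26 t.1.2 a c * zmx R 26 t.2 b d) =
  24%:~R * ((c == a)%:R * (d == b)%:R + (c == b)%:R * (d == a)%:R) +
  \sum_(t <- s) t.1%:~R * zmx R 26 (nth [::] all_forms t.2) c d.
Proof.
exists (tensor_coef a b); split; first exact: tensor_coef_lt.
move=> c d; have e := congr1 (fun z : int => z%:~R : R) (casimir_entry a b c d).
rewrite /casimir_tensor_mx /swap_mx ient_add ient_scale ient_add !ient_unitv !ient_sum in e.
rewrite intrD intrM intrD !intrM !rmorph_sum in e.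
apply: etrans (etrans e _); last first.
  congr (_ + _); apply: eq_bigr => t _.
  by rewrite /= ient_scale intrM mxE.
apply: eq_bigr => t _; rewrite /= ient_scale ient_outer !intrM.
congr (_ * (_ * _)); exact: mxE.
Qed.

(** 576 is 48 times 12, where 12 = (omega_4, omega_4 + 2 rho) = 1 + 11. The factors are in reverse
    order because the action on coordinates reverses products, as in [vf_vf_gx]. *)
Lemma casimir_scalar (R : pzRingType) :
  \sum_(t <- casimir) t.1.1%:~R *: (zmx R 26 t.2 *m zmx R 26 t.1.2) = 576%:~R *: 1%:M.
Proof.
have chk : leqm (meval_seq 26 (MSum casimir (fun t => MScale t.1.1 (MMul (MZ t.2) (MZ t.1.2)))))
   (meval_seq 26 (MZ (ldiag 26 (fun=> 576)))) by vm_compute.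
have := mx_reflect R chk; rewrite meval_sum => ->.
apply/matrixP => i j; rewrite zmx_diag !mxE; case: eqP => _; first by rewrite mulr1.
by rewrite mulr0.
Qed.

(** * Heights and the order on the weights of V *)

Definition height (a : nat) : nat := absz (foldr intZmod.addz 0 (nth [::] root26 a)).

(** On V the f_i raise the height and the e_i raise 16 minus the height. On polynomials, where V is
    dualized, both become operators lowering a grading with natural values. *)
Lemma height_f (R : pzRingType) i :
  brk (zmx R 26 (ldiag 26 (fun a => (height a)%:Z))) (rho26 R (Fgen i)) = rho26 R (Fgen i).
Proof.
have /allP chk : all (fun i => leqm
   (meval_seq 26 (MBrk (MZ (ldiag 26 (fun a => (height a)%:Z))) (MZ (f26 i))))
   (meval_seq 26 (MZ (f26 i)))) (iota 0 4) by vm_compute.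
by have := mx_reflect R (chk _ (mem_iota0 i)); rewrite meval_brk.
Qed.

Lemma height_e (R : pzRingType) i :
  brk (zmx R 26 (ldiag 26 (fun a => (16 - height a)%N%:Z))) (rho26 R (Egen i)) =
  rho26 R (Egen i).
Proof.
have /allP chk : all (fun i => leqm
   (meval_seq 26 (MBrk (MZ (ldiag 26 (fun a => (16 - height a)%N%:Z))) (MZ (e26 i))))
   (meval_seq 26 (MZ (e26 i)))) (iota 0 4) by vm_compute.
by have := mx_reflect R (chk _ (mem_iota0 i)); rewrite meval_brk.
Qed.

(** The coefficients 22, 42, 30, 16 are those of the sum of the positive coroots, which takes the
    value 16 at omega_4 and 2 at each simple root. Twice the height is thus a combination of the h_i
    and of the identity, and preserves every space that those preserve. *)
Lemma height_h (R : pzRingType) :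
  2%:~R *: zmx R 26 (ldiag 26 (fun a => (height a)%:Z)) =
  16%:~R *: 1%:M - \sum_(i < 4) (nth 0 [:: 22; 42; 30; 16] i)%:~R *: rho26 R (Hgen i).
Proof.
have chk : leqm (meval_seq 26 (MScale 2 (MZ (ldiag 26 (fun a => (height a)%:Z)))))
   (meval_seq 26 (MAdd (MZ (ldiag 26 (fun=> 16))) (MSum (iota 0 4)
      (fun i => MScale (- nth 0 [:: 22; 42; 30; 16] i) (MZ (h26 i)))))) by vm_compute.
apply: etrans (mx_reflect R chk) _.
have mevalD x y : meval_mx R 26 (MAdd x y) = meval_mx R 26 x + meval_mx R 26 y by [].
rewrite mevalD meval_sum.
rewrite -[iota 0 4]/(index_iota 0 4) big_mkord.
rewrite -sumrN; congr (_ + _); last first.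
  by apply: eq_bigr => i _; rewrite /= mulrNz scaleNr.
apply/matrixP => i j; rewrite zmx_diag !mxE; case: eqP => _; first by rewrite mulr1.
by rewrite mulr0.
Qed.

Lemma wt26_root (a i : nat) : (a < 26)%N -> (i < 4)%N ->
  ient wt26 a i = (i == 3)%:Z - \sum_(j < 4) ient root26 a j * cartN j i.
Proof.
move=> a26 i4; have chk : all (fun a => all (fun i => ient wt26 a i ==
   (i == 3)%:Z - foldr (fun j s => ient root26 a j * cartN j i + s)%R 0 (iota 0 4))
   (iota 0 4)) (iota 0 26) by vm_compute.
have := allP (allP chk a _) i; rewrite !mem_iota => /(_ a26 i4)/eqP->.
by congr (_ - _); rewrite !big_ord_recl big_ord0.
Qed.

(** The weights of V start with a chain w0 > w1 > w2 lying above all others. Hence a monomial whose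
    column k only uses rows of index at least k has a sum of weights below that of the diagonal
    monomial with the same column degrees. *)
Lemma root26_ge (a j : nat) : (a < 26)%N -> (j < 4)%N ->
  [/\ 0 <= ient root26 a j, (a != 0)%N -> ient root26 1 j <= ient root26 a j &
      (1 < a)%N -> ient root26 2 j <= ient root26 a j].
Proof.
move=> a26 j4; have chk : all (fun a => all (fun j => [&& 0 <= ient root26 a j,
   (a != 0%N) ==> (ient root26 1 j <= ient root26 a j) &
   (1 < a)%N ==> (ient root26 2 j <= ient root26 a j)]) (iota 0 4)) (iota 0 26).
  by vm_compute.
have := allP (allP chk a _) j; rewrite !mem_iota => /(_ a26 j4)/and3P[? c1 c2].
by split=> // h; [apply: (implyP c1) | apply: (implyP c2)].
Qed.

(** The weights w0, w1 and w2 have multiplicity one; in [ideal_in_J] this turns an equality of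
    weights into an equality of variables. *)
Lemma root26_eq (a b : nat) : (a < 26)%N -> (b < 3)%N ->
  (forall j, (j < 4)%N -> ient root26 a j = ient root26 b j) -> a = b.
Proof.
move=> a26 b3 e; have chk : all (fun a => all (fun b =>
   all (fun j => ient root26 a j == ient root26 b j) (iota 0 4) ==> (a == b))
   (iota 0 3)) (iota 0 26) by vm_compute.
have := allP (allP chk a _) b; rewrite !mem_iota => /(_ a26 b3)/implyP h.
by apply/eqP/h/allP => j; rewrite mem_iota => /e ->.
Qed.

Lemma eroot_rec (R : pzRingType) t : (t < 24)%N ->
  if (t < 4)%N then exists i : 'I_4, root_e R t = rho26 R (Egen i) /\ root_f R t = rho26 R (Fgen i)
  else exists (i : 'I_4) u, [/\ (u < t)%N, root_e R t = brk (rho26 R (Egen i)) (root_e R u) &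
    root_f R t = brk (rho26 R (Fgen i)) (root_f R u)].
Proof.
move=> t24; have /andP[/allP chk _] := root_checkT.
have := chk t; rewrite mem_iota => /(_ t24); case: ltnP => t4.
  move=> /andP[ce cf]; exists (Ordinal t4); split; apply/matrixP => a b;
    rewrite !mxE; [rewrite (leqmP _ _ ce) | rewrite (leqmP _ _ cf)] => //.
set u := nth _ root_rec _ => /and4P[i4 ut ce cf].
exists (Ordinal i4), u.2; split; first exact: ut.
  by have := mx_reflect R ce; rewrite meval_brk.
by have := mx_reflect R cf; rewrite meval_brk.
Qed.

Lemma root_sum (R : pzRingType) :
  \sum_(t < 24) (nth 0 root_coef t)%:~R *: brk (root_e R t) (root_f R t) =
  \sum_(i < 4) (48 * nth 0 [:: 16; 30; 21; 11] i)%:~R *: rho26 R (Hgen i).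
Proof.
have /andP[_ chk] := root_checkT; have := mx_reflect R chk.
rewrite !meval_sum -[iota 0 24]/(index_iota 0 24) -[iota 0 4]/(index_iota 0 4) !big_mkord.
by under eq_bigr => t _ do rewrite [meval_mx _ _ _]/= -/(MBrk _ _) scaleN1r.
Qed.

(** * Derivations *)

Lemma sum_mxvec (V : nmodType) n r (F : 'I_(n * r) -> V) :
  \sum_i F i = \sum_a \sum_k F (mxvec_index a k).
Proof.
by rewrite pair_bigA (reindex _ (curry_mxvec_bij _ _)) /=; apply: eq_bigr => -[].
Qed.

Section VectorFields.
Variables (K : fieldType) (n r : nat).
Local Notation S := {mpoly K[n * r]}.

Definition gx : 'M[S]_(n, r) := \matrix_(a, k) 'X_(mxvec_index a k).
Definition cmx m m' (A : 'M[K]_(m, m')) : 'M[S]_(m, m') := map_mx (@mpolyC (n * r) K) A.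

(** The derivation that sends the generic matrix [gx] to [M], by [vfX]. *)
Definition vf (M : 'M[S]_(n, r)) (p : S) : S := \sum_i mxvec M 0 i * p^`M(i).

Lemma vf_is_linear M : linear (vf M).
Proof.
move=> c p q; rewrite /vf scaler_sumr -big_split; apply: eq_bigr => i _ /=.
by rewrite mderivD mderivZ mulrDr scalerAr.
Qed.
HB.instance Definition _ M := GRing.isLinear.Build K S S _ (vf M) (vf_is_linear M).

Lemma vfE M p : vf M p = \sum_a \sum_k M a k * p^`M(mxvec_index a k).
Proof. by rewrite /vf sum_mxvec; do 2!apply: eq_bigr => ? _; rewrite mxvecE. Qed.

Lemma vfM M p q : vf M (p * q) = vf M p * q + p * vf M q.
Proof.
rewrite /vf mulr_suml mulr_sumr -big_split; apply: eq_bigr => i _ /=.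
by rewrite mderivM; ring.
Qed.

Lemma vf1 M : vf M 1 = 0.
Proof. by rewrite /vf big1 // => i _; rewrite -mpolyC1 mderivC mulr0. Qed.

Lemma vfX M a k : vf M (gx a k) = M a k.
Proof.
rewrite /vf mxE (bigD1 (mxvec_index a k)) //= [X in _ + X]big1 => [|i ik].
  rewrite addr0 mxvecE mderivX mnm1E eqxx scale1r.
  suff -> : (U_(mxvec_index a k) - U_(mxvec_index a k) = 0)%MM by rewrite mpolyX0 mulr1.
  by apply/mnmP => j; rewrite mnmBE mnm0E subnn.
by rewrite mderivX mnm1E eq_sym (negPf ik) scale0r mulr0.
Qed.

Lemma vf_addl M N p : vf (M + N) p = vf M p + vf N p.
Proof.
by rewrite /vf -big_split; apply: eq_bigr => i _; rewrite linearD mxE mulrDl.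
Qed.

Lemma vf_scalel c M p : vf (c *: M) p = c * vf M p.
Proof.
by rewrite /vf mulr_sumr; apply: eq_bigr => i _; rewrite linearZ mxE mulrA.
Qed.

Lemma vf_oppl M p : vf (- M) p = - vf M p.
Proof. by rewrite -scaleN1r vf_scalel mulN1r. Qed.

Lemma vf0l p : vf 0 p = 0.
Proof. by rewrite -(scale0r gx) vf_scalel mul0r. Qed.

Lemma mpoly_mul_ind (P : S -> Prop) : P 1 ->
  (forall c p q, P p -> P q -> P (c *: p + q)) ->
  (forall a k p, P p -> P (gx a k * p)) -> forall p, P p.
Proof.
move=> P1 Plin PX; have P0 : P 0 by have := Plin (-1) _ _ P1 P1; rewrite scaleN1r addNr.
have Pm m : P 'X_[m].
  have [d] := ubnP (mdeg m); elim: d m => // d IH m md.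
  have [->|m0] := eqVneq m 0%MM; first by rewrite mpolyX0.
  have /existsP[i mi] : [exists i, m i != 0%N].
    apply: contraNT m0 => /existsPn m0; apply/eqP/mnmP => i; rewrite mnm0E.
    by apply/eqP; move: (m0 i); rewrite negbK.
  have mE : m = (U_(i) + (m - U_(i)))%MM.
    apply/mnmP => j; rewrite mnmDE mnmBE mnm1E; case: eqP => [<-|_] /=.
      by rewrite subnKC // lt0n.
    by rewrite subn0.
  rewrite mE mpolyXD; case/mxvec_indexP: i mi mE => a k mi mE.
  have := PX a k 'X_[m - U_(mxvec_index a k)]; rewrite mxE; apply.
  apply: IH; move: md; rewrite {1}mE mdegD mdeg1; lia.
move=> p; rewrite (mpolyE p); elim: (msupp p) => [|m s IH]; first by rewrite big_nil.
by rewrite big_cons; apply: Plin.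
Qed.

Lemma derivation_ext (d1 d2 : {linear S -> S}) :
  (forall p q, d1 (p * q) = d1 p * q + p * d1 q) ->
  (forall p q, d2 (p * q) = d2 p * q + p * d2 q) ->
  (forall a k, d1 (gx a k) = d2 (gx a k)) -> d1 =1 d2.
Proof.
move=> L1 L2 e12; have one (d : {linear S -> S}) :
    (forall p q, d (p * q) = d p * q + p * d q) -> d 1 = 0.
  move=> L; have := L 1 1; rewrite !mul1r mulr1 => h.
  by apply: (addrI (d 1)); rewrite -h addr0.
apply: mpoly_mul_ind => [|c p q ep eq|a k p ep].
- by rewrite !one.
- by rewrite !linearP ep eq.
- by rewrite L1 L2 e12 ep.
Qed.

Lemma vf_comm M N p : vf M (vf N p) - vf N (vf M p) =
  vf (map_mx (vf M) N - map_mx (vf N) M) p.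
Proof.
pose c q := vf M (vf N q) - vf N (vf M q).
have cl : linear c by move=> a u v; rewrite /c !linearP /= scalerBr; ring.
pose cL := HB.pack_for {linear S -> S} c (GRing.isLinear.Build K S S _ c cl).
apply: (@derivation_ext cL (vf (map_mx (vf M) N - map_mx (vf N) M))).
- by move=> u v; rewrite /= /c !vfM !linearD /= !vfM; ring.
- exact: vfM.
- by move=> a k; rewrite /= /c !vfX !mxE.
Qed.

Lemma map_vf_mul M m1 m2 m3 (A : 'M[S]_(m1, m2)) (B : 'M_(m2, m3)) :
  map_mx (vf M) (A *m B) = map_mx (vf M) A *m B + A *m map_mx (vf M) B.
Proof.
apply/matrixP => i j; rewrite !mxE linear_sum -big_split; apply: eq_bigr => k _.
by rewrite /= vfM !mxE.
Qed.

Lemma map_vf_const M m m' (A : 'M[K]_(m, m')) : map_mx (vf M) (cmx A) = 0.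
Proof.
by apply/matrixP => i j; rewrite !mxE -[_%:MP]mulr1 mul_mpolyC linearZ /= vf1 scaler0.
Qed.

Lemma map_vf_gx M : map_mx (vf M) gx = M.
Proof. by apply/matrixP => a k; rewrite mxE vfX. Qed.

(** The coordinates span the dual of V, whence the sign; [De] multiplies on the right and needs
    none. Both turn [brk] into commutators, and they commute with each other. *)
Definition Dg (X : 'M[K]_n) : S -> S := vf (- (cmx X *m gx)).
Definition De (M : 'M[K]_r) : S -> S := vf (gx *m cmx M).

HB.instance Definition _ X := GRing.Linear.on (Dg X).
HB.instance Definition _ M := GRing.Linear.on (De M).

Lemma cmxM m1 m2 m3 (A : 'M[K]_(m1, m2)) (B : 'M_(m2, m3)) :
  cmx (A *m B) = cmx A *m cmx B.
Proof. exact: map_mxM. Qed.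

Lemma cmxB m1 m2 (A B : 'M[K]_(m1, m2)) : cmx (A - B) = cmx A - cmx B.
Proof. exact: map_mxB. Qed.

Lemma map_Dg (X Y : 'M[K]_n) : map_mx (vf (- (cmx X *m gx))) (- (cmx Y *m gx)) =
  cmx (Y *m X) *m gx.
Proof.
rewrite (map_mxN (vf _)) map_vf_mul map_vf_const mul0mx add0r map_vf_gx.
by rewrite mulmxN opprK cmxM mulmxA.
Qed.

Lemma Dg_brk (X Y : 'M[K]_n) p : Dg X (Dg Y p) - Dg Y (Dg X p) = Dg (brk X Y) p.
Proof.
apply: etrans (vf_comm _ _ p) _; congr (vf _ p).
apply: etrans (congr2 (fun A B => A - B) (map_Dg X Y) (map_Dg Y X)) _.
by rewrite /brk cmxB mulmxBl opprB.
Qed.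

Lemma map_De (M N : 'M[K]_r) : map_mx (vf (gx *m cmx M)) (gx *m cmx N) = gx *m cmx (M *m N).
Proof. by rewrite map_vf_mul map_vf_const mulmx0 addr0 map_vf_gx cmxM mulmxA. Qed.

Lemma De_brk (M N : 'M[K]_r) p : De M (De N p) - De N (De M p) = De (brk M N) p.
Proof.
apply: etrans (vf_comm _ _ p) _; congr (vf _ p).
apply: etrans (congr2 (fun A B => A - B) (map_De M N) (map_De N M)) _.
by rewrite /brk cmxB mulmxBr.
Qed.

Lemma De_Dg M X p : De M (Dg X p) = Dg X (De M p).
Proof.
apply/eqP; rewrite -subr_eq0; apply/eqP; apply: etrans (vf_comm _ _ p) _.
have E1 : map_mx (vf (gx *m cmx M)) (- (cmx X *m gx)) = - (cmx X *m gx *m cmx M).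
  by rewrite (map_mxN (vf _)) map_vf_mul map_vf_const mul0mx add0r map_vf_gx mulmxA.
have E2 : map_mx (vf (- (cmx X *m gx))) (gx *m cmx M) = - (cmx X *m gx *m cmx M).
  by rewrite map_vf_mul map_vf_const mulmx0 addr0 map_vf_gx mulNmx.
apply: etrans (congr2 (fun A B => vf (A - B) p) E1 E2) _.
by rewrite subrr vf0l.
Qed.

Lemma DgZ c X p : Dg (c *: X) p = c *: Dg X p.
Proof.
rewrite /Dg /cmx map_mxZ -scalemxAl -scalerN vf_scalel mul_mpolyC.
by [].
Qed.

Lemma DgD X Y p : Dg (X + Y) p = Dg X p + Dg Y p.
Proof. by rewrite /Dg /cmx map_mxD mulmxDl opprD vf_addl. Qed.

Lemma DgN X p : Dg (- X) p = - Dg X p.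
Proof. by rewrite -[- X]scaleN1r DgZ scaleN1r. Qed.

Lemma Dg0 p : Dg 0 p = 0.
Proof. by rewrite -(scale0r 0) DgZ scale0r. Qed.

Lemma Dg_sum (T : Type) (s : seq T) (F : T -> 'M_n) p :
  Dg (\sum_(t <- s) F t) p = \sum_(t <- s) Dg (F t) p.
Proof. by elim: s => [|t s IH]; rewrite ?big_nil ?Dg0 // !big_cons DgD IH. Qed.

Lemma DeD M N p : De (M + N) p = De M p + De N p.
Proof. by rewrite /De /cmx map_mxD mulmxDr vf_addl. Qed.

Lemma DeZ c M p : De (c *: M) p = c *: De M p.
Proof. by rewrite /De /cmx map_mxZ -scalemxAr vf_scalel mul_mpolyC. Qed.

Definition is_ideal (J : S -> Prop) : Prop :=
  [/\ J 0, forall p q, J p -> J q -> J (p + q) & forall p q, J q -> J (p * q)].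

Definition is_subspace (N : S -> Prop) : Prop :=
  N 0 /\ forall c p q, N p -> N q -> N (c *: p + q).

Lemma ideal_subspace J : is_ideal J -> is_subspace J.
Proof.
by case=> J0 JD JM; split=> // c p q Jp Jq; apply: JD => //; rewrite -mul_mpolyC; apply: JM.
Qed.

(** The defect G of the product rule for a second order operator is a derivation in each argument.
    It takes values in the ideal as soon as it does so on pairs of coordinates, and then the values
    of the operator on coordinates decide. *)
Lemma second_order_ideal J (s : seq (K * 'M[S]_(n, r) * 'M[S]_(n, r))) F :
  is_ideal J ->
  (forall a k b l, J (\sum_(t <- s) t.1.1 *:
    (vf t.1.2 (gx a k) * vf t.2 (gx b l) + vf t.2 (gx a k) * vf t.1.2 (gx b l)))) ->
  (forall a k, J (\sum_(t <- s) t.1.1 *: vf t.1.2 (vf t.2 (gx a k)) + vf F (gx a k))) ->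
  forall p, J (\sum_(t <- s) t.1.1 *: vf t.1.2 (vf t.2 p) + vf F p).
Proof.
move=> Jid G1 G2; have [J0 JD JM] := Jid; have [_ Jlin] := ideal_subspace Jid.
pose G p q := \sum_(t <- s) t.1.1 *: (vf t.1.2 p * vf t.2 q + vf t.2 p * vf t.1.2 q).
have JG a k q : J (G (gx a k) q).
  elim/mpoly_mul_ind: q => [|c p q Jp Jq|b l q Jq].
  - by rewrite /G big1 // => t _; rewrite !vf1 !mulr0 addr0 scaler0.
  - have -> : G (gx a k) (c *: p + q) = c *: G (gx a k) p + G (gx a k) q.
      rewrite /G scaler_sumr -big_split; apply: eq_bigr => t _ /=.
      by rewrite !linearP /= -!mul_mpolyC; ring.
    exact: Jlin.
  - have -> : G (gx a k) (gx b l * q) = gx b l * G (gx a k) q + q * G (gx a k) (gx b l).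
      rewrite /G !mulr_sumr -big_split; apply: eq_bigr => t _ /=.
      by rewrite !vfM -!mul_mpolyC; ring.
    by apply: JD; apply: JM => //; apply: G1.
elim/mpoly_mul_ind => [|c p q Jp Jq|a k p Jp].
- rewrite vf1 addr0 big1 // => t _; rewrite vf1 linear0 scaler0 //.
- set x := (X in J X); have -> : x = c *: (\sum_(t <- s) t.1.1 *: vf t.1.2 (vf t.2 p) + vf F p) +
      (\sum_(t <- s) t.1.1 *: vf t.1.2 (vf t.2 q) + vf F q).
    have E : \sum_(t <- s) t.1.1 *: vf t.1.2 (vf t.2 (c *: p + q)) =
        c *: (\sum_(t <- s) t.1.1 *: vf t.1.2 (vf t.2 p)) +
        \sum_(t <- s) t.1.1 *: vf t.1.2 (vf t.2 q).
      rewrite scaler_sumr -big_split; apply: eq_bigr => t _ /=.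
      by rewrite !linearP /= -!mul_mpolyC; ring.
    by rewrite /x E linearP scalerDr addrACA.
  exact: Jlin.
- set x := (X in J X).
  have -> : x = gx a k * (\sum_(t <- s) t.1.1 *: vf t.1.2 (vf t.2 p) + vf F p) +
      (p * (\sum_(t <- s) t.1.1 *: vf t.1.2 (vf t.2 (gx a k)) + vf F (gx a k)) + G (gx a k) p).
    have E : \sum_(t <- s) t.1.1 *: vf t.1.2 (vf t.2 (gx a k * p)) =
        gx a k * (\sum_(t <- s) t.1.1 *: vf t.1.2 (vf t.2 p)) +
        p * (\sum_(t <- s) t.1.1 *: vf t.1.2 (vf t.2 (gx a k))) + G (gx a k) p.
      rewrite /G !mulr_sumr -!big_split; apply: eq_bigr => t _ /=.
      by rewrite !vfM linearD /= !vfM -!mul_mpolyC; ring.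
    rewrite /x E vfM; move: (\sum_(t <- s) _) (\sum_(t <- s) _) (G _ _) => A B C.
    by move: (vf F _) (vf F _) => a' b'; ring.
  by apply: (JD); [apply: (JM) | apply: JD; [apply: JM; apply: G2 | apply: JG]].
Qed.

End VectorFields.

(** * Weights and extremal vectors *)

Section Weights.
Variables (K : fieldType) (n r : nat).
Hypothesis charK : [pchar K] =i pred0.
Local Notation S := {mpoly K[n * r]}.
Implicit Types (w : 'I_n -> 'I_r -> K) (p q : S) (m : 'X_{1..n * r}).

(** Monomials are eigenvectors of these diagonal fields, so eigenvalues can be read off the support
    of a polynomial. *)
Definition wop w : S -> S := vf (\matrix_(a, k) (w a k *: gx K n r a k)).
HB.instance Definition _ w := GRing.Linear.on (wop w).

Definition mwt w m : K := \sum_a \sum_k (m (mxvec_index a k))%:R * w a k.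

Lemma wopX w m : wop w 'X_[m] = mwt w m *: 'X_[m].
Proof.
rewrite /wop vfE /mwt !scaler_suml; apply: eq_bigr => a _.
rewrite scaler_suml; apply: eq_bigr => k _; rewrite !mxE mderivX.
set i := mxvec_index a k; have [->|mi] := eqVneq (m i) 0%N.
  by rewrite mul0r !scale0r mulr0.
rewrite -scalerAl -scalerAr scalerA mulrC -mpolyXD; congr (_ *: 'X_[_]).
apply/mnmP => j; rewrite mnmDE mnmBE mnm1E; case: eqP => [<-|_] /=.
  by rewrite subnKC // lt0n.
by rewrite subn0.
Qed.

Lemma wop_coef w p m : (wop w p)@_m = mwt w m * p@_m.
Proof.
have -> : wop w p = \sum_(m' <- msupp p) (p@_m' * mwt w m') *: 'X_[m'].
  rewrite {1}(mpolyE p) linear_sum; apply: eq_bigr => m' _.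
  by rewrite linearZ /= wopX scalerA.
rewrite [in RHS](mpolyE p) !(raddf_sum (mcoeff m)) mulr_sumr.
apply: eq_bigr => m' _; rewrite /= !mcoeffZ mcoeffX.
by case: eqP => [->|_]; rewrite ?mulr0 // !mulr1 mulrC.
Qed.

Lemma wopE w p c : (forall m, m \in msupp p -> mwt w m = c) -> wop w p = c *: p.
Proof.
move=> wc; apply/mpolyP => m; rewrite wop_coef mcoeffZ.
by have [/wc->//|/memN_msupp_eq0->] := boolP (m \in msupp p); rewrite !mulr0.
Qed.

Lemma wop_eigen w p c m : wop w p = c *: p -> m \in msupp p -> c = mwt w m.
Proof.
move=> /(congr1 (mcoeff m)); rewrite wop_coef mcoeffZ mcoeff_msupp => + pm.
by move/(mulIf pm).
Qed.

Lemma wop_commute w w' p : wop w (wop w' p) = wop w' (wop w p).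
Proof. by apply/mpolyP => m; rewrite !wop_coef mulrCA. Qed.

Section Family.
Variables (T : Type) (W : T -> 'I_n -> 'I_r -> K).

(** Any monomial of p displays the eigenvalues, so no separate weight has to be carried along. For p
    = 0 the condition is void. *)
Definition weight_vector p : Prop :=
  forall s m, m \in msupp p -> wop (W s) p = mwt (W s) m *: p.

(** If p has monomials with two different eigenvalues under some operator, subtracting either
    eigenvalue from that operator gives an element of N with fewer monomials. The two elements
    differ by a nonzero multiple of p, so one of them is outside J. *)
Lemma exists_weight_vector (N J : S -> Prop) :
  is_subspace N -> is_subspace J -> (forall s p, N p -> N (wop (W s) p)) ->
  (exists2 p, N p & ~ J p) ->
  exists p, [/\ N p, ~ J p & weight_vector p].
Proof.
move=> [N0 Nlin] [J0 Jlin] NW [p Np Jp].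
have [d] := ubnP (size (msupp p)); elim: d p Np Jp => // d IH p Np Jp pd.
have [wp|nwp] := classic (weight_vector p); first by exists p.
have {nwp}[s /not_all_ex_not[m nwp]] := not_all_ex_not _ _ nwp.
have {nwp}[mp wm] := imply_to_and _ _ nwp.
have /allPn[m' m'p m'm] : ~~ all (fun m' => mwt (W s) m' == mwt (W s) m) (msupp p).
  by apply/negP => /allP am; apply/wm/wopE => m' /am/eqP.
pose q m1 := - mwt (W s) m1 *: p + wop (W s) p.
have qsz m1 : m1 \in msupp p -> (size (msupp (q m1)) < size (msupp p))%N.
  move=> m1p; apply: leq_ltn_trans (_ : size (rem m1 (msupp p)) < _)%N.
    apply: uniq_leq_size => // m2; rewrite mem_rem_uniq // inE !mcoeff_msupp /q.
    rewrite mcoeffD mcoeffZ wop_coef -mulrDl mulf_eq0 negb_or => /andP[h ->].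
    by rewrite andbT; apply: contraNneq h => ->; rewrite addNr.
  by rewrite size_rem // ltn_predL; case: (msupp p) m1p.
have Nq m1 : N (q m1) by apply: Nlin => //; apply: NW.
have [Jq|Jq] := classic (J (q m)); last first.
  by apply: (IH (q m)) => //; apply: leq_trans (qsz m mp) _.
apply: (IH (q m')) => //; last by apply: leq_trans (qsz m' m'p) _.
move=> Jq'; apply: Jp.
have c0 : mwt (W s) m' - mwt (W s) m != 0 by rewrite subr_eq0.
have -> : p = (mwt (W s) m' - mwt (W s) m)^-1 *: (- 1 *: q m' + q m) + 0.
  rewrite addr0 /q scaleN1r opprD addrACA addNr addr0 -scaleNr opprK -scalerDl.
  by rewrite scalerA mulVf // scale1r.
by apply: (Jlin) J0; apply: Jlin.
Qed.

Definition natw (lv : 'I_n -> 'I_r -> nat) : 'I_n -> 'I_r -> K :=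
  fun a k => (lv a k)%:R.

Lemma mwt_nat lv m :
  mwt (natw lv) m = (\sum_a \sum_k m (mxvec_index a k) * lv a k)%N%:R.
Proof.
rewrite /mwt natr_sum; apply: eq_bigr => a _.
by rewrite natr_sum; apply: eq_bigr => k _; rewrite natrM.
Qed.

Lemma natr_inj0 (i j : nat) : i%:R = j%:R :> K -> i = j.
Proof.
wlog ij : i j / (i <= j)%N => [hw e|].
  by have [/hw|/ltnW /hw h] := leqP i j; [apply | apply/esym/h].
move=> e; apply/eqP; rewrite eqn_leq ij -subn_eq0 -((pcharf0P K).1 charK).
by rewrite natrB // e subrr eqxx.
Qed.

Definition lowers (lv : 'I_n -> 'I_r -> nat) (F : S -> S) : Prop :=
  forall p, wop (natw lv) (F p) = F (wop (natw lv) p) - F p.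

Lemma lowers_eigen lv (F : {linear S -> S}) p c : lowers lv F ->
  wop (natw lv) p = c *: p -> wop (natw lv) (F p) = (c - 1) *: F p.
Proof. by move=> lF pe; rewrite lF pe linearZ /= scalerBl scale1r. Qed.

(** The eigenvalue on a nonzero polynomial is the grading of one of its monomials, hence a natural
    number, and d + 1 applications of F would make it negative. *)
Lemma lowers_nilpotent lv (F : {linear S -> S}) p d : lowers lv F ->
  wop (natw lv) p = d%:R *: p -> iter d.+1 F p = 0.
Proof.
move=> lF; elim: d p => [|d IH] p pd.
  apply/eqP/negPn/negP => Fp0.
  have /(lowers_eigen lF) := pd; rewrite sub0r => e.
  have := wop_eigen e (mlead_supp Fp0); rewrite mwt_nat => e2.
  have : (1 + \sum_a \sum_k mlead (F p) (mxvec_index a k) * lv a k)%N%:R = 0%:R :> K.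
    by rewrite natrD -e2 subrr.
  by move/natr_inj0.
rewrite iterSr; apply: IH.
by rewrite (lowers_eigen lF pd) -[d.+1]addn1 natrD addrK.
Qed.

(** As long as some F u leaves the element outside J, apply it; the level drops, so this stops.
    Weight vectors are chosen inside the eigenspaces [Nd] of the grading, which keeps the level
    unchanged by that choice. *)
Lemma exists_extremal (U : Type) (F : U -> {linear S -> S}) lv s0 (N J : S -> Prop) :
  W s0 = natw lv -> is_subspace N -> is_subspace J ->
  (forall s p, N p -> N (wop (W s) p)) -> (forall u p, N p -> N (F u p)) ->
  (forall u, lowers lv (F u)) ->
  (exists2 p, N p & ~ J p) ->
  exists p, [/\ N p, ~ J p, weight_vector p & forall u, J (F u p)].
Proof.
move=> Ws0 Nsub Jsub NW NF lF ex.
pose Nd d p := N p /\ wop (natw lv) p = d%:R *: p.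
have Ndsub d : is_subspace (Nd d).
  have [N0 Nlin] := Nsub; split=> [|c p q [Np ep] [Nq eq]].
    by split=> //; rewrite linear0 scaler0.
  by split; [exact: Nlin | rewrite linearP /= ep eq scalerDr !scalerA mulrC].
have NdW d s p : Nd d p -> Nd d (wop (W s) p).
  by move=> [Np ep]; split; [exact: NW | rewrite wop_commute ep linearZ].
have nz p : ~ J p -> p != 0 by move=> Jp; apply/eqP => p0; apply: Jp; rewrite p0; case: Jsub.
have [p [d [Np Jp]]] : exists p d, Nd d p /\ ~ J p.
  have [p [Np Jp wp]] := exists_weight_vector Nsub Jsub NW ex.
  exists p, (\sum_a \sum_k mlead p (mxvec_index a k) * lv a k)%N; split=> //; split=> //.
  by rewrite -mwt_nat -Ws0; apply: wp; apply: mlead_supp; apply: nz.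
elim: d p Np Jp => [|d IH] p Np Jp.
all: have [q [Nq Jq wq]] := exists_weight_vector (Ndsub _) Jsub (NdW _)
  (ex_intro2 _ _ p Np Jp).
all: have [Fq|/not_all_ex_not[u Fq]] := classic (forall u, J (F u q)).
1,3: by exists q; split=> //; case: Nq.
  have := lowers_nilpotent (lF u) Nq.2; rewrite /= => F0.
  by case: Fq; rewrite F0; case: Jsub.
apply: (IH (F u q)) => //; split; first by apply: NF; case: Nq.
by rewrite (lowers_eigen (lF u) Nq.2) -[d.+1]addn1 natrD addrK.
Qed.

End Family.

End Weights.

(** * Representations of the general linear Lie algebra *)

Definition i30 : 'I_3 := @Ordinal 3 0 isT.
Definition i31 : 'I_3 := @Ordinal 3 1 isT.
Definition i32 : 'I_3 := @Ordinal 3 2 isT.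

Lemma sum3 (V : nmodType) (F : 'I_3 -> V) : \sum_k F k = F i30 + F i31 + F i32.
Proof.
rewrite !big_ord_recl big_ord0 addr0 addrA.
by congr (F _ + F _ + F _); apply: val_inj.
Qed.

Lemma brk_delta (R : pzRingType) r (a b c d : 'I_r) :
  brk (delta_mx a b : 'M[R]_r) (delta_mx c d) =
  (b == c)%:R *: delta_mx a d - (d == a)%:R *: delta_mx c b.
Proof. by rewrite /brk !mul_delta_mx_cond !scaler_nat. Qed.

Section GL.
Variables (K : fieldType) (r : nat) (V : lmodType K).
Variable E : 'I_r -> 'I_r -> {linear V -> V}.
Hypothesis E_comm : forall a b c d p, E a b (E c d p) =
  E c d (E a b p) + ((b == c)%:R *: E a d p - (d == a)%:R *: E c b p).

Definition CE (p : V) : V := \sum_k \sum_l E k l (E l k p).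

Lemma CE_is_linear : linear CE.
Proof.
move=> c p q; rewrite /CE scaler_sumr -big_split; apply: eq_bigr => k _.
rewrite scaler_sumr -big_split; apply: eq_bigr => l _.
by rewrite !linearP.
Qed.
HB.instance Definition _ := GRing.isLinear.Build K V V _ CE CE_is_linear.

Lemma sum_pick (i : 'I_r) (F : 'I_r -> V) : \sum_k (i == k)%:R *: F k = F i.
Proof.
rewrite (bigD1 i) //= eqxx scale1r big1 ?addr0 // => k ki.
by rewrite eq_sym (negPf ki) scale0r.
Qed.

Lemma CE_E a b p : CE (E a b p) = E a b (CE p).
Proof.
apply/eqP; rewrite eq_sym -subr_eq0 /CE linear_sum -sumrB.
transitivity (\sum_k \sum_l ((b == k)%:R *: E a l (E l k p)
   - (a == l)%:R *: E k b (E l k p)) + \sum_k \sum_l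
   ((b == l)%:R *: E k l (E a k p) - (a == k)%:R *: E k l (E l b p)) == 0).
  congr (_ == 0); rewrite -big_split; apply: eq_bigr => k _ /=.
  rewrite linear_sum -sumrB -big_split; apply: eq_bigr => l _ /=.
  rewrite (E_comm a b k l (E l k p)) (E_comm a b l k p).
  rewrite linearD linearB !linearZ /= (eq_sym l a) (eq_sym k a).
  have AC (x y z : V) : x + y + z - x = z + y.
    by rewrite addrC !addrA addNr add0r addrC.
  exact: AC.
apply/eqP; rewrite -big_split /=.
transitivity (\sum_k ((b == k)%:R *: (\sum_l E a l (E l k p)) -
    E k b (E a k p) + (E k b (E a k p) -
    (a == k)%:R *: (\sum_l E k l (E l b p))))).
  apply: eq_bigr => k _; rewrite !sumrB -!scaler_sumr.
  by rewrite (sum_pick a (fun l => E k b (E l k p)))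
     (sum_pick b (fun l => E k l (E a k p))).
under eq_bigr => k _ do rewrite addrA subrK.
rewrite sumrB (sum_pick b (fun k => \sum_l E a l (E l k p))).
by rewrite (sum_pick a (fun k => \sum_l E k l (E l b p))) subrr.
Qed.

(** A product of operators CE - c. They commute with the action because CE is central, and a factor
    with c the value of CE on an isotypic component removes that component. *)
Fixpoint CEs (cs : seq K) (p : V) : V :=
  if cs is c :: cs' then CE (CEs cs' p) - c *: CEs cs' p else p.

Lemma CEs_is_linear cs : linear (CEs cs).
Proof.
elim: cs => [|c cs IH] a p q; first by [].
rewrite /= IH linearP /=; move: (CEs cs p) (CEs cs q) => x y.
by rewrite scalerDr opprD addrACA scalerBr !scalerA [c * a]mulrC.
Qed.
HB.instance Definition _ cs := GRing.isLinear.Build K V V _ (CEs cs) (CEs_is_linear cs).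

Lemma CEs_E cs a b p : CEs cs (E a b p) = E a b (CEs cs p).
Proof.
elim: cs => [|c cs IH]; first by [].
by rewrite /= IH CE_E [RHS]linearB [X in _ = _ - X]linearZ.
Qed.

Lemma CEs_cat cs cs' p : CEs (cs ++ cs') p = CEs cs (CEs cs' p).
Proof. by elim: cs => //= c cs ->. Qed.

Lemma CEs_CE cs p : CEs cs (CE p) = CE (CEs cs p).
Proof. by elim: cs => //= c cs ->; rewrite [RHS]linearB [X in _ = _ - X]linearZ. Qed.

Lemma CEsC cs cs' p : CEs cs (CEs cs' p) = CEs cs' (CEs cs p).
Proof. by elim: cs' => //= c cs' IH; rewrite [LHS]linearB [X in _ - X = _]linearZ /= CEs_CE IH. Qed.

Lemma CEs_stable (N : V -> Prop) cs p : N 0 ->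
  (forall c p q, N p -> N q -> N (c *: p + q)) ->
  (forall a b q, N q -> N (E a b q)) -> N p -> N (CEs cs p).
Proof.
move=> N0 Nlin NE Np; have Nsum (F : 'I_r -> V) : (forall k, N (F k)) -> N (\sum_k F k).
  move=> NF; apply: big_ind => // x y Nx Ny; rewrite -[x]scale1r; exact: Nlin.
elim: cs => //= c cs IH; rewrite addrC -scaleNr; apply: Nlin => //.
by apply: (Nsum) => k; apply: Nsum => l; apply: (NE); apply: NE.
Qed.

Lemma CEs_eigen (J : V -> Prop) cs p c : J 0 ->
  (forall c p q, J p -> J q -> J (c *: p + q)) ->
  (forall a b q, J q -> J (E a b q)) -> J (CE p - c *: p) ->
  J (CEs cs p - (\prod_(d <- cs) (c - d)) *: p).
Proof.
move=> J0 Jlin JE Jp; elim: cs => [|d cs IH] /=.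
  by rewrite big_nil scale1r subrr.
have JCE q : J q -> J (CE q).
  move=> Jq; have -> : CE q = CEs [:: 0] q by rewrite /= scale0r subr0.
  exact: CEs_stable.
rewrite big_cons; set P := \prod_(d <- cs) _ in IH *.
have -> : CE (CEs cs p) - d *: CEs cs p - (c - d) * P *: p =
    - d *: (CEs cs p - P *: p) + (P *: (CE p - c *: p) +
      (1 *: CE (CEs cs p - P *: p) + 0)).
  have CEE q : CE (q - P *: p) = CE q - P *: CE p by rewrite linearB linearZ.
  rewrite addr0 scale1r CEE scaleNr.
  rewrite !scalerBr !scalerA mulrBl scalerBl [P * c]mulrC.
  have AC (x y z t u : V) : x - y - (u - t) = - (y - t) + (z - u + (x - z)).
    have -> : z - u + (x - z) = x - u by rewrite addrC addrA subrK.
    by rewrite !opprB addrACA [RHS]addrACA [t + x]addrC.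
  exact: AC.
by apply: (Jlin) => //; apply: (Jlin) => //; apply: Jlin => //; apply: JCE.
Qed.

End GL.

Lemma gl3_kill02 (K : fieldType) (V : lmodType K) (E : 'I_3 -> 'I_3 -> {linear V -> V}) p :
  (forall a b c d p, E a b (E c d p) =
    E c d (E a b p) + ((b == c)%:R *: E a d p - (d == a)%:R *: E c b p)) ->
  E i30 i31 p = 0 -> E i31 i32 p = 0 -> E i30 i32 p = 0.
Proof.
move=> E_comm E01 E12; have := E_comm i30 i31 i31 i32 p.
by rewrite E01 E12 !linear0 eqxx scale1r scale0r subr0 add0r.
Qed.

Section Level.
Variables (K : fieldType) (V : lmodType K) (E : 'I_3 -> 'I_3 -> {linear V -> V}).
Hypothesis E_comm : forall a b c d p, E a b (E c d p) =
    E c d (E a b p) + ((b == c)%:R *: E a d p - (d == a)%:R *: E c b p).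

(** On polynomials E_11 + 2 E_22 adds up the column indices of the variables of a monomial, and both
    raising operators replace a column index by the preceding one. *)
Lemma gl3_level01 p : E i31 i31 (E i30 i31 p) + 2%:R *: E i32 i32 (E i30 i31 p) =
  E i30 i31 (E i31 i31 p + 2%:R *: E i32 i32 p) - E i30 i31 p.
Proof.
have -> : E i30 i31 (E i31 i31 p + 2%:R *: E i32 i32 p) =
    E i30 i31 (E i31 i31 p) + 2%:R *: E i30 i31 (E i32 i32 p) by rewrite linearD linearZ.
rewrite (E_comm i31 i31 i30 i31) (E_comm i32 i32 i30 i31).
by rewrite !scale0r scale1r subr0 sub0r addr0 addrAC.
Qed.

Lemma gl3_level12 p : E i31 i31 (E i31 i32 p) + 2%:R *: E i32 i32 (E i31 i32 p) =
  E i31 i32 (E i31 i31 p + 2%:R *: E i32 i32 p) - E i31 i32 p.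
Proof.
have -> : E i31 i32 (E i31 i31 p + 2%:R *: E i32 i32 p) =
    E i31 i32 (E i31 i31 p) + 2%:R *: E i31 i32 (E i32 i32 p) by rewrite linearD linearZ.
rewrite (E_comm i31 i31 i31 i32) (E_comm i32 i32 i31 i32).
rewrite !scale0r !scale1r subr0 sub0r scalerBr !scaler_nat !mulr2n.
move: (E i31 i32 (E i31 i31 p)) (E i31 i32 (E i32 i32 p)) (E i31 i32 p) => x y z.
by rewrite opprD !addrA [LHS](ACl (1*3*4*6*(2*5)))/= subrr addr0.
Qed.

End Level.

(** * Highest weights of sl_2 modulo a subspace *)

Section SL2.
Variables (K : fieldType) (V : lmodType K).
Hypothesis charK : [pchar K] =i pred0.

(** Modulo J, e f^(k+1) p = (k+1)(c - k) f^k p. At the first power of f that takes p into J this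
    coefficient must vanish, so c is a natural number. *)
Lemma sl2_weight_nonneg (e f h : {linear V -> V}) (J : V -> Prop) p (c : int) d :
  J 0 -> (forall c p q, J p -> J q -> J (c *: p + q)) -> (forall q, e (f q) - f (e q) = h q) ->
  (forall q, h (f q) - f (h q) = - (2%:R *: f q)) ->
  (forall q, J q -> J (e q)) -> (forall q, J q -> J (f q)) ->
  ~ J p -> J (e p) -> h p = c%:~R *: p -> J (iter d f p) -> 0 <= c.
Proof.
move=> J0 Jlin ef hf Je Jf Jp Jep hp Jd.
have hk k : h (iter k f p) = (c - (2 * k)%N%:Z)%:~R *: iter k f p.
  elim: k => [|k IH]; first by rewrite muln0 subr0.
  have -> : h (iter k.+1 f p) = f (h (iter k f p)) - 2%:R *: f (iter k f p).
    by rewrite -(hf (iter k f p)) addrC subrK.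
  rewrite IH linearZ /= -scalerBl; congr (_ *: _).
  have -> : c - (2 * k.+1)%N%:Z = (c - (2 * k)%N%:Z) - 2%:Z by lia.
  by rewrite [RHS]intrB.
have ek k : exists2 j, J j & e (iter k.+1 f p) =
    (k.+1%:Z * (c - k%:Z))%:~R *: iter k f p + j.
  elim: k => [|k [j Jj IH]].
    exists (f (e p)); first exact: Jf.
    by rewrite -[LHS](subrK (f (e p))) ef hp mul1r subr0.
  exists (f j); first exact: Jf.
  have -> : e (iter k.+2 f p) = h (iter k.+1 f p) + f (e (iter k.+1 f p)).
    by rewrite -(ef (iter k.+1 f p)) subrK.
  rewrite hk IH linearD linearZ /= addrA -scalerDl -rmorphD; congr (_%:~R *: _ + _).
  lia.
have Jscale (a : K) q : a != 0 -> J (a *: q) -> J q.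
  by move=> a0 Jq; rewrite -(scalerK a0 q) -[_ *: _]addr0; apply: Jlin.
elim: d Jd => [//|d IH] Jd.
have [/IH//|Jd'] := classic (J (iter d f p)).
have [j Jj ejd] := ek d.
suff -> : c = d%:Z by [].
apply/eqP; rewrite -subr_eq0; apply/negPn/negP => cd; apply: Jd'.
apply: (Jscale (d.+1%:Z * (c - d%:Z))%:~R); first by rewrite intr_eq0_char0 // mulf_neq0.
rewrite -[_ *: _](addrK j) -ejd addrC -scaleN1r.
by apply: Jlin => //; apply: Je.
Qed.

End SL2.

(** * Highest weight vectors in polynomial representations of gl_3 *)

Section GL3.
Variables (K : fieldType) (V : lmodType K) (E : 'I_3 -> 'I_3 -> {linear V -> V}).
Hypothesis charK : [pchar K] =i pred0.
Hypothesis E_comm : forall a b c d p, E a b (E c d p) =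
  E c d (E a b p) + ((b == c)%:R *: E a d p - (d == a)%:R *: E c b p).
(* V is a polynomial representation of gl_3. *)
Hypothesis E_nat : forall k p c, p != 0 -> E k k p = c *: p ->
  exists d : nat, c = d%:R.

(** The value (u, u + 2 rho) of the Casimir element of gl_3, with 2 rho = (2, 0, -2). *)
Definition cE (u : int * int * int) : int :=
  u.1.1 * u.1.1 + u.1.2 * u.1.2 + u.2 * u.2 + 2 * u.1.1 - 2 * u.2.

Definition gl_weight (u : int * int * int) (p : V) : Prop :=
  [/\ E i30 i30 p = u.1.1%:~R *: p, E i31 i31 p = u.1.2%:~R *: p &
      E i32 i32 p = u.2%:~R *: p].

Definition dominant (u : int * int * int) : Prop := u.1.2 <= u.1.1 /\ u.2 <= u.1.2.

Lemma gl_weight_up0 u p : gl_weight u p ->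
  gl_weight (u.1.1 + 1, u.1.2 - 1, u.2) (E i30 i31 p).
Proof.
move=> [w0 w1 w2]; split; rewrite E_comm ?w0 ?w1 ?w2 linearZ /= ?scale0r ?subr0 ?addr0 ?sub0r //.
  by rewrite scale1r intrD scalerDl scale1r.
by rewrite scale1r intrB scalerBl scale1r.
Qed.

Lemma gl_weight_up1 u p : gl_weight u p ->
  gl_weight (u.1.1, u.1.2 + 1, u.2 - 1) (E i31 i32 p).
Proof.
move=> [w0 w1 w2]; split; rewrite E_comm ?w0 ?w1 ?w2 linearZ /= ?scale0r ?subr0 ?addr0 ?sub0r //.
  by rewrite scale1r intrD scalerDl scale1r.
by rewrite scale1r intrB scalerBl scale1r.
Qed.

Lemma gl_weight_nat u p : gl_weight u p -> p != 0 ->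
  [/\ 0 <= u.1.1, 0 <= u.1.2 & 0 <= u.2].
Proof.
have nn (c : int) k : p != 0 -> E k k p = c%:~R *: p -> 0 <= c.
  move=> p0 /(E_nat p0)[d]; case: c => // c /eqP.
  rewrite NegzE mulrNz eq_sym -addr_eq0 -[_%:~R]/(c.+1%:R) -natrD.
  by rewrite ((pcharf0P K).1 charK) addnS.
by move=> [w0 w1 w2] p0; split; [apply: nn w0|apply: nn w1|apply: nn w2].
Qed.

Section ModuloSubspace.
Variable J : V -> Prop.
Hypothesis J0 : J 0.
Hypothesis Jlin : forall c p q, J p -> J q -> J (c *: p + q).
Hypothesis JE : forall a b q, J q -> J (E a b q).

Lemma CE_hw u p : gl_weight u p ->
  J (E i30 i31 p) -> J (E i31 i32 p) -> J (CE E p - (cE u)%:~R *: p).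
Proof.
move=> [w0 w1 w2] J01 J12.
have J02 : J (E i30 i32 p).
  have -> : E i30 i32 p = -1 *: E i31 i32 (E i30 i31 p) + (1 *: E i30 i31 (E i31 i32 p) + 0).
    by rewrite (E_comm i30 i31 i31 i32) eqxx !scale1r scale0r subr0 addr0 scaleN1r addrA addNr add0r.
  by apply: (Jlin); [apply: JE | apply: Jlin => //; apply: JE].
have up (k l : 'I_3) : k != l -> E k l (E l k p) = E l k (E k l p) + (E k k p - E l l p).
  by move=> kl; rewrite E_comm !eqxx !scale1r.
have -> : CE E p - (cE u)%:~R *: p = 2%:R *: E i31 i30 (E i30 i31 p) +
   (2%:R *: E i32 i30 (E i30 i32 p) + (2%:R *: E i32 i31 (E i31 i32 p) + 0)).
  rewrite /CE !sum3 (up i30 i31) // (up i30 i32) // (up i31 i32) //.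
  rewrite w0 w1 w2 !linearZ /= w0 w1 w2 !scalerA /cE.
  move: (E i31 i30 _) (E i32 i30 _) (E i32 i31 _) => A B C.
  rewrite !scalerN -!scalerBl !scaler_nat !mulr2n addr0 !addrA -scaleNr.
  rewrite [LHS](ACl ((2*6)*((4*10)*(8*11))*(1*3*5*7*9*12*13))) /= -!scalerDl.
  rewrite !(intrD, intrM, mulrNz) /=; set t := (X in X *: p).
  have -> : t = 0 by rewrite /t; ring.
  by rewrite scale0r addr0 !addrA.
by do 2![apply: (Jlin); first exact: JE]; apply: Jlin => //; apply: JE.
Qed.

Lemma gl_nilpotent (k l : 'I_3) d p : k != l -> E k k p = d%:R *: p ->
  iter d.+1 (E l k) p = 0.
Proof.
move=> kl; have low q c : E k k q = c *: q -> E k k (E l k q) = (c - 1) *: E l k q.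
  move=> e; rewrite E_comm e linearZ /= (negPf kl) eqxx scale0r sub0r scale1r.
  by rewrite scalerBl scale1r.
elim: d p => [|d IH] p e.
  apply/eqP/negPn/negP => q0; have [d] := E_nat q0 (low _ _ e).
  by move/eqP; rewrite sub0r eq_sym -addr_eq0 -(natrD _ _ 1) ((pcharf0P K).1 charK) addn1.
rewrite iterSr; apply: IH.
by rewrite (low _ _ e) -[d.+1]addn1 natrD addrK.
Qed.

(** This is [sl2_weight_nonneg] for E_kl, E_lk and E_kk - E_ll; E_lk acts nilpotently because the
    eigenvalues of E_kk are natural numbers. *)
Lemma gl_step_dominant (k l : 'I_3) p (a b : int) : k != l -> ~ J p ->
  E k k p = a%:~R *: p -> E l l p = b%:~R *: p -> J (E k l p) -> b <= a.
Proof.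
move=> kl Jp wk wl Jkl; rewrite -subr_ge0.
have p0 : p != 0 by apply/eqP => p0; apply: Jp; rewrite p0.
have [d ad] := E_nat p0 wk; rewrite ad in wk.
apply: (@sl2_weight_nonneg K V charK (E k l) (E l k)
  (E k k \- E l l) J p (a - b) d.+1 J0 Jlin) => //.
- by move=> q; rewrite E_comm !eqxx !scale1r /= addrC addKr.
- move=> q; rewrite linearB /= (E_comm k k l k) (E_comm l l l k) !eqxx (negPf kl).
  rewrite !scale1r !scale0r sub0r subr0 scaler_nat mulr2n.
  move: (E l k (E k k q)) (E l k (E l l q)) (E l k q) => x y z.
  rewrite !opprB !opprD !addrA [LHS](ACl (1*6*(3*5)*(2*4)))/= subrr add0r.
  by rewrite addNr add0r.
- exact: JE.
- exact: JE.
- by rewrite /= wk wl -scalerBl intrB ad.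
- by rewrite (gl_nilpotent kl wk).
Qed.

End ModuloSubspace.

(** The dominance order of gl_3, with the simple roots (1, -1, 0) and (0, 1, -1). *)
Definition above (u v : int * int * int) : Prop := exists i j : nat,
  v = (u.1.1 + i%:Z, u.1.2 - i%:Z + j%:Z, u.2 - j%:Z).

(** The difference is (v - u, u + v + 2 rho), where v - u is a nonzero sum of positive roots and u +
    v + 2 rho is strictly dominant. *)
Lemma cE_mono u v : dominant u -> dominant v -> above u v -> u <> v -> cE u < cE v.
Proof.
case: u => [[u0 u1] u2] [/= u10 u21] [v10 v21] [i [j vE]] uv.
have ij : (0 < i + j)%N.
  rewrite lt0n; apply/eqP => ij0; apply: uv; rewrite vE.
  by rewrite /=; congr (_, _, _); lia.
move: v10 v21; rewrite vE /cE /= => v10 v21.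
set I := i%:Z; set Jz := j%:Z.
have I0 : 0 <= I by []. have J0 : 0 <= Jz by [].
have IJ : 0 < I + Jz by rewrite /I /Jz; lia.
rewrite -subr_gt0.
have -> : (u0 + I) * (u0 + I) + (u1 - I + Jz) * (u1 - I + Jz) + (u2 - Jz) * (u2 - Jz) +
     2 * (u0 + I) - 2 * (u2 - Jz) - (u0 * u0 + u1 * u1 + u2 * u2 + 2 * u0 - 2 * u2) =
   I * ((u0 - u1) + (u0 + I - (u1 - I + Jz))) + Jz * ((u1 - u2) + (u1 - I + Jz - (u2 - Jz)))
   + 2 * (I + Jz) by ring.
rewrite -/I -/Jz in v10 v21.
have : 0 <= I * ((u0 - u1) + (u0 + I - (u1 - I + Jz))) by apply: mulr_ge0; lia.
have : 0 <= Jz * ((u1 - u2) + (u1 - I + Jz - (u2 - Jz))) by apply: mulr_ge0; lia.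
lia.
Qed.

Lemma above_up0 u v : above (u.1.1 + 1, u.1.2 - 1, u.2) v -> above u v /\ u <> v.
Proof.
case: u => [[u0 u1] u2] [i [j ->]]; split; last by case=> /=; lia.
by exists i.+1, j; rewrite /=; congr (_, _, _); lia.
Qed.

Lemma above_up1 u v : above (u.1.1, u.1.2 + 1, u.2 - 1) v -> above u v /\ u <> v.
Proof.
case: u => [[u0 u1] u2] [i [j ->]]; split; last by case=> /=; lia.
by exists i, j.+1; rewrite /=; congr (_, _, _); lia.
Qed.

(** Induction on the level u_1 + 2 u_2, which the raising operators decrease and which cannot be
    negative on a nonzero vector. Once factors killing E_01 q and E_12 q are applied, what remains
    of q is 0 or a highest weight vector of weight u, killed by the further factor CE - cE u. *)
Lemma CE_kill (d : nat) u q : gl_weight u q -> u.1.2 + 2 * u.2 < d%:Z ->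
  exists2 cs : seq K, CEs E cs q = 0 & forall c, c \in cs ->
    exists v, [/\ dominant v, above u v & c = (cE v)%:~R].
Proof.
elim: d u q => [|d IH] u q wq ud.
  exists [::] => //=; apply/eqP/negPn/negP => /(gl_weight_nat wq)[]; lia.
have [cs0 k0 P0] := IH _ _ (gl_weight_up0 wq) ltac:(rewrite /=; lia).
have [cs1 k1 P1] := IH _ _ (gl_weight_up1 wq) ltac:(rewrite /=; lia).
pose q' := CEs E (cs0 ++ cs1) q.
have q'0 : E i30 i31 q' = 0.
  by rewrite /q' CEs_cat CEsC -!(CEs_E E_comm) k0 linear0.
have q'1 : E i31 i32 q' = 0.
  by rewrite /q' CEs_cat -!(CEs_E E_comm) k1 linear0.
have Pcs c : c \in cs0 ++ cs1 -> exists v, [/\ dominant v, above u v & c = (cE v)%:~R].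
  rewrite mem_cat => /orP[/P0|/P1] [v [dv av ->]]; exists v; split=> //.
    by case: (above_up0 av).
  by case: (above_up1 av).
have [q'00|q'n] := eqVneq q' 0; first by exists (cs0 ++ cs1).
have wq' : gl_weight u q'.
  by case: wq => w0 w1 w2; split; rewrite -(CEs_E E_comm) ?w0 ?w1 ?w2 linearZ.
pose Z (x : V) := x = 0.
have Zlin c (x y : V) : Z x -> Z y -> Z (c *: x + y).
  by rewrite /Z => -> ->; rewrite scaler0 addr0.
have ZE a b (x : V) : Z x -> Z (E a b x) by rewrite /Z => ->; rewrite linear0.
have q'N : ~ Z q' by move=> h; rewrite /Z in h; rewrite h eqxx in q'n.
exists ((cE u)%:~R :: (cs0 ++ cs1)).
  exact: (CE_hw (J := Z) erefl Zlin ZE wq' q'0 q'1).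
move=> c; rewrite inE => /orP[/eqP->|/Pcs//]; exists u; split=> //; last first.
  by exists 0%N, 0%N; case: (u) => [[u0 u1] u2] /=; congr (_, _, _); lia.
case: wq' => w0 w1 w2.
by split; [apply: (gl_step_dominant (J := Z) erefl Zlin ZE _ q'N w0 w1 q'0)
          |apply: (gl_step_dominant (J := Z) erefl Zlin ZE _ q'N w1 w2 q'1)].
Qed.

(** The factors that kill E_01 p and E_12 p belong to weights v strictly above the dominant weight
    u. Modulo J their product acts on p by the product of the cE u - cE v, nonzero by [cE_mono], so
    p stays outside J while its images under the raising operators become 0. *)
Lemma highest_weight_lift (I J : V -> Prop) u p :
  I 0 -> (forall c p q, I p -> I q -> I (c *: p + q)) ->
  (forall a b q, I q -> I (E a b q)) ->
  J 0 -> (forall c p q, J p -> J q -> J (c *: p + q)) ->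
  (forall a b q, J q -> J (E a b q)) ->
  gl_weight u p -> I p -> ~ J p -> J (E i30 i31 p) -> J (E i31 i32 p) ->
  exists p', [/\ I p', ~ J p', gl_weight u p', E i30 i31 p' = 0 & E i31 i32 p' = 0].
Proof.
move=> I0 Ilin IE J0 Jlin JE wp Ip Jp J01 J12.
have level (v : int * int * int) : exists d : nat, v.1.2 + 2 * v.2 < d%:Z.
  exists (absz (v.1.2 + 2 * v.2)).+1; lia.
have [d0 l0] := level (u.1.1 + 1, u.1.2 - 1, u.2).
have [d1 l1] := level (u.1.1, u.1.2 + 1, u.2 - 1).
have [cs0 k0 P0] := CE_kill (gl_weight_up0 wp) l0.
have [cs1 k1 P1] := CE_kill (gl_weight_up1 wp) l1.
have domu : dominant u.
  by case: wp => w0 w1 w2; split; [apply: (gl_step_dominant J0 Jlin JE _ Jp w0 w1 J01)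
          |apply: (gl_step_dominant J0 Jlin JE _ Jp w1 w2 J12)].
exists (CEs E (cs0 ++ cs1) p); split.
- exact: CEs_stable.
- move=> JP; have JC := CEs_eigen (cs0 ++ cs1) J0 Jlin JE (CE_hw J0 Jlin JE wp J01 J12).
  set P := \prod_(d <- _) _ in JC.
  have P0' : P != 0.
    rewrite prodf_seq_neq0; apply/allP => c; rewrite mem_cat => /orP[/P0|/P1] [v [dv av ->]].
      have [av' uv] := above_up0 av.
      by rewrite -intrB intr_eq0_char0 // subr_eq0 lt_eqF // cE_mono.
    have [av' uv] := above_up1 av.
    by rewrite -intrB intr_eq0_char0 // subr_eq0 lt_eqF // cE_mono.
  apply: Jp; rewrite -(scalerK P0' p) -[_ *: _]addr0; apply: (Jlin) => //.
  have -> : P *: p = -1 *: (CEs E (cs0 ++ cs1) p - P *: p) + CEs E (cs0 ++ cs1) p.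
    by rewrite scaleN1r opprB subrK.
  exact: Jlin.
- by case: wp => w0 w1 w2; split; rewrite -(CEs_E E_comm) ?w0 ?w1 ?w2 linearZ.
- by rewrite CEs_cat CEsC -!(CEs_E E_comm) k0 linear0.
- by rewrite CEs_cat -!(CEs_E E_comm) k1 linear0.
Qed.

End GL3.

(** * The ideal of the quadrics *)

Section IdealSpan.
Variables (K : fieldType) (N : nat) (Q : {mpoly K[N]} -> Prop).

Lemma ideal_span_mem q : Q q -> ideal_span Q q.
Proof.
move=> Qq; exists [:: (1, q)]; split; last by rewrite big_seq1 mul1r.
by move=> y; rewrite inE => /eqP ->.
Qed.

Lemma ideal_span0 : ideal_span Q 0.
Proof. by exists [::]; rewrite big_nil. Qed.

Lemma ideal_spanD p q : ideal_span Q p -> ideal_span Q q -> ideal_span Q (p + q).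
Proof.
move=> [s [Qs ->]] [t [Qt ->]]; exists (s ++ t); split; last by rewrite big_cat.
by move=> y; rewrite mem_cat => /orP[/Qs|/Qt].
Qed.

Lemma ideal_spanM p q : ideal_span Q q -> ideal_span Q (p * q).
Proof.
move=> [s [Qs ->]]; exists [seq (p * y.1, y.2) | y <- s]; split.
  by move=> y /mapP[z zs ->]; apply: (Qs z zs).
by rewrite mulr_sumr big_map; apply: eq_bigr => y _; rewrite mulrA.
Qed.

Lemma ideal_spanZ c q : ideal_span Q q -> ideal_span Q (c *: q).
Proof. by move=> Jq; rewrite -mul_mpolyC; apply: ideal_spanM. Qed.

Lemma ideal_span_lin c p q :
  ideal_span Q p -> ideal_span Q q -> ideal_span Q (c *: p + q).
Proof. by move=> Jp Jq; apply: ideal_spanD => //; apply: ideal_spanZ. Qed.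

Lemma ideal_span_sum (T : eqType) (s : seq T) (F : T -> {mpoly K[N]}) :
  (forall t, t \in s -> ideal_span Q (F t)) -> ideal_span Q (\sum_(t <- s) F t).
Proof.
elim: s => [|t s IH] JF; first by rewrite big_nil; apply: ideal_span0.
rewrite big_cons; apply: ideal_spanD; first by apply: JF; rewrite mem_head.
by apply: IH => u us; apply: JF; rewrite inE us orbT.
Qed.

Lemma ideal_span_stable (d : {linear {mpoly K[N]} -> {mpoly K[N]}}) :
  (forall p q, d (p * q) = d p * q + p * d q) ->
  (forall q, Q q -> ideal_span Q (d q)) ->
  forall p, ideal_span Q p -> ideal_span Q (d p).
Proof.
move=> dM dQ p [s [Qs ->]]; rewrite linear_sum; apply: ideal_span_sum => y ys.
rewrite dM; apply: ideal_spanD; apply: ideal_spanM; last by apply/dQ/Qs.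
exact/ideal_span_mem/Qs.
Qed.

End IdealSpan.

Lemma ideal_span_ideal (K : fieldType) n r (Q : {mpoly K[n * r]} -> Prop) :
  is_ideal (ideal_span Q).
Proof. by split; [exact: ideal_span0 | exact: ideal_spanD | exact: ideal_spanM]. Qed.

Definition Eop (K : fieldType) n r (a b : 'I_r) : {mpoly K[n * r]} -> {mpoly K[n * r]} :=
  De (delta_mx a b).
HB.instance Definition _ K n r a b := GRing.Linear.on (@Eop K n r a b).

Section Eop.
Variables (K : fieldType) (n r : nat).
Local Notation S := {mpoly K[n * r]}.
Local Notation E := (@Eop K n r).

Lemma EopE (a b : 'I_r) : E a b = vf (gx K n r *m cmx n r (delta_mx a b)) :> (S -> S).
Proof. by []. Qed.

Lemma Eop_comm a b c d p : E a b (E c d p) =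
  E c d (E a b p) + ((b == c)%:R *: E a d p - (d == a)%:R *: E c b p).
Proof.
rewrite -[LHS](subrK (E c d (E a b p))) addrC; congr (_ + _).
by rewrite /Eop De_brk brk_delta DeD -scaleNr !DeZ scaleNr.
Qed.

Lemma gx_deltaE (a b : 'I_r) (i : 'I_n) (k : 'I_r) :
  (gx K n r *m cmx n r (delta_mx a b)) i k = (b == k)%:R *: gx K n r i a.
Proof.
rewrite mxE (bigD1 a) //= big1 => [|l la].
  by rewrite !mxE eqxx addr0 eq_sym -mul_mpolyC mulrC.
by rewrite !mxE (negPf la) mpolyC0 mulr0.
Qed.

Lemma Eop_gx a b i k : E a b (gx K n r i k) = (b == k)%:R *: gx K n r i a.
Proof. by rewrite EopE vfX gx_deltaE. Qed.

Lemma Eop_diag k p : E k k p = wop (fun _ l => (l == k)%:R) p.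
Proof.
rewrite EopE /wop; congr (vf _ p); apply/matrixP => a l.
rewrite gx_deltaE [RHS]mxE eq_sym.
by have [->|_] := eqVneq l k; rewrite // !scale0r.
Qed.

Lemma cmx_gxE (A : 'M[K]_n) a k :
  (cmx n r A *m gx K n r) a k = \sum_c A a c *: gx K n r c k.
Proof. by rewrite mxE; apply: eq_bigr => c _; rewrite mxE mul_mpolyC. Qed.

Lemma vf_vf_gx (A B : 'M[K]_n) a k :
  Dg A (Dg B (gx K n r a k)) = (cmx n r (B *m A) *m gx K n r) a k.
Proof.
rewrite [Dg B _]/Dg vfX -(map_Dg r A B).
by rewrite [RHS]mxE.
Qed.

Lemma vf_eulerE p : vf (gx K n r) p = \sum_k E k k p.
Proof.
have -> : gx K n r = \sum_k gx K n r *m cmx n r (delta_mx k k).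
  rewrite -mulmx_sumr -[LHS]mulmx1; congr (_ *m _).
  apply/matrixP => i j; rewrite summxE (bigD1 i) //= big1 => [|l li].
    by rewrite !mxE eqxx addr0 eq_sym; case: eqP => _; rewrite ?mpolyC0 ?mpolyC1.
  by rewrite !mxE eq_sym (negPf li) mpolyC0.
elim: (index_enum _) => [|k s IH]; first by rewrite !big_nil vf0l.
by rewrite !big_cons vf_addl IH EopE.
Qed.

Lemma Dg_scalar c p : Dg (c%:M : 'M[K]_n) p = - c *: \sum_k E k k p.
Proof.
rewrite -scalemx1 DgZ -vf_eulerE scaleNr -scalerN; congr (_ *: _).
rewrite /Dg -vf_oppl; congr (vf _ p).
by rewrite /cmx map_mx1 mul1mx.
Qed.

Lemma Dg_diag (A : 'M[K]_n) (p : S) : (forall i j, i != j -> A i j = 0) ->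
  Dg A p = wop (fun a _ => - A a a) p.
Proof.
move=> A0; rewrite /Dg /wop; congr (vf _ p); apply/matrixP => a k.
rewrite mxE cmx_gxE mxE (bigD1 a) //= big1 => [|c ca]; last first.
  by rewrite A0 ?scale0r // eq_sym.
by rewrite addr0 scaleNr.
Qed.

Lemma quadE (A : 'M[K]_n) k l : ((gx K n r)^T *m cmx n r A *m gx K n r) k l =
  \sum_a \sum_b A a b *: (gx K n r a k * gx K n r b l).
Proof.
rewrite mxE exchange_big; apply: eq_bigr => b _ /=.
rewrite mxE mulr_suml; apply: eq_bigr => a _.
by rewrite [cmx _ _ _ _ _]mxE [_^T _ _]mxE -mul_mpolyC mulrAC mulrC !mulrA.
Qed.

End Eop.

Lemma entries_lin (K : pzRingType) (V : lmodType K) n (T : Type) (s : seq (K * T))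
    (F : T -> 'M[K]_n) (Y : 'I_n -> 'I_n -> V) :
  \sum_a \sum_b (\sum_(t <- s) t.1 *: F t.2) a b *: Y a b =
  \sum_(t <- s) t.1 *: (\sum_a \sum_b F t.2 a b *: Y a b).
Proof.
under [RHS]eq_bigr => t _ do rewrite scaler_sumr.
rewrite [RHS]exchange_big; apply: eq_bigr => a _ /=.
under [RHS]eq_bigr => t _ do rewrite scaler_sumr.
rewrite [RHS]exchange_big; apply: eq_bigr => b _ /=.
rewrite summxE scaler_suml; apply: eq_bigr => t _.
by rewrite mxE scalerA.
Qed.

(** * The ideal generated by the quadrics and its symmetries *)

Section F4Ideal.
Variable K : fieldType.
Local Notation S := {mpoly K[26 * 3]}.
Local Notation x := (gx K 26 3).
Local Notation E := (@Eop K 26 3).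
Local Notation C := (cmx 26 3).

Definition gform (c : nat) : 'M[K]_26 := zmx K 26 (nth [::] all_forms c).

Definition gquad (c : nat) : 'M[S]_3 := x^T *m C (gform c) *m x.

Lemma gquadE c k l : gquad c k l = \sum_a \sum_b gform c a b *: (x a k * x b l).
Proof. exact: quadE. Qed.

Definition gquads (q : S) : Prop := exists c k l, (c < 79)%N /\ q = gquad c k l.

Definition J : S -> Prop := ideal_span gquads.

Lemma gform52 (c : 'I_52) : gform c = formK forms52 K c.
Proof. by rewrite /gform nth_forms52. Qed.

Lemma gform27 (c : 'I_27) : gform (52 + c) = formK forms27 K c.
Proof. by rewrite /gform nth_forms27. Qed.

Lemma gform_act y c : (c < 79)%N -> exists s : seq (K * nat),
  (forall t, t \in s -> (t.2 < 79)%N) /\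
  - ((rho26 K y)^T *m gform c + gform c *m rho26 K y) = \sum_(t <- s) t.1 *: gform t.2.
Proof.
move=> c79; case: (ltnP c 52) => c52.
  exists [seq (rho52 K y r (Ordinal c52), r : nat) | r <- enum 'I_52]; split.
    by move=> t /mapP[r _ ->]; apply: leq_trans (ltn_ord r) _.
  rewrite -[c]/(val (Ordinal c52)) gform52 (form_checkP forms52_check).
  rewrite big_map big_enum; apply: eq_bigr => r _.
  by rewrite gform52.
have c27 : (c - 52 < 27)%N by lia.
exists [seq (formrep 27 e26 f26 h26 K y r (Ordinal c27), (52 + r)%N) | r <- enum 'I_27]; split.
  by move=> t /mapP[r _ ->]; have := ltn_ord r; rewrite /=; lia.
have e : gform c = formK forms27 K (Ordinal c27).
  by rewrite -gform27; congr gform; rewrite /=; lia.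
rewrite e (form_checkP forms27_check) big_map big_enum; apply: eq_bigr => r _.
by rewrite gform27.
Qed.

Lemma J_quad (A : 'M[K]_26) s k l : (forall t, t \in s -> (t.2 < 79)%N) ->
  A = \sum_(t <- s) t.1 *: gform t.2 -> J ((x^T *m C A *m x) k l).
Proof.
move=> s79 AE; have -> : (x^T *m C A *m x) k l = \sum_(t <- s) t.1 *: gquad t.2 k l.
  apply: etrans (quadE A k l) _; rewrite AE; apply: etrans (entries_lin _ _ _) _.
  by apply: eq_bigr => t _; congr (_ *: _); apply: esym (gquadE _ _ _).
apply: ideal_span_sum => t ts; apply: ideal_spanZ; apply: ideal_span_mem.
by exists t.2, k, l; split => //; apply: s79.
Qed.

Lemma J_Dg y p : J p -> J (Dg (rho26 K y) p).
Proof.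
apply: (@ideal_span_stable _ _ _ (Dg (rho26 K y))).
  by move=> p' q; apply: vfM.
move=> q [c [k [l [c79 ->]]]]; have [s [s79 e]] := gform_act y c79.
suff eq : Dg (rho26 K y) (gquad c k l) =
   (x^T *m C (- ((rho26 K y)^T *m gform c + gform c *m rho26 K y)) *m x) k l.
  by apply: (eq_ind _ J (J_quad k l s79 e)); apply: esym eq.
have -> : Dg (rho26 K y) (gquad c k l) =
    map_mx (vf (- (C (rho26 K y) *m x))) (x^T *m C (gform c) *m x) k l by rewrite [RHS]mxE.
rewrite !map_vf_mul map_vf_const mulmx0 addr0 map_vf_gx.
have -> : map_mx (vf (- (C (rho26 K y) *m x))) x^T = - (x^T *m C (rho26 K y)^T).
  rewrite -map_trmx map_vf_gx linearN /= trmx_mul; congr (- (_ *m _)).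
  by rewrite /cmx map_trmx.
congr (_ _ k l); rewrite /cmx map_mxN map_mxD !map_mxM -!/(cmx 26 3 _).
by rewrite !(mulmxN, mulNmx) mulmxDr mulmxDl opprD !mulmxA.
Qed.

Lemma J_E a b p : J p -> J (E a b p).
Proof.
apply: (@ideal_span_stable _ _ _ (E a b)).
  by move=> p' q; apply: vfM.
move=> q [c [k [l [c79 ->]]]].
suff eq : J (map_mx (vf (x *m C (delta_mx a b))) (x^T *m C (gform c) *m x) k l).
  by move: eq; rewrite mxE.
rewrite !map_vf_mul map_vf_const mulmx0 addr0 map_vf_gx.
have -> : map_mx (vf (x *m C (delta_mx a b))) x^T = C (delta_mx b a) *m x^T.
  rewrite -map_trmx map_vf_gx trmx_mul; congr (_ *m _).
  by rewrite /cmx map_trmx trmx_delta.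
have -> : C (delta_mx b a) *m x^T *m C (gform c) *m x +
    x^T *m C (gform c) *m (x *m C (delta_mx a b)) =
    C (delta_mx b a) *m gquad c + gquad c *m C (delta_mx a b).
  by rewrite /gquad !mulmxA.
rewrite mxE; apply: ideal_spanD; rewrite mxE; apply: ideal_span_sum => j _.
  by apply: ideal_spanM; apply: ideal_span_mem; exists c, j, l.
by rewrite mulrC; apply: ideal_spanM; apply: ideal_span_mem; exists c, k, j.
Qed.

End F4Ideal.

(** * The Casimir operator modulo the quadrics *)

Section CasimirModJ.
Variable K : fieldType.
Local Notation S := {mpoly K[26 * 3]}.
Local Notation x := (gx K 26 3).
Local Notation E := (@Eop K 26 3).
Local Notation C := (cmx 26 3).
Local Notation J := (@J K).
Local Notation Z A := (zmx K 26 A).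

Lemma casimir_quad (a b : 'I_26) (k l : 'I_3) :
  J (\sum_(t <- casimir) t.1.1%:~R *: ((C (Z t.1.2) *m x) a k * (C (Z t.2) *m x) b l)
     - 24%:~R *: (x a k * x b l + x b k * x a l)).
Proof.
have [s [/allP s79 sE]] := casimir_tensor K a b.
pose y c d : S := x c k * x d l.
have -> : \sum_(t <- casimir) t.1.1%:~R *: ((C (Z t.1.2) *m x) a k * (C (Z t.2) *m x) b l)
   = \sum_c \sum_d (\sum_(t <- casimir) t.1.1%:~R * (Z t.1.2 a c * Z t.2 b d)) *: y c d.
  transitivity (\sum_(t <- casimir) \sum_c \sum_d
      (t.1.1%:~R * (Z t.1.2 a c * Z t.2 b d)) *: y c d).
    apply: eq_bigr => t _; rewrite !cmx_gxE mulr_suml scaler_sumr; apply: eq_bigr => c _.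
    rewrite mulr_sumr scaler_sumr; apply: eq_bigr => d _.
    by rewrite -scalerAl -scalerAr !scalerA mulrA.
  rewrite exchange_big; apply: eq_bigr => c _; rewrite exchange_big; apply: eq_bigr => d _.
  by rewrite scaler_suml.
have -> : \sum_c \sum_d (\sum_(t <- casimir) t.1.1%:~R * (Z t.1.2 a c * Z t.2 b d)) *: y c d
  = 24%:~R *: (y a b + y b a) + \sum_(t <- s) t.1%:~R *: gquad K t.2 k l.
  transitivity (\sum_c \sum_d ((24%:~R * ((c == a)%:R * (d == b)%:R)) *: y c d +
     (24%:~R * ((c == b)%:R * (d == a)%:R)) *: y c d +
     \sum_(t <- s) (t.1%:~R * gform K t.2 c d) *: y c d)).
    apply: eq_bigr => c _; apply: eq_bigr => d _.
    by rewrite sE mulrDr !scalerDl scaler_suml.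
  have pick (c d : 'I_26) : \sum_c' \sum_d'
      (24%:~R * ((c' == c)%:R * (d' == d)%:R)) *: y c' d' = 24%:~R *: y c d.
    rewrite (bigD1 c) //= [X in _ + X]big1 => [|c' cc']; last first.
      by rewrite big1 // => d' _; rewrite (negPf cc') mul0r mulr0 scale0r.
    rewrite (bigD1 d) //= [X in _ + X + _]big1 => [|d' dd']; last first.
      by rewrite (negPf dd') !mulr0 scale0r.
    by rewrite !eqxx !mulr1 !addr0.
  under eq_bigr => c _ do rewrite !big_split.
  rewrite !big_split /= !pick -scalerDr; congr (_ + _).
  under eq_bigr => c _ do rewrite exchange_big.
  rewrite exchange_big; apply: eq_bigr => t _; rewrite gquadE scaler_sumr.
  apply: eq_bigr => c _; rewrite scaler_sumr; apply: eq_bigr => d _.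
  by rewrite scalerA.
rewrite /y addrAC subrr add0r; apply: ideal_span_sum => t ts.
apply: ideal_spanZ; apply: ideal_span_mem; exists t.2, k, l; split=> //.
exact: s79.
Qed.

Section Operator.
Variables c d : K.

(** The symbols dictate c: that of CE is the swapped product of coordinates, that of Eu^2 the plain
    one. Degree 1 dictates d: there the Casimir term, CE, Eu^2 and Eu take the values 576, 3, 1 and
    1, so that c = 24 gives d = 480. *)
Definition cas_op (p : S) : S :=
  \sum_(t <- casimir) t.1.1%:~R *: Dg (Z t.1.2) (Dg (Z t.2) p)
  - c *: CE E p - c *: vf x (vf x p) - d *: vf x p.

Definition cas_terms : seq (K * 'M[S]_(26, 3) * 'M[S]_(26, 3)) :=
  [seq (t.1.1%:~R, - (C (Z t.1.2) *m x), - (C (Z t.2) *m x)) | t <- casimir] ++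
  ([seq (- c, x *m C (delta_mx u.1 u.2), x *m C (delta_mx u.2 u.1))
     | u <- index_enum ('I_3 * 'I_3)%type] ++ [:: (- c, x, x)]).

Lemma sum_cas_terms (F : K * 'M[S]_(26, 3) * 'M[S]_(26, 3) -> S) :
  \sum_(t <- cas_terms) F t =
  \sum_(t <- casimir) F (t.1.1%:~R, - (C (Z t.1.2) *m x), - (C (Z t.2) *m x)) +
  (\sum_(u : 'I_3 * 'I_3) F (- c, x *m C (delta_mx u.1 u.2), x *m C (delta_mx u.2 u.1))
   + F (- c, x, x)).
Proof.
apply: etrans; [exact: big_cat | congr (_ + _); first exact: big_map].
apply: etrans; [exact: big_cat | congr (_ + _); first exact: big_map].
exact: big_seq1.
Qed.

Lemma CE_pairs p : CE E p = \sum_(u : 'I_3 * 'I_3) E u.1 u.2 (E u.2 u.1 p).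
Proof. exact: (pair_bigA _ (fun k l => E k l (E l k p))). Qed.

Lemma cas_opE p : cas_op p =
  \sum_(t <- cas_terms) t.1.1 *: vf t.1.2 (vf t.2 p) + vf ((- d)%:MP *: x) p.
Proof.
have e1 : vf ((- d)%:MP *: x) p = - (d *: vf x p).
  by rewrite vf_scalel mul_mpolyC scaleNr.
have e2 : \sum_(u : 'I_3 * 'I_3) - c *:
    vf (x *m C (delta_mx u.1 u.2)) (vf (x *m C (delta_mx u.2 u.1)) p) = - (c *: CE E p).
  rewrite CE_pairs -scaleNr; apply: esym; exact: scaler_sumr.
have e3 : - c *: vf x (vf x p) = - (c *: vf x (vf x p)) by rewrite scaleNr.
apply: esym; apply: etrans (congr2 +%R (sum_cas_terms _) e1) _.
apply: etrans (congr2 (fun a b => _ + (a + b) - _) e2 e3) _.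
by rewrite /cas_op addrA.
Qed.

Lemma sum_pick2 (V : lmodType K) (i j : 'I_3) (F : 'I_3 -> 'I_3 -> V) :
  \sum_(u : 'I_3 * 'I_3) (i == u.1)%:R *: ((j == u.2)%:R *: F u.1 u.2) = F i j.
Proof.
rewrite -(pair_bigA _ (fun p q => (i == p)%:R *: ((j == q)%:R *: F p q))) /=.
under eq_bigr => p _ do rewrite -scaler_sumr sum_pick.
exact: sum_pick.
Qed.

Lemma vf_deltaE (p q : 'I_3) a k :
  vf (x *m C (delta_mx p q)) (x a k) = (q == k)%:R *: x a p.
Proof. exact: Eop_gx. Qed.

Lemma casimir_E_quad a k b l : \sum_(u : 'I_3 * 'I_3) - c *:
     (vf (x *m C (delta_mx u.1 u.2)) (x a k) * vf (x *m C (delta_mx u.2 u.1)) (x b l) +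
      vf (x *m C (delta_mx u.2 u.1)) (x a k) * vf (x *m C (delta_mx u.1 u.2)) (x b l)) =
     - c *: (x a l * x b k + x a l * x b k).
Proof.
rewrite -scaler_sumr; congr (_ *: _).
transitivity (\sum_(u : 'I_3 * 'I_3)
    ((l == u.1)%:R *: ((k == u.2)%:R *: (x a u.1 * x b u.2)) +
     (k == u.1)%:R *: ((l == u.2)%:R *: (x a u.2 * x b u.1)))).
  apply: eq_bigr => -[p q] _ /=; rewrite !vf_deltaE.
  rewrite (eq_sym l) (eq_sym k) (eq_sym l) (eq_sym k).
  by rewrite -!scalerAl -!scalerAr; congr (_ + _); rewrite !scalerA mulrC.
rewrite big_split; congr (_ + _).
  exact: (sum_pick2 l k (fun p q => x a p * x b q)).
exact: (sum_pick2 k l (fun p q => x a q * x b p)).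
Qed.

Hypothesis c24 : c = 24%:~R.
Hypothesis d480 : 576%:~R - c *+ 4 - d = 0.

(* Both contributions of the Casimir element of F4 cancel against those of
   gl_3 and of the Euler field by [casimir_quad]. *)
Lemma cas_op_J p : J (cas_op p).
Proof.
have xC (A : 'M[K]_26) a k : vf (- (C A *m x)) (x a k) = - (C A *m x) a k.
  by rewrite vfX mxE.
rewrite cas_opE; apply: (second_order_ideal (ideal_span_ideal _)) => [a k b l|a k].
  have J1 := casimir_quad a b k l; have J2 := casimir_quad b a l k.
  rewrite -c24 in J1 J2; have JJ := ideal_spanD J1 J2.
  apply: (eq_ind _ J JJ); apply: esym; apply: etrans (sum_cas_terms _) _.
  set A1 := \sum_(t <- casimir) _ in JJ *; set A2 := \sum_(t <- casimir) _ in JJ *.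
  rewrite casimir_E_quad !vfX.
  have e1 : \sum_(t <- casimir) t.1.1%:~R *:
     (vf (- (C (Z t.1.2) *m x)) (x a k) * vf (- (C (Z t.2) *m x)) (x b l) +
      vf (- (C (Z t.2) *m x)) (x a k) * vf (- (C (Z t.1.2) *m x)) (x b l)) = A1 + A2.
    rewrite /A1 /A2 -big_split; apply: eq_bigr => t _.
    apply: etrans (scalerDr _ _ _) _; congr (_ *: _ + _ *: _);
      apply: etrans (congr2 *%R (xC _ _ _) (xC _ _ _)) _; first exact: mulrNN.
    by apply: etrans (mulrNN _ _) _; apply: mulrC.
  apply: etrans (congr1 (fun y => y + _) e1) _.
  move: (A1) (A2) => y z; rewrite -!mul_mpolyC mpolyCN; ring.
apply: (eq_ind 0 J (ideal_span0 _)); apply: esym.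
apply: etrans (congr1 (fun y => y + _) (sum_cas_terms _)) _.
rewrite [vf x (x a k)]vfX.
have e1 : \sum_(t <- casimir) t.1.1%:~R *:
   vf (- (C (Z t.1.2) *m x)) (vf (- (C (Z t.2) *m x)) (x a k)) = 576%:~R *: x a k.
  transitivity (\sum_(t <- casimir) t.1.1%:~R *: (C (Z t.2 *m Z t.1.2) *m x) a k).
    by apply: eq_bigr => t _; congr (_ *: _); apply: vf_vf_gx.
  transitivity ((C (\sum_(t <- casimir) t.1.1%:~R *: (Z t.2 *m Z t.1.2)) *m x) a k).
    rewrite cmx_gxE; under eq_bigr => t _ do rewrite cmx_gxE scaler_sumr.
    rewrite exchange_big; apply: eq_bigr => i _; rewrite summxE scaler_suml.
    apply: eq_bigr => t _; rewrite scalerA; congr (_ *: _); apply: esym.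
    exact: mxE.
  rewrite casimir_scalar cmx_gxE (bigD1 a) //= big1 => [|i ia].
    by rewrite [_ a a]mxE [_%:M a a]mxE eqxx mulr1n mulr1 addr0.
  by rewrite [_ a i]mxE [_%:M a i]mxE eq_sym (negPf ia) mulr0n mulr0 scale0r.
have e2 : \sum_(u : 'I_3 * 'I_3) - c *:
    vf (x *m C (delta_mx u.1 u.2)) (vf (x *m C (delta_mx u.2 u.1)) (x a k)) = - c *: (3%:R *: x a k).
  rewrite -scaler_sumr; congr (_ *: _).
  transitivity (\sum_(u : 'I_3 * 'I_3) (k == u.1)%:R *: x a k).
    apply: eq_bigr => -[p' q] _ /=; rewrite vf_deltaE linearZ /= vf_deltaE eqxx scale1r.
    by rewrite eq_sym; case: eqP => [->|_] //; rewrite !scale0r.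
  rewrite -(pair_bigA _ (fun p q => (k == p)%:R *: x a k)) exchange_big /=.
  under eq_bigr => q _ do rewrite (sum_pick k (fun=> x a k)).
  by rewrite sumr_const card_ord scaler_nat.
apply: etrans (congr2 (fun y z => y + (z + _) + _) e1 e2) _.
rewrite vfX vfX [(_ *: x) a k]mxE.
have -> : d = 576%:~R - c *+ 4 by apply/eqP; rewrite eq_sym -subr_eq0 d480.
rewrite mul_mpolyC !scalerA -!scalerDl; set t := (X in X *: _ = _).
have -> : t = 0 by rewrite /t /=; ring.
exact: scale0r.
Qed.

End Operator.

End CasimirModJ.

(** * Curves and column operations *)

Section Curves.
Variables (K L : fieldType) (iota : {rmorphism K -> L}) (n r : nat).
Local Notation S := {mpoly K[n * r]}.
Local Notation gx := (gx K n r).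

Lemma peval_gx (phi : 'M[L]_(n, r)) a k : peval iota (gx a k) phi = phi a k.
Proof. by rewrite /peval mxE mmapX mmap1U mxvecE. Qed.

Lemma pevalM (phi : 'M[L]_(n, r)) p q :
  peval iota (p * q) phi = peval iota p phi * peval iota q phi.
Proof. exact: rmorphM. Qed.

Lemma pevalD (phi : 'M[L]_(n, r)) p q :
  peval iota (p + q) phi = peval iota p phi + peval iota q phi.
Proof. exact: rmorphD. Qed.

Lemma peval0 (phi : 'M[L]_(n, r)) : peval iota 0 phi = 0.
Proof. exact: rmorph0. Qed.

Lemma peval1 (phi : 'M[L]_(n, r)) : peval iota 1 phi = 1.
Proof. exact: rmorph1. Qed.

Lemma pevalZ (phi : 'M[L]_(n, r)) c p :
  peval iota (c *: p) phi = iota c * peval iota p phi.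
Proof. exact: mmapZ. Qed.

Lemma peval_sum (phi : 'M[L]_(n, r)) (T : Type) (s : seq T) (F : T -> S) :
  peval iota (\sum_(t <- s) F t) phi = \sum_(t <- s) peval iota (F t) phi.
Proof. exact: rmorph_sum. Qed.

(** The restriction of p to the polynomial curve c. *)
Definition cev (c : 'M[{poly L}]_(n, r)) (p : S) : {poly L} :=
  mmap (@polyC L \o iota) (fun i => mxvec c 0 i) p.

Lemma cev_gx c a k : cev c (gx a k) = c a k.
Proof. by rewrite /cev mxE mmapX mmap1U mxvecE. Qed.

Lemma cevM c p q : cev c (p * q) = cev c p * cev c q.
Proof. exact: rmorphM. Qed.

Lemma cevD c p q : cev c (p + q) = cev c p + cev c q.
Proof. exact: rmorphD. Qed.

Lemma cevZ c a p : cev c (a *: p) = (iota a)%:P * cev c p.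
Proof. exact: mmapZ. Qed.

Lemma cev0 c : cev c 0 = 0.
Proof. exact: rmorph0. Qed.

Lemma cev1 c : cev c 1 = 1.
Proof. exact: rmorph1. Qed.

Lemma cev_sum c (T : Type) (s : seq T) (F : T -> S) :
  cev c (\sum_(t <- s) F t) = \sum_(t <- s) cev c (F t).
Proof. exact: rmorph_sum. Qed.

Lemma cev_horner c p t :
  (cev c p).[t] = peval iota p (\matrix_(a, k) (c a k).[t]).
Proof.
elim/mpoly_mul_ind: p => [|b p q IHp IHq|a k p IH].
- by rewrite cev1 peval1 hornerC.
- by rewrite cevD cevZ pevalD pevalZ hornerD hornerCM IHp IHq.
- by rewrite cevM pevalM cev_gx peval_gx hornerM IH mxE.
Qed.

Lemma mderiv_gx a k (i : 'I_(n * r)) : (gx a k)^`M(i) = (i == mxvec_index a k)%:R%:MP.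
Proof.
rewrite mxE mderivX mnm1E eq_sym; have [->|_] := eqVneq; last by rewrite scale0r.
rewrite scale1r; suff -> : (U_(mxvec_index a k) - U_(mxvec_index a k) = 0)%MM.
  by rewrite mpolyX0.
by apply/mnmP => j; rewrite mnmBE mnm0E subnn.
Qed.

Lemma cev_deriv c p : (cev c p)^`() =
  \sum_i (mxvec c 0 i)^`() * cev c (p^`M(i)).
Proof.
elim/mpoly_mul_ind: p => [|b p q IHp IHq|a k p IH].
- rewrite cev1 derivC big1 // => i _.
  by rewrite -mpolyC1 mderivC cev0 mulr0.
- rewrite cevD cevZ derivD derivM derivC mul0r add0r IHp IHq mulr_sumr -big_split.
  by apply: eq_bigr => i _; rewrite mderivD mderivZ cevD cevZ mulrDr mulrCA.
- rewrite cevM derivM IH cev_gx mulr_sumr.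
  transitivity (\sum_i (mxvec c 0 i)^`() * ((i == mxvec_index a k)%:R * cev c p) +
     \sum_i c a k * ((mxvec c 0 i)^`() * cev c p^`M(i))).
    congr (_ + _); rewrite (bigD1 (mxvec_index a k)) //= big1 => [|i ik].
      by rewrite mxvecE eqxx mul1r addr0.
    by rewrite (negPf ik) mul0r mulr0.
  rewrite -big_split; apply: eq_bigr => i _ /=.
  rewrite mderivM cevD !cevM cev_gx mulrDr mderiv_gx; congr (_ * (_ * _) + _).
    by case: eqP => _; rewrite ?mpolyC1 ?mpolyC0 ?cev1 ?cev0.
  by rewrite mulrCA.
Qed.

Lemma cev_deriv_vf (c : 'M[{poly L}]_(n, r)) (M : 'M[S]_(n, r)) p :
  (forall a k, (c a k)^`() = cev c (M a k)) -> (cev c p)^`() = cev c (vf M p).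
Proof.
move=> cM; rewrite cev_deriv /vf cev_sum; apply: eq_bigr => i _.
rewrite cevM; congr (_ * _); case/mxvec_indexP: i => a k.
by rewrite !mxvecE.
Qed.

Lemma cev_deriv0 (c : 'M[{poly L}]_(n, r)) (M : 'M[S]_(n, r)) p (phi : 'M[L]_(n, r)) :
  (forall a k, (c a k).[0] = phi a k) ->
  (forall a k, (c a k)^`().[0] = peval iota (M a k) phi) ->
  (cev c p)^`().[0] = peval iota (vf M p) phi.
Proof.
move=> c0 c1; rewrite cev_deriv /vf peval_sum horner_sum; apply: eq_bigr => i _.
rewrite hornerM pevalM cev_horner; congr (_ * _).
  by case/mxvec_indexP: i => a k; rewrite !mxvecE.
by congr (peval iota _ _); apply/matrixP => a k; rewrite mxE.
Qed.

Hypothesis charL : [pchar L] =i pred0.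

Lemma poly_vanish (q : {poly L}) : (forall t, q.[t] = 0) -> q = 0.
Proof.
move=> q0; apply/eqP/negPn/negP => qn.
have rts : all (root q) [seq i%:R | i <- seq.iota 0 (size q)].
  by apply/allP => _ /mapP[i _ ->]; rewrite /root q0.
have := max_poly_roots qn rts; rewrite map_inj_uniq ?iota_uniq; last first.
  by move=> i j; apply: natr_inj0.
by rewrite size_map size_iota ltnn => /(_ isT).
Qed.

(** Applied to curves in Y, this turns the stability of Y under families of transformations into the
    stability of its ideal under vector fields. *)
Lemma vanish_tangent (c : 'M[{poly L}]_(n, r)) (M : 'M[S]_(n, r)) p (phi : 'M[L]_(n, r)) :
  (forall a k, (c a k).[0] = phi a k) ->
  (forall a k, (c a k)^`().[0] = peval iota (M a k) phi) ->
  (forall t, peval iota p (\matrix_(a, k) (c a k).[t]) = 0) ->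
  peval iota (vf M p) phi = 0.
Proof.
move=> c0 c1 pc; rewrite -(cev_deriv0 p c0 c1) (poly_vanish (q := cev c p)) ?deriv0 ?horner0 //.
by move=> t; rewrite cev_horner pc.
Qed.

Lemma deriv_eq0_const (q : {poly L}) t : q^`() = 0 -> q.[t] = q.[0].
Proof.
move=> q'0; have -> : q = (q`_0)%:P; last by rewrite !hornerC.
apply/polyP => -[|i]; rewrite coefC //=.
have := coef_deriv q i; rewrite q'0 coef0 => /esym/eqP.
by rewrite -mulr_natr mulf_eq0 ((pcharf0P L).1 charL) orbF => /eqP.
Qed.

End Curves.

Lemma mxvec_index_eq m n (a b : 'I_m) (k l : 'I_n) :
  (mxvec_index a k == mxvec_index b l) = (a == b) && (k == l).
Proof.
apply/eqP/andP => [e|[/eqP-> /eqP->] //]; apply/andP.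
have := mxvecE (delta_mx a k : 'M[int]_(m, n)) a k.
by rewrite e mxvecE !mxE !eqxx eq_sym [l == k]eq_sym; case: (_ && _).
Qed.

Section Unipotent.
Variables (K L : fieldType) (iota : {rmorphism K -> L}) (n r : nat).
Hypothesis charL : [pchar L] =i pred0.
Local Notation S := {mpoly K[n * r]}.

(** The line c is the integral curve of [Eop k l] through phi, because adding multiples of column k
    to column l leaves column k unchanged. *)
Lemma unipotent_invariance (k l : 'I_r) (p : S) (phi : 'M[L]_(n, r)) (t : L) :
  k != l -> Eop k l p = 0 ->
  peval iota p (\matrix_(a, j) (phi a j + (j == l)%:R * t * phi a k)) = peval iota p phi.
Proof.
move=> kl Ep; pose c : 'M[{poly L}]_(n, r) :=
  \matrix_(a, j) ((phi a j)%:P + ((j == l)%:R * phi a k)%:P * 'X).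
have c' : (cev iota c p)^`() = 0.
  rewrite (cev_deriv_vf (M := gx K n r *m cmx n r (delta_mx k l))).
    by rewrite -EopE Ep cev0.
  move=> a j; rewrite gx_deltaE cevZ cev_gx !mxE.
  rewrite derivD derivM !derivC mul0r add0r derivX mulr1 add0r.
  rewrite (negPf kl) mul0r polyC0 mul0r addr0 eq_sym rmorph_nat.
  by rewrite polyCM ?rmorph_nat ?polyC_natr.
have := deriv_eq0_const charL t c'; rewrite !cev_horner => e.
have -> : \matrix_(a, j) (phi a j + (j == l)%:R * t * phi a k) = \matrix_(a, j) (c a j).[t].
  by apply/matrixP => a j; rewrite !mxE hornerD hornerM !hornerC hornerX mulrAC.
rewrite e; congr peval; apply/matrixP => a j.
by rewrite !mxE hornerD hornerM !hornerC hornerX mulr0 addr0.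
Qed.

End Unipotent.

Lemma char0_fraction (K : fieldType) n : [pchar K] =i pred0 ->
  [pchar {fraction {mpoly K[n]}}] =i pred0.
Proof.
move=> charK; apply/(pcharf0P _) => m.
rewrite -(rmorph_nat (@tofrac {mpoly K[n]})) tofrac_eq0.
by rewrite -mpolyC_nat mpolyC_eq0 ((pcharf0P K).1 charK).
Qed.

(* A generic matrix can be brought into the shape of phi below by column
   operations, that do not change the values of p. *)
Lemma unipotent_monomial (K : fieldType) n (p : {mpoly K[n * 3]}) (a0 a1 : 'I_n) :
  [pchar K] =i pred0 -> a0 != a1 ->
  Eop i30 i31 p = 0 -> Eop i31 i32 p = 0 -> p != 0 ->
  exists2 m, m \in msupp p & [/\ m (mxvec_index a0 i31) = 0%N,
    m (mxvec_index a0 i32) = 0%N & m (mxvec_index a1 i32) = 0%N].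
Proof.
move=> charK a01 E01 E12 p0.
have E02 : Eop i30 i32 p = 0.
  exact: (gl3_kill02 (E := @Eop K n 3) (@Eop_comm K n 3) E01 E12).
pose F := {fraction {mpoly K[n * 3]}}.
have charF : [pchar F] =i pred0 by apply: char0_fraction.
pose io : {rmorphism K -> F} := [the {rmorphism K -> F} of @tofrac _ \o @mpolyC (n * 3) K].
have [x xE] : exists x : 'M[F]_(n, 3), forall a k, x a k = tofrac (gx K n 3 a k).
  by exists (map_mx (@tofrac _) (gx K n 3)) => a k; rewrite mxE.
have pevx q : peval io q x = tofrac q.
  elim/mpoly_mul_ind: q => [|b q q' IH IH'|a k q IH].
  - by rewrite peval1 tofrac1.
  - by rewrite pevalD pevalZ IH IH' -mul_mpolyC tofracD tofracM.
  - by rewrite pevalM peval_gx IH xE tofracM.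
have xn0 a k : x a k != 0.
  rewrite xE tofrac_eq0 mxE; apply/eqP => /(congr1 (mcoeff U_(mxvec_index a k))).
  by rewrite mcoeffXU eqxx mcoeff0 => /eqP; rewrite oner_eq0.
pose col (k l : 'I_3) (t : F) (phi : 'M[F]_(n, 3)) : 'M[F]_(n, 3) :=
  \matrix_(a, j) (phi a j + (j == l)%:R * t * phi a k).
have colp k l t phi : k != l -> Eop k l p = 0 -> peval io p (col k l t phi) = peval io p phi.
  by move=> kl; apply: unipotent_invariance.
pose y := col i30 i32 (- (x a0 i32 / x a0 i30)) (col i30 i31 (- (x a0 i31 / x a0 i30)) x).
have y1 : y a0 i31 = 0.
  by rewrite !mxE /= !mul0r !addr0 !mul1r mulNr divfK ?addrN.
have y2 : y a0 i32 = 0.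
  by rewrite !mxE /= !mul0r !addr0 !mul1r mulNr divfK ?addrN.
(* Times x_{a0,0}, this entry is a 2 x 2 minor of the generic matrix, nonzero because its two
   monomials differ. *)
have y11 : y a1 i31 != 0.
  have -> : y a1 i31 = x a1 i31 - x a0 i31 / x a0 i30 * x a1 i30.
    by rewrite !mxE /= !mul0r !addr0 !mul1r mulNr.
  rewrite mulrAC subr_eq0; apply/eqP => /(congr1 ( *%R^~ (x a0 i30))).
  rewrite divfK // !xE -!tofracM => /eqP; rewrite tofrac_eq => /eqP.
  rewrite ![gx _ _ _ _ _]mxE => /(congr1 (mcoeff (U_(mxvec_index a1 i31) + U_(mxvec_index a0 i30)))).
  rewrite -!mpolyXD !mcoeffX eqxx; case: eqP => [|_ /eqP]; last by rewrite oner_eq0.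
  move=> /mnmP/(_ (mxvec_index a1 i31)); rewrite !mnmDE !mnm1E eqxx.
  by rewrite !mxvec_index_eq (negPf a01) !andbF !eqxx.
pose z := col i31 i32 (- (y a1 i32 / y a1 i31)) y.
have z01 : z a0 i31 = 0 by rewrite mxE y1 /= !mul0r addr0.
have z02 : z a0 i32 = 0 by rewrite mxE y1 y2 mulr0 addr0.
have z12 : z a1 i32 = 0 by rewrite mxE /= mul1r mulNr divfK ?addrN.
have pz : peval io p z != 0.
  have -> : peval io p z = tofrac p; last by rewrite tofrac_eq0.
  have n12 : i31 != i32 by [].
  have n02 : i30 != i32 by [].
  have n01 : i30 != i31 by [].
  have e1 := colp i31 i32 (- (y a1 i32 / y a1 i31)) y n12 E12.
  have e2 := colp i30 i32 (- (x a0 i32 / x a0 i30)) (col i30 i31 (- (x a0 i31 / x a0 i30)) x) n02 E02.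
  have e3 := colp i30 i31 (- (x a0 i31 / x a0 i30)) x n01 E01.
  apply: etrans e1 _.
  apply: etrans e2 _.
  apply: etrans e3 _.
  exact: pevx.
(* As p does not vanish at z, neither does one of its monomials, which therefore avoids the three
   zero entries of z. *)
have [m mp mz] : exists2 m, m \in msupp p & mmap1 (fun i => mxvec z 0 i) m != 0.
  have [//|none] := classic (exists2 m, m \in msupp p & mmap1 (fun i => mxvec z 0 i) m != 0).
  case/eqP: pz; rewrite /peval /mmap big_seq big1 // => m mp.
  have [->|nz] := eqVneq (mmap1 (fun i => mxvec z 0 i) m) 0; first by rewrite mulr0.
  by case: none; exists m.
have nz i : mxvec z 0 i = 0 -> m i = 0%N.
  move=> zi; apply/eqP; apply: contraNT mz => mi.
  by rewrite /mmap1 (bigD1 i) //= zi expr0n (negPf mi) mul0r.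
by exists m => //; split; apply: nz; rewrite mxvecE.
Qed.

(** * Polynomials vanishing on the cone *)

(** With lambda = (0, l2, l1 - l2, l0 - l1) in fundamental weights, the equality of Casimir values
    reads (lambda - mu, lambda + mu + 2 rho) = 0. As lambda - mu is a nonnegative combination of
    simple roots and lambda + mu + 2 rho is strictly dominant, lambda = mu. *)
Lemma dominance_rigidity (l0 l1 l2 m0 m1 m2 m3 N0 N1 N2 N3 : int) :
  l1 <= l0 -> l2 <= l1 -> 0 <= l2 ->
  0 <= m0 -> 0 <= m1 -> 0 <= m2 -> 0 <= m3 ->
  m0 = - (2 * N0 - N1) -> m1 = - (- N0 + 2 * N1 - N2) ->
  m2 = - (- 2 * N1 + 2 * N2 - N3) -> m3 = (l0 + l1 + l2) - (- N2 + 2 * N3) ->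
  0 <= N0 -> 0 <= N1 -> l2 <= N2 -> l1 + l2 <= N3 ->
  24 * (4 * m0 * m0 + 12 * m1 * m1 + 6 * m2 * m2 + 2 * m3 * m3 +
        12 * m0 * m1 + 8 * m0 * m2 + 4 * m0 * m3 + 16 * m1 * m2 + 8 * m1 * m3 + 6 * m2 * m3)
    + 48 * (16 * m0 + 30 * m1 + 21 * m2 + 11 * m3) =
  24 * (l0 * l0 + l1 * l1 + l2 * l2 + 2 * l0 - 2 * l2) + 24 * ((l0 + l1 + l2) * (l0 + l1 + l2))
    + 480 * (l0 + l1 + l2) ->
  [/\ N0 = 0, N1 = 0, N2 = l2 & N3 = l1 + l2].
Proof.
move=> l10 l21 l2_0 m0_0 m1_0 m2_0 m3_0 m0E m1E m2E m3E N0_0 N1_0 N2_0 N3_0 cas.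
(* The factors 2, 2, 1, 1 are the squared lengths of the simple roots, up to a common scalar. *)
have id : 2 * (N0 * (m0 + 2)) + 2 * (N1 * (l2 + m1 + 2)) + (N2 - l2) * (l1 - l2 + m2 + 2)
    + (N3 - (l1 + l2)) * (l0 - l1 + m3 + 2) = 0.
  apply: (@mulfI _ 24) => //; rewrite mulr0; move/esym/eqP: cas; rewrite -subr_eq0 => /eqP <-.
  by rewrite m0E m1E m2E m3E; ring.
have p0 : 0 <= N0 * (m0 + 2) by apply: mulr_ge0; lia.
have p1 : 0 <= N1 * (l2 + m1 + 2) by apply: mulr_ge0; lia.
have p2 : 0 <= (N2 - l2) * (l1 - l2 + m2 + 2) by apply: mulr_ge0; lia.
have p3 : 0 <= (N3 - (l1 + l2)) * (l0 - l1 + m3 + 2) by apply: mulr_ge0; lia.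
have z (u w : int) : 0 < w -> u * w = 0 -> u = 0.
  by move=> w0 /eqP; rewrite mulf_eq0 => /orP[/eqP//|/eqP w00]; rewrite w00 in w0.
split.
- by apply: (z N0 (m0 + 2)); lia.
- by apply: (z N1 (l2 + m1 + 2)); lia.
- by apply/eqP; rewrite -subr_eq0; apply/eqP/(z (N2 - l2) (l1 - l2 + m2 + 2)); lia.
- by apply/eqP; rewrite -subr_eq0; apply/eqP/(z (N3 - (l1 + l2)) (l0 - l1 + m3 + 2)); lia.
Qed.

Lemma sum4 (V : nmodType) (F : nat -> V) : \sum_(j < 4) F j = F 0%N + F 1%N + F 2%N + F 3%N.
Proof. by rewrite !big_ord_recl big_ord0 addr0 !addrA. Qed.

(** * Weights, gradings and the Casimir value of an extremal polynomial *)

Section Extremal.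
Variable K : fieldType.
Hypothesis charK : [pchar K] =i pred0.
Local Notation S := {mpoly K[26 * 3]}.
Local Notation E := (@Eop K 26 3).
Local Notation J := (@J K).
Local Notation D y := (@Dg K 26 3 (rho26 K y)).

(** Gradings lowered by the raising operators of gl_3, by the f_i and by the e_i, respectively. *)
Definition lvl (j : 'I_3) (a : 'I_26) (l : 'I_3) : nat :=
  match val j with 0 => l | 1 => height a | _ => 16 - height a end%N.

Definition WI := ('I_4 + ('I_3 + 'I_3))%type.

(** The first two families are the tori of F4 and of gl_3, the former with the sign of the dual of
    V; the third makes the gradings available to [exists_extremal]. *)
Definition W (s : WI) : 'I_26 -> 'I_3 -> K :=
  match s with
  | inl i => fun a _ => - (ient wt26 a i)%:~R
  | inr (inl k) => fun _ l => (l == k)%:R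
  | inr (inr j) => natw K (lvl j)
  end.

Lemma D_wop i p : D (Hgen i) p = wop (W (inl i)) p.
Proof.
apply: etrans (Dg_diag _ _) _.
  by move=> a b ab; rewrite /rho26 /rep_of /= zmx_diag (negPf ab).
congr vf; apply/matrixP => a k; rewrite !mxE; congr (- _ *: _).
by rewrite /h26 /ient /ldiag !nth_mkseq // eqxx.
Qed.

Lemma wop_lvl0 p : wop (W (inr (inr i30))) p = E i31 i31 p + 2%:R *: E i32 i32 p.
Proof.
apply/mpolyP => m; rewrite mcoeffD mcoeffZ !Eop_diag !wop_coef mulrA -mulrDl.
congr (_ * _); rewrite /mwt mulr_sumr -big_split; apply: eq_bigr => a _.
rewrite mulr_sumr -big_split; apply: eq_bigr => k _ /=.
rewrite mulrCA -mulrDr; congr (_ * _).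
by case: k => -[|[|[|]]] //= k3; rewrite /natw /lvl /=; ring.
Qed.

Definition heightmx : 'M[K]_26 := zmx K 26 (ldiag 26 (fun a => (height a)%:Z)).
Definition coheightmx : 'M[K]_26 := zmx K 26 (ldiag 26 (fun a => (16 - height a)%N%:Z)).

Lemma wop_diagmx (f : nat -> nat) p :
  wop (natw K (fun (a : 'I_26) (_ : 'I_3) => f a)) p =
  - Dg (zmx K 26 (ldiag 26 (fun a => (f a)%:Z))) p.
Proof.
rewrite (Dg_diag (A := zmx K 26 _)); last by move=> a b ab; rewrite zmx_diag (negPf ab).
rewrite /wop -vf_oppl; congr vf; apply/matrixP => a k.
by rewrite !mxE -scaleNr opprK /ient /ldiag !nth_mkseq // eqxx.
Qed.

Lemma wop_lvl1 p : wop (W (inr (inr i31))) p = - Dg heightmx p.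
Proof. exact: (wop_diagmx height). Qed.

Lemma wop_lvl2 p : wop (W (inr (inr i32))) p = - Dg coheightmx p.
Proof. exact: (wop_diagmx (fun a => 16 - height a)%N). Qed.

Lemma Dg_height p : 2%:~R *: Dg heightmx p =
  - 16%:~R *: \sum_k E k k p
  - \sum_(i < 4) (nth 0 [:: 22; 42; 30; 16] i)%:~R *: D (Hgen i) p.
Proof.
rewrite -DgZ (height_h K) DgD DgN scalemx1 Dg_scalar Dg_sum; congr (_ - _).
by apply: eq_bigr => i _; rewrite DgZ.
Qed.

Lemma coheightE : coheightmx = 16%:~R%:M - heightmx.
Proof.
apply/matrixP => a b; rewrite zmx_diag [RHS]mxE [X in _ = X + _]mxE.
rewrite [X in _ = _ + X]mxE zmx_diag.
have [->|_] := eqVneq a b; last by rewrite mulr0n subr0.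
have h16 : (height b <= 16)%N.
  have /allP chk : all (fun a => height a <= 16)%N (iota 0 26) by vm_compute.
  exact: (chk _ (mem_iota0 b)).
by rewrite -subzn // intrB.
Qed.

(** In characteristic 0 the gradings are combinations of the h_i and of the E_kk, by [Dg_height] for
    the height. *)
Lemma W_stable (N : S -> Prop) : is_subspace N ->
  (forall i p, N p -> N (D (Hgen i) p)) -> (forall k p, N p -> N (E k k p)) ->
  forall s p, N p -> N (wop (W s) p).
Proof.
move=> [N0 Nlin] ND NE.
have Nsum (T : Type) (s : seq T) (F : T -> S) : (forall t, N (F t)) -> N (\sum_(t <- s) F t).
  by move=> NF; apply: big_ind => // x y Nx Ny; rewrite -[x]scale1r; apply: Nlin.
have NZ c p : N p -> N (c *: p) by move=> Np; rewrite -[_ *: _]addr0; apply: Nlin.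
have Nh p : N p -> N (Dg heightmx p).
  move=> Np; have := Dg_height p => /(congr1 (fun q => 2%:~R^-1 *: q)).
  rewrite scalerK ?intr_eq0_char0 // => ->; apply: (NZ).
  apply: (Nlin); first by apply: (Nsum) => k; apply: NE.
  by rewrite -scaleN1r; apply: (NZ); apply: Nsum => i; apply: NZ; apply: ND.
move=> [i|[k|j]] p Np.
- by rewrite -D_wop; apply: ND.
- by move: (NE k p Np); rewrite Eop_diag.
- case: j => -[|[|[|//]]] j3.
  + have -> : Ordinal j3 = i30 by apply: val_inj.
    rewrite wop_lvl0 addrC; apply: Nlin; exact: NE.
  + have -> : Ordinal j3 = i31 by apply: val_inj.
    by rewrite wop_lvl1 -scaleN1r; apply: NZ; apply: Nh.
  + have -> : Ordinal j3 = i32 by apply: val_inj.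
    rewrite wop_lvl2 -scaleN1r coheightE; apply: (NZ).
    have -> : Dg (16%:~R%:M - heightmx) p = - 1 *: Dg heightmx p + Dg (16%:~R%:M) p.
      by rewrite DgD DgN scaleN1r addrC.
    apply: Nlin; first exact: Nh.
    by rewrite Dg_scalar; apply: NZ; apply: Nsum => k; apply: NE.
Qed.

Lemma lowers_diag (lv : 'I_26 -> 'I_3 -> nat) (A F : 'M[K]_26) :
  (forall p, wop (natw K lv) p = - Dg A p) -> brk A F = F ->
  lowers lv (@Dg K 26 3 F).
Proof.
move=> lvA AF p; rewrite !lvA.
have e := Dg_brk A F p; rewrite AF in e.
have -> : Dg F (- Dg A p) = - Dg F (Dg A p) by exact: linearN.
by rewrite -[in RHS]e opprB addrA addNr add0r.
Qed.

Lemma lowers_f i : lowers (lvl i31) (D (Fgen i)).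
Proof. exact: (lowers_diag wop_lvl1 (height_f K i)). Qed.

Lemma lowers_e i : lowers (lvl i32) (D (Egen i)).
Proof. exact: (lowers_diag wop_lvl2 (height_e K i)). Qed.

Lemma lowers_E01 : lowers (lvl i30) (E i30 i31).
Proof.
move=> p; rewrite -/(W (inr (inr i30))) !wop_lvl0.
exact: (gl3_level01 (E := E) (@Eop_comm K 26 3) p).
Qed.

Lemma lowers_E12 : lowers (lvl i30) (E i31 i32).
Proof.
move=> p; rewrite -/(W (inr (inr i30))) !wop_lvl0.
exact: (gl3_level12 (E := E) (@Eop_comm K 26 3) p).
Qed.

Lemma E_nat k (p : S) c : p != 0 -> E k k p = c *: p -> exists d : nat, c = d%:R.
Proof.
move=> p0; rewrite Eop_diag => e; have := wop_eigen e (mlead_supp p0).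
move=> ->; exists (\sum_a \sum_l mlead p (mxvec_index a l) * (l == k))%N.
rewrite -(mwt_nat K (fun (a : 'I_26) (l : 'I_3) => (l == k) : nat)).
by rewrite /mwt; do 2!(apply: eq_bigr => ? _).
Qed.

Definition mu (m : 'X_{1..26 * 3}) (i : nat) : int :=
  \sum_a \sum_k (m (mxvec_index a k))%:Z * ient wt26 (a : 'I_26) i.

Definition edeg (m : 'X_{1..26 * 3}) (k : 'I_3) : nat := \sum_(a < 26) m (mxvec_index a k).

(** The coefficient at the j-th simple root of the degree of m times omega_4, minus [mu m]. *)
Definition Nroot (m : 'X_{1..26 * 3}) (j : nat) : int :=
  \sum_a \sum_k (m (mxvec_index a k))%:Z * ient root26 (a : 'I_26) j.

Lemma mwt_mu m i : mwt (W (inl i)) m = (- mu m i)%:~R.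
Proof.
rewrite /mwt /mu rmorphN rmorph_sum /= -sumrN; apply: eq_bigr => a _.
rewrite rmorph_sum -sumrN; apply: eq_bigr => k _.
by rewrite /= mulrN intrM.
Qed.

Lemma mwt_edeg m k : mwt (W (inr (inl k))) m = (edeg m k)%:R.
Proof.
rewrite /mwt /edeg natr_sum; apply: eq_bigr => a _.
rewrite (bigD1 k) //= eqxx mulr1 big1 ?addr0 // => l lk.
by rewrite (negPf lk) mulr0.
Qed.

Lemma mu_root m i : (i < 4)%N -> mu m i =
  (edeg m i30 + edeg m i31 + edeg m i32)%N%:Z * (i == 3)%:Z - \sum_(j < 4) Nroot m j * cartN j i.
Proof.
move=> i4; transitivity (\sum_a \sum_k ((m (mxvec_index a k))%:Z * (i == 3)%:Z -
   \sum_(j < 4) (m (mxvec_index a k))%:Z * ient root26 (a : 'I_26) j * cartN j i)).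
  apply: eq_bigr => a _; apply: eq_bigr => k _; rewrite wt26_root // mulrBr mulr_sumr.
  by congr (_ - _); apply: eq_bigr => j _; rewrite mulrA.
under eq_bigr => a _ do rewrite sumrB.
rewrite sumrB; congr (_ - _).
  rewrite exchange_big sum3 /= /edeg !PoszD !mulrDl.
  by rewrite !(big_morph Posz PoszD (erefl 0%Z)) !mulr_suml.
under eq_bigr => a _ do rewrite exchange_big.
rewrite exchange_big; apply: eq_bigr => j _ /=; rewrite /Nroot mulr_suml.
by apply: eq_bigr => a _; rewrite mulr_suml.
Qed.

Lemma Jlin c (p q : S) : J p -> J q -> J (c *: p + q).
Proof. exact: ideal_span_lin. Qed.

Lemma J0 : J 0. Proof. exact: ideal_span0. Qed.

Lemma J_sub : is_subspace J. Proof. by split; [exact: J0 | exact: Jlin]. Qed.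

Lemma JZ c (p : S) : J p -> J (c *: p).
Proof. exact: ideal_spanZ. Qed.

Lemma JB (p q : S) : J p -> J q -> J (p - q).
Proof. by move=> Jp Jq; rewrite addrC -scaleN1r; apply: Jlin. Qed.

Lemma J_brk (A B : 'M[K]_26) p : J (Dg A (Dg B p)) -> J (Dg B (Dg A p)) -> J (Dg (brk A B) p).
Proof. by move=> JA JB'; apply: (eq_ind _ J _ _ (Dg_brk A B p)); apply: JB. Qed.

Lemma J_root t p : (t < 24)%N -> J p -> J (Dg (root_e K t) p) /\ J (Dg (root_f K t) p).
Proof.
elim/ltn_ind: t p => t IH p t24 Jp; have := eroot_rec K t24; case: ltnP => t4.
  by move=> [i [-> ->]]; split; apply: J_Dg.
move=> [i [u [ut -> ->]]]; have u24 := ltn_trans ut t24.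
split; apply: J_brk.
- by apply: J_Dg; case: (IH u ut _ u24 Jp).
- by case: (IH u ut _ u24 (J_Dg (Egen i) Jp)).
- by apply: J_Dg; case: (IH u ut _ u24 Jp).
- by case: (IH u ut _ u24 (J_Dg (Fgen i) Jp)).
Qed.

Lemma J_froot t p : (t < 24)%N -> (forall i, J (D (Fgen i) p)) -> J (Dg (root_f K t) p).
Proof.
move=> t24 Jf; elim/ltn_ind: t t24 => t IH t24; have := eroot_rec K t24; case: ltnP => t4.
  by move=> [i [_ ->]].
move=> [i [u [ut _ ->]]]; have u24 := ltn_trans ut t24.
apply: J_brk; last by case: (J_root u24 (Jf i)).
by apply: J_Dg; apply: IH.
Qed.

(** 48 (m, m + 2 rho), with m in fundamental weight coordinates. *)
Definition casimir_value (m : nat -> int) : int :=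
  24 * (\sum_(i < 4) \sum_(j < 4) ient weight_gram i j * (m i * m j)) +
  48 * (\sum_(i < 4) nth 0 [:: 16; 30; 21; 11] i * m i).

Lemma casimir_valueE (m : nat -> int) : casimir_value m =
  24 * (4 * m 0%N * m 0%N + 12 * m 1%N * m 1%N + 6 * m 2%N * m 2%N + 2 * m 3%N * m 3%N +
    12 * m 0%N * m 1%N + 8 * m 0%N * m 2%N + 4 * m 0%N * m 3%N + 16 * m 1%N * m 2%N +
    8 * m 1%N * m 3%N + 6 * m 2%N * m 3%N)
  + 48 * (16 * m 0%N + 30 * m 1%N + 21 * m 2%N + 11 * m 3%N).
Proof.
rewrite /casimir_value (sum4 (fun i => \sum_(j < 4) ient weight_gram i j * (m i * m j))).
rewrite !(sum4 (fun j => ient weight_gram _ j * (m _ * m j))).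
rewrite (sum4 (fun i => nth 0 [:: 16; 30; 21; 11] i * m i)) /ient /=.
move: (m 0%N) (m 1%N) (m 2%N) (m 3%N) => a b c d; ring.
Qed.

(** Write e_t f_t + f_t e_t as 2 e_t f_t - [e_t, f_t]. The first terms send p into J, and the
    brackets add up to the element of [root_sum], which acts on p through its weight -m. *)
Lemma casimir_lowest (m : nat -> int) p :
  (forall i : 'I_4, D (Hgen i) p = (- m i)%:~R *: p) -> (forall i, J (D (Fgen i) p)) ->
  J (\sum_(t <- casimir) t.1.1%:~R *: Dg (zmx K 26 t.1.2) (Dg (zmx K 26 t.2) p)
     - (casimir_value m)%:~R *: p).
Proof.
move=> pH pF.
have -> := sum_casimir (fun c A B => c%:~R *: Dg A (Dg B p)) .
have -> : \sum_(t < 24) ((nth 0 root_coef t)%:~R *: Dg (root_e K t) (Dg (root_f K t) p) +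
      (nth 0 root_coef t)%:~R *: Dg (root_f K t) (Dg (root_e K t) p)) =
   \sum_(t < 24) (nth 0 root_coef t *+ 2)%:~R *: Dg (root_e K t) (Dg (root_f K t) p) +
   (48 * (\sum_(i < 4) nth 0 [:: 16; 30; 21; 11] i * m i))%:~R *: p.
  have -> : (48 * (\sum_(i < 4) nth 0 [:: 16; 30; 21; 11] i * m i))%:~R *: p =
      - \sum_(t < 24) (nth 0 root_coef t)%:~R *: Dg (brk (root_e K t) (root_f K t)) p.
    under [X in _ = - X]eq_bigr => t _ do rewrite -DgZ.
    rewrite -Dg_sum root_sum Dg_sum mulr_sumr rmorph_sum scaler_suml -sumrN.
    apply: eq_bigr => i _; rewrite DgZ pH scalerA -scaleNr; congr (_ *: _).
    by rewrite mulrA [in RHS]rmorphN mulrN opprK -intrM.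
  rewrite -sumrN -big_split; apply: eq_bigr => t _ /=.
  have AC (c : K) (A B : S) : c *: A + c *: B = (c + c) *: A - c *: (A - B).
    by rewrite scalerDl scalerBr opprB [RHS]addrACA subrr addr0.
  by rewrite -Dg_brk mulr2n intrD; apply: AC.
have -> : \sum_(i < 4) \sum_(j < 4) (24 * ient weight_gram i j)%:~R *: D (Hgen i) (D (Hgen j) p) =
   (24 * (\sum_(i < 4) \sum_(j < 4) ient weight_gram i j * (m i * m j)))%:~R *: p.
  rewrite mulr_sumr rmorph_sum scaler_suml; apply: eq_bigr => i _.
  rewrite mulr_sumr rmorph_sum scaler_suml; apply: eq_bigr => j _.
  rewrite pH; have -> c : D (Hgen i) (c *: p) = c *: D (Hgen i) p by exact: linearZ.
  rewrite pH !scalerA; congr (_ *: _); rewrite -!intrM; congr (_%:~R); ring.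
have AC (X : S) (A B : K) : X + A *: p + B *: p - (B + A) *: p = X.
  by rewrite -(addrA X) -scalerDl [A + B]addrC addrK.
rewrite /casimir_value intrD AC.
apply: ideal_span_sum => t _; apply: JZ.
by case: (J_root (ltn_ord t) (J_froot (ltn_ord t) pF)).
Qed.

(** The first sum belongs to the diagonal monomial with the column degrees of m, so the second is
    the coefficient of lambda - mu, where lambda = l0 w0 + l1 w1 + l2 w2. *)
Lemma Nroot_split m j : (j < 4)%N -> Nroot m j =
  \sum_k (edeg m k)%:Z * ient root26 (k : 'I_3) j +
  \sum_a \sum_k (m (mxvec_index a k))%:Z * (ient root26 (a : 'I_26) j - ient root26 (k : 'I_3) j).
Proof.
move=> j4; have -> : \sum_k (edeg m k)%:Z * ient root26 (k : 'I_3) j =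
   \sum_a \sum_(k < 3) (m (mxvec_index (a : 'I_26) k))%:Z * ient root26 k j.
  rewrite exchange_big; apply: eq_bigr => k _.
  by rewrite /edeg (big_morph Posz PoszD (erefl 0%Z)) mulr_suml.
rewrite -big_split; apply: eq_bigr => a _; rewrite -big_split; apply: eq_bigr => k _ /=.
by rewrite mulrBr addrC subrK.
Qed.

Definition a26_0 : 'I_26 := @Ordinal 26 0 isT.
Definition a26_1 : 'I_26 := @Ordinal 26 1 isT.

Lemma Nroot_term_ge0 (m : 'X_{1..26 * 3}) j a k : (j < 4)%N ->
  m (mxvec_index a26_0 i31) = 0%N -> m (mxvec_index a26_0 i32) = 0%N ->
  m (mxvec_index a26_1 i32) = 0%N ->
  0 <= (m (mxvec_index a k))%:Z * (ient root26 (a : 'I_26) j - ient root26 (k : 'I_3) j).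
Proof.
move=> j4 m01 m02 m12; have [->|mak] := eqVneq (m (mxvec_index a k)) 0%N; first by rewrite mul0r.
apply: mulr_ge0 => //; rewrite subr_ge0.
have [ge0 ge1 ge2] := root26_ge (ltn_ord a) j4.
case: k mak => -[|[|[|//]]] k3 mak.
- suff -> : ient root26 0 j = 0 by [].
  by rewrite /ient /=; case: j j4 {ge0 ge1 ge2} => [|[|[|[|]]]].
- apply: ge1; apply: contraNneq mak => a0.
  by apply/eqP; rewrite -[RHS]m01; congr (m (mxvec_index _ _)); apply: val_inj.
apply: ge2; rewrite ltnNge; apply: contraNN mak => a1.
have [a0|a0] := eqVneq (a : nat) 0%N.
  by apply/eqP; rewrite -[RHS]m02; congr (m (mxvec_index _ _)); apply: val_inj.
by apply/eqP; rewrite -[RHS]m12; congr (m (mxvec_index _ _)); apply: val_inj => //=; lia.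
Qed.

Lemma mu_explicit m :
  [/\ mu m 0 = - (2 * Nroot m 0 - Nroot m 1),
      mu m 1 = - (- Nroot m 0 + 2 * Nroot m 1 - Nroot m 2),
      mu m 2 = - (- 2 * Nroot m 1 + 2 * Nroot m 2 - Nroot m 3) &
      mu m 3 = ((edeg m i30)%:Z + (edeg m i31)%:Z + (edeg m i32)%:Z)
                 - (- Nroot m 2 + 2 * Nroot m 3)].
Proof.
rewrite !mu_root // !(sum4 (fun j => Nroot m j * cartN j _)) /cartN /= !PoszD.
move: (Nroot m 0) (Nroot m 1) (Nroot m 2) (Nroot m 3) => a b c d.
move: (Posz (edeg m i30)) (Posz (edeg m i31)) (Posz (edeg m i32)) => x y z.
by split; ring.
Qed.

End Extremal.

Lemma casimir_combination (K : fieldType) (V : lmodType K) (v w n x y : int) (p a c : V) :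
  (v - (x * w + x * (n * n) + y * n))%:~R *: p =
  a - x%:~R *: c - x%:~R *: (n%:~R *: (n%:~R *: p)) - y%:~R *: (n%:~R *: p)
    - (a - v%:~R *: p) + x%:~R *: (c - w%:~R *: p).
Proof.
rewrite intrB !intrD !intrM.
rewrite scalerBl !scalerDl scalerBr opprB !scalerA mulrA !opprD !addrA.
by rewrite [RHS](ACl (5*8*3*4*(1*6)*(7*2)))/= !subrr !addr0.
Qed.

(** * Containment of a stable ideal in the ideal of the quadrics *)

Section IdealInJ.
Variable K : fieldType.
Hypothesis charK : [pchar K] =i pred0.
Local Notation S := {mpoly K[26 * 3]}.
Local Notation E := (@Eop K 26 3).
Local Notation J := (@J K).
Local Notation D y := (@Dg K 26 3 (rho26 K y)).
Local Notation idK := [the {rmorphism K -> K} of idfun].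

Definition base_pt (R : pzRingType) : 'M[R]_(26, 3) := \matrix_(a, k) (a == k :> nat)%:R.

(** At the point (e_0, e_1, e_2) only monomials in the diagonal variables survive, and such a
    monomial is determined by its column degrees. *)
Lemma peval_base p m : m \in msupp p ->
  (forall a k, m (mxvec_index a k) != 0%N -> a = k :> nat) ->
  (forall m' k, m' \in msupp p -> edeg m' k = edeg m k) ->
  peval idK p (base_pt K) = p@_m.
Proof.
move=> mp mdiag same.
have edeg_diag (m' : 'X_{1..26 * 3}) : (forall a k, m' (mxvec_index a k) != 0%N -> a = k :> nat) ->
    forall (a : 'I_26) (k : 'I_3), a = k :> nat -> m' (mxvec_index a k) = edeg m' k.
  move=> m'd a k ak; rewrite /edeg (bigD1 a) //= big1 ?addn0 // => b ba.
  apply/eqP; apply: contraNT ba => /m'd bk; apply/eqP/val_inj.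
  by rewrite /= bk ak.
rewrite /peval /mmap (bigD1_seq m) ?msupp_uniq //= [X in _ + X]big1_seq ?addr0.
  rewrite /mmap1 big1 ?mulr1 // => i _; case/mxvec_indexP: i => a k; rewrite mxvecE mxE.
  have [->|/mdiag ->] := eqVneq (m (mxvec_index a k)) 0%N; first exact: expr0.
  by rewrite eqxx expr1n.
move=> m' /andP[m'm m'p].
have [d|nd] := classic (forall a k, m' (mxvec_index a k) != 0%N -> a = k :> nat).
  case/eqP: m'm; apply/mnmP => i; case/mxvec_indexP: i => a k.
  have [ak|ak] := eqVneq (a : nat) k.
    by rewrite (edeg_diag _ d _ _ ak) (edeg_diag _ mdiag _ _ ak) same.
  have z (m'' : 'X_{1..26 * 3}) : (forall a k, m'' (mxvec_index a k) != 0%N -> a = k :> nat) ->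
      m'' (mxvec_index a k) = 0%N.
    by move=> dd; apply/eqP; apply: contraNT ak => /dd ->.
  by rewrite !z.
have [a nda] := not_all_ex_not _ _ nd; have [k ndk] := not_all_ex_not _ _ nda.
have [m'ak ak] := imply_to_and _ _ ndk.
rewrite /mmap1 (bigD1 (mxvec_index a k)) //= mxvecE mxE.
by have /eqP/negPf-> := ak; rewrite expr0n (negPf m'ak) mul0r mulr0.
Qed.

Lemma D_H_brk i p : D (Egen i) (D (Fgen i) p) - D (Fgen i) (D (Egen i) p) = D (Hgen i) p.
Proof.
apply: etrans (Dg_brk _ _ _) _; have [_ ef _ _] := rho26_rep K.
by congr (Dg _ p); have := ef i i; rewrite eqxx.
Qed.

Theorem ideal_in_J (I : S -> Prop) : is_subspace I ->
  (forall y p, I p -> I (D y p)) -> (forall a b p, I p -> I (E a b p)) ->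
  (forall p, I p -> peval idK p (base_pt K) = 0) ->
  forall p, I p -> J p.
Proof.
move=> Isub ID IE Ibase p Ip; have [//|Jp] := classic (J p); exfalso.
have [I0 Ilin] := Isub; have Jsub := J_sub K.
have WI_stable := W_stable charK Isub (fun i => ID (Hgen i)) (fun k => IE k k).
pose F (b : bool) : {linear S -> S} := 
  if b then [the {linear S -> S} of E i30 i31] else [the {linear S -> S} of E i31 i32].
have IF b q : I q -> I (F b q) by case: b; apply: IE.
have lF b : lowers (lvl i30) (F b) by case: b; [apply: lowers_E01 | apply: lowers_E12].
have [p1 [Ip1 Jp1 wp1 Ep1]] := exists_extremal charK (s0 := inr (inr i30)) erefl
  Isub Jsub WI_stable IF lF (ex_intro2 _ _ p Ip Jp).
have nz q : ~ J q -> q != 0 by move=> Jq; apply/eqP => q0; apply: Jq; rewrite q0; apply: J0.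
pose u : int * int * int := (Posz (edeg (mlead p1) i30), Posz (edeg (mlead p1) i31),
  Posz (edeg (mlead p1) i32)).
have Ek k : E k k p1 = (edeg (mlead p1) k)%:R *: p1.
  rewrite Eop_diag -mwt_edeg; apply: (wp1 (inr (inl k))).
  exact: mlead_supp (nz _ Jp1).
have w1 : gl_weight E u p1 by split; apply: Ek.
(* The raising operators send p1 only into J, but they kill p2 itself, as [unipotent_monomial]
   requires. *)
have [p2 [Ip2 Jp2 w2 E01 E12]] := highest_weight_lift charK (@Eop_comm K 26 3)
  (@E_nat K) I0 Ilin IE (J0 K) (@Jlin K) (@J_E K) w1 Ip1 Jp1 (Ep1 true) (Ep1 false).
pose uk (k : 'I_3) : K := (edeg (mlead p1) k)%:R.
have {}w2 k : E k k p2 = uk k *: p2.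
  case: w2 => a0 a1 a2; case: k => -[|[|[|//]]] k3.
  + by have -> : Ordinal k3 = i30 by apply: val_inj.
  + by have -> : Ordinal k3 = i31 by apply: val_inj.
  + by have -> : Ordinal k3 = i32 by apply: val_inj.
(* The actions of F4 and gl_3 commute, so N is stable under F4 and the search for p3 keeps the
   properties of p2. *)
pose N q := [/\ I q, forall k, E k k q = uk k *: q, E i30 i31 q = 0 & E i31 i32 q = 0].
have Elin k l c q q' : E k l (c *: q + q') = c *: E k l q + E k l q' by exact: linearP.
have E0 k l : E k l 0 = 0 by exact: linear0.
have ED k l y q : E k l (D y q) = D y (E k l q) by exact: De_Dg.
have DZ y c q' : D y (c *: q') = c *: D y q' by exact: linearZ.
have D0 y : D y 0 = 0 by exact: linear0.
have Nsub : is_subspace N.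
  split=> [|c q q' [Iq a q1 q2] [Iq' b q1' q2']].
    by split=> // k; rewrite E0 scaler0.
  split; first exact: Ilin.
  - by move=> k; rewrite Elin a b scalerDr !scalerA mulrC.
  - by rewrite Elin q1 q1' scaler0 addr0.
  - by rewrite Elin q2 q2' scaler0 addr0.
have ND y q : N q -> N (D y q).
  move=> [Iq a q1 q2]; split; first exact: ID.
  - by move=> k; rewrite ED a DZ.
  - by rewrite ED q1 D0.
  - by rewrite ED q2 D0.
have NE k q : N q -> N (E k k q).
  move=> Nq; have [_ wq _ _] := Nq.
  by rewrite wq -[_ *: _]addr0; have [N0 Nlin] := Nsub; apply: Nlin.
have [p3 [[Ip3 w3 E01' E12'] Jp3 wp3 fp3]] := exists_extremal charK
  (F := fun i => [the {linear S -> S} of D (Fgen i)])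
  (s0 := inr (inr i31)) erefl Nsub Jsub (W_stable charK Nsub (fun i => ND (Hgen i)) NE)
  (fun i => ND (Fgen i)) (@lowers_f K) (ex_intro2 _ _ p2 (And4 Ip2 w2 E01 E12) Jp2).
have p3n := nz _ Jp3.
have a01 : a26_0 != a26_1 by [].
have [m mp [m01 m02 m12]] := unipotent_monomial charK a01 E01' E12' p3n.
have edegE m' k : m' \in msupp p3 -> uk k = (edeg m' k)%:R.
  move=> m'p; rewrite -mwt_edeg; apply: (wop_eigen (p := p3)) => //.
  by rewrite -(w3 k) Eop_diag.
have same m' k : m' \in msupp p3 -> edeg m' k = edeg m k.
  by move=> m'p; apply: (natr_inj0 charK); rewrite -(edegE m' k m'p) (edegE m k mp).
have ukE k : uk k = ((edeg m k)%:Z)%:~R by rewrite (edegE m k mp).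
have pH i : D (Hgen i) p3 = (- mu m i)%:~R *: p3.
  by rewrite D_wop (wp3 (inl i) m mp) mwt_mu.
have cas := casimir_lowest pH fp3.
set l0 := edeg m i30 in ukE *; set l1 := edeg m i31; set l2 := edeg m i32.
have wu : gl_weight E (Posz l0, Posz l1, Posz l2) p3.
  by split; rewrite /= -ukE; apply: w3.
have JE1 : J (E i30 i31 p3) by rewrite E01'; apply: J0.
have JE2 : J (E i31 i32 p3) by rewrite E12'; apply: J0.
have dom01 : Posz l1 <= Posz l0.
  case: wu => a0 a1 a2; apply: (gl_step_dominant charK (@Eop_comm K 26 3) (@E_nat K)
    (J0 K) (@Jlin K) (@J_E K) (k := i30) (l := i31) _ Jp3 a0 a1 JE1) => //.
have dom12 : Posz l2 <= Posz l1.
  case: wu => a0 a1 a2; apply: (gl_step_dominant charK (@Eop_comm K 26 3) (@E_nat K)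
    (J0 K) (@Jlin K) (@J_E K) (k := i31) (l := i32) _ Jp3 a1 a2 JE2) => //.
(* Modulo J, p3 is a lowest weight vector of weight -mu, so [sl2_weight_nonneg] is applied with f_i,
   e_i and -h_i in the roles of e, f and h. *)
have mu_ge0 (i : 'I_4) : 0 <= mu m i.
  pose f := [the {linear S -> S} of D (Egen i)].
  pose e := [the {linear S -> S} of D (Fgen i)].
  pose h := [the {linear S -> S} of Dg (- rho26 K (Hgen i))].
  have [d dE] : exists d : nat, wop (natw K (lvl i32)) p3 = d%:R *: p3.
    have := wp3 (inr (inr i32)) m mp; rewrite /= mwt_nat => ->.
    by eexists.
  have [_ ef hef _] := rho26_rep K.
  apply: (@sl2_weight_nonneg K _ charK e f h J p3 (mu m i) d.+1 (J0 K) (@Jlin K)).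
  - move=> q; apply: etrans (Dg_brk _ _ _) _; rewrite /h /=; congr (Dg _ q).
    by have := ef i i; rewrite eqxx => <-; rewrite /brk opprB.
  - move=> q; apply: etrans (Dg_brk _ _ _) _; rewrite /f /= -DgZ -DgN; congr (Dg _ q).
    have [hE _] := hef i i; rewrite /brk mulNmx mulmxN -opprD; congr (- _).
    apply: etrans hE _; congr (_ *: _); rewrite cartanE.
    by case: (i) => -[|[|[|[|]]]].
  - by move=> q; apply: J_Dg.
  - by move=> q; apply: J_Dg.
  - exact: Jp3.
  - exact: fp3.
  - by rewrite /h /= DgN pH -scaleNr -mulrNz opprK.
  - by rewrite (lowers_nilpotent charK (F := f) (@lowers_e K i) dE); apply: J0.
pose n : int := Posz l0 + Posz l1 + Posz l2.
have Eu : vf (gx K 26 3) p3 = n%:~R *: p3.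
  rewrite vf_eulerE sum3 !w3 !ukE -!scalerDl; congr (_ *: _).
  by rewrite /n !intrD.
have casimir_eq : casimir_value (mu m) = 24 * cE (Posz l0, Posz l1, Posz l2) + 24 * (n * n) + 480 * n.
  have JC := CE_hw (@Eop_comm K 26 3) (J0 K) (@Jlin K) (@J_E K) wu JE1 JE2.
  have Jop : J (cas_op 24%:~R 480%:~R p3).
    by apply: cas_op_J => //; rewrite -mulr_natr; ring.
  set Cp := CE _ p3 in JC.
  have opE : cas_op 24%:~R 480%:~R p3 =
     \sum_(t <- casimir) t.1.1%:~R *: Dg (zmx K 26 t.1.2) (Dg (zmx K 26 t.2) p3)
      - 24%:~R *: Cp - 24%:~R *: (n%:~R *: (n%:~R *: p3)) - 480%:~R *: (n%:~R *: p3).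
    have EuZ : vf (gx K 26 3) (n%:~R *: p3) = n%:~R *: (n%:~R *: p3).
      have VZ c q : vf (gx K 26 3) (c *: q) = c *: vf (gx K 26 3) q by exact: linearZ.
      by rewrite VZ Eu.
    by rewrite /cas_op Eu EuZ.
  set A := \sum_(t <- casimir) _ in cas opE.
  set v := casimir_value (mu m) in cas *; set w := cE _ in JC *.
  (* All terms on the right lie in J, so a nonzero coefficient on the left would put p3 in J. *)
  have e : (v - (24 * w + 24 * (n * n) + 480 * n))%:~R *: p3 =
      cas_op 24%:~R 480%:~R p3 - (A - v%:~R *: p3) + 24%:~R *: (Cp - w%:~R *: p3).
    rewrite opE; exact: casimir_combination.
  apply/eqP; rewrite -subr_eq0; apply/negPn/negP => nz0; apply: Jp3.
  have nz1 : (v - (24 * w + 24 * (n * n) + 480 * n))%:~R != 0 :> K by rewrite intr_eq0_char0.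
  rewrite -(scalerK nz1 p3); apply: JZ; rewrite e addrC; apply: Jlin => //.
  exact: JB.
have R j : (j < 4)%N -> Nroot m j =
    l1%:Z * ient root26 1 j + l2%:Z * ient root26 2 j +
    \sum_a \sum_k (m (mxvec_index a k))%:Z * (ient root26 (a : 'I_26) j - ient root26 (k : 'I_3) j).
  move=> j4; rewrite (Nroot_split _ j4) sum3 /=.
  have -> : ient root26 0 j = 0 by case: j j4 => [|[|[|[|]]]].
  by rewrite mulr0 add0r.
have Rge j : (j < 4)%N -> 0 <= \sum_a \sum_k (m (mxvec_index a k))%:Z *
    (ient root26 (a : 'I_26) j - ient root26 (k : 'I_3) j).
  by move=> j4; apply: sumr_ge0 => a _; apply: sumr_ge0 => k _; apply: Nroot_term_ge0.
have Neq j : (j < 4)%N -> \sum_a \sum_k (m (mxvec_index a k))%:Z *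
    (ient root26 (a : 'I_26) j - ient root26 (k : 'I_3) j) = 0.
  have [m0 m1 m2 m3] := mu_explicit m.
  have [N0 N1 N2 N3] := And4 (R 0%N isT) (R 1%N isT) (R 2%N isT) (R 3%N isT).
  have [g0 g1 g2 g3] := And4 (Rge 0%N isT) (Rge 1%N isT) (Rge 2%N isT) (Rge 3%N isT).
  have d0 : 0 <= mu m 0 := mu_ge0 (@Ordinal 4 0 isT).
  have d1 : 0 <= mu m 1 := mu_ge0 (@Ordinal 4 1 isT).
  have d2 : 0 <= mu m 2 := mu_ge0 (@Ordinal 4 2 isT).
  have d3 : 0 <= mu m 3 := mu_ge0 (@Ordinal 4 3 isT).
  rewrite casimir_valueE /cE /n /= in casimir_eq.
  rewrite -/l0 -/l1 -/l2 in m3.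
  have r1 : [/\ ient root26 1 0 = 0, ient root26 1 1 = 0, ient root26 1 2 = 0 & ient root26 1 3 = 1] by [].
  have r2 : [/\ ient root26 2 0 = 0, ient root26 2 1 = 0, ient root26 2 2 = 1 & ient root26 2 3 = 1] by [].
  case: r1 r2 => r10 r11 r12 r13 [r20 r21 r22 r23].
  rewrite r10 r20 !mulr0 !add0r in N0; rewrite r11 r21 !mulr0 !add0r in N1.
  rewrite r12 r22 mulr0 mulr1 add0r in N2; rewrite r13 r23 !mulr1 in N3.
  set S0 := \sum_a _ in N0 g0; set S1 := \sum_a _ in N1 g1.
  set S2 := \sum_a _ in N2 g2; set S3 := \sum_a _ in N3 g3.
  have l2_0 : 0 <= l2%:Z by [].
  have [e0 e1 e2 e3] : [/\ Nroot m 0 = 0, Nroot m 1 = 0, Nroot m 2 = l2%:Z & Nroot m 3 = l1%:Z + l2%:Z].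
    apply: (dominance_rigidity dom01 dom12 l2_0 d0 d1 d2 d3 m0 m1 m2 m3) => //.
    - by rewrite N0.
    - by rewrite N1.
    - by rewrite N2 lerDl.
    - by rewrite N3 lerDl.
  case: j => [|[|[|[|//]]]] j4.
  - by rewrite -/S0 -N0.
  - by rewrite -/S1 -N1.
  - by rewrite -/S2; apply: (addrI l2%:Z); rewrite -N2 addr0.
  - by rewrite -/S3; apply: (addrI (l1%:Z + l2%:Z)); rewrite -N3 addr0.
(* The terms of the vanishing sums are nonnegative, so every variable of m has the weight of the
   diagonal variable of its column. *)
have mdiag a k : m (mxvec_index a k) != 0%N -> a = k :> nat.
  move=> mak; apply: root26_eq => // j j4.
  have t0 b l := Nroot_term_ge0 b l j4 m01 m02 m12.
  have /psumr_eq0P/(_ (Neq j j4))/(_ a isT) : forall b : 'I_26, true -> 0 <= \sum_k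
     (m (mxvec_index b k))%:Z * (ient root26 b j - ient root26 (k : 'I_3) j).
    by move=> b _; apply: sumr_ge0.
  move/psumr_eq0P => /(_ (fun l _ => t0 a l))/(_ k isT)/eqP.
  by rewrite mulf_eq0 eqz_nat (negPf mak) subr_eq0 => /eqP.
have := Ibase p3 Ip3; rewrite (peval_base mp mdiag same) => /eqP.
by apply/negP; rewrite -mcoeff_msupp.
Qed.

End IdealInJ.

(** * The cone in the explicit model *)

Lemma mx_exp_nilp3 (L : fieldType) n (A : 'M[L]_n.+3) : A *m A *m A = 0 ->
  mx_exp A = 1%:M + A + 2%:R^-1 *: (A *m A).
Proof.
move=> A3; rewrite /mx_exp !big_ord_recl big1 => [|i _].
  rewrite /= expr0 expr1 expr2 fact0 addr0 addrA.
  by rewrite invr1 !scale1r.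
rewrite -[nat_of_ord _]/(3 + i)%N exprD exprS expr2 -[A * (A * A)]/(A *m (A *m A)).
by rewrite mulmxA A3 mul0r scaler0.
Qed.

Definition root_gen (s : bool) (i : 'I_4) : f4gen := if s then Egen i else Fgen i.

(** The weights of V are 0 and the short roots, so their strings in the direction of a root have at
    most three members. *)
Lemma rho26_nilp (R : pzRingType) s i :
  rho26 R (root_gen s i) *m rho26 R (root_gen s i) *m rho26 R (root_gen s i) = 0.
Proof.
have /allP chk : all (fun i => leqm (meval_seq 26 (MMul (MMul (MZ (e26 i)) (MZ (e26 i))) (MZ (e26 i))))
     (meval_seq 26 (MZ [::])) && leqm (meval_seq 26 (MMul (MMul (MZ (f26 i)) (MZ (f26 i))) (MZ (f26 i))))
     (meval_seq 26 (MZ [::]))) (iota 0 4) by vm_compute.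
have /andP[ce cf] := chk _ (mem_iota0 i).
case: s; [have := mx_reflect R ce | have := mx_reflect R cf] => e; exact: etrans e (zmx0 _ _).
Qed.

Section GroupAction.
Variables (K L : fieldType) (iota : {rmorphism K -> L}).

Lemma gact_cat n (rho : f4gen -> 'M[K]_n) (g g' : gword L) :
  gact iota rho (g ++ g') = gact iota rho g *m gact iota rho g'.
Proof. by elim: g => [|x g IH] /=; rewrite ?mul1mx // IH mulmxA. Qed.

Lemma inY_letter n r (rho : f4gen -> 'M[K]_n) v (phi : 'M[L]_(n, r)) y :
  inY iota rho v phi -> inY iota rho v (letter_act iota rho y *m phi).
Proof.
move=> [C [g [_ gP]]]; exists (parabolic_coset iota node2 (y :: g)), (y :: g).
split=> // u; have [z zb e] := gP u; exists z => //.
by rewrite -mulmxA e /= mulmxA.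
Qed.

Lemma inY_mulmxr n r (rho : f4gen -> 'M[K]_n) v (phi : 'M[L]_(n, r)) (M : 'M[L]_r) :
  inY iota rho v phi -> inY iota rho v (phi *m M).
Proof.
move=> [C [g [Cg gP]]]; exists C, g; split=> // u.
by have [z zb e] := gP (M *m u); exists z => //; rewrite -mulmxA.
Qed.

Lemma map_zmx n A : map_mx iota (zmx K n A) = zmx L n A.
Proof. by apply/matrixP => i j; rewrite !mxE rmorph_int. Qed.

Lemma map_rho26 y : map_mx iota (rho26 K y) = rho26 L y.
Proof. by case: y => i; apply: map_zmx. Qed.

Lemma letter_rho26 s i t : letter_act iota (rho26 K) (s, i, t) =
  1%:M + t *: rho26 L (root_gen s i) +
  (t ^+ 2 / 2%:R) *: (rho26 L (root_gen s i) *m rho26 L (root_gen s i)).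
Proof.
rewrite /letter_act map_rho26 -/(root_gen s i) mx_exp_nilp3.
  congr (_ + _); rewrite -scalemxAl -scalemxAr !scalerA; congr (_ *: _).
  by rewrite -mulrA mulrC expr2.
by rewrite -!scalemxAl -!scalemxAr -scalemxAl rho26_nilp !scaler0.
Qed.

End GroupAction.

(** On forms exp(t A) acts as exp(t D), where D X = A^T X + X A. As A^3 = 0, this exponential ends
    with t^4 D^4 / 24, so a subspace stable under D is stable under it. *)
Lemma exp_quadratic (L : fieldType) n (S : 'M[L]_n -> Prop) (A : 'M[L]_n) (t : L) :
  [pchar L] =i pred0 ->
  (forall c X Y, S X -> S Y -> S (c *: X + Y)) ->
  (forall X, S X -> S (A^T *m X + X *m A)) -> A *m A *m A = 0 ->
  let a := 1%:M + t *: A + (t ^+ 2 / 2%:R) *: (A *m A) in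
  forall B, S B -> S (a^T *m B *m a).
Proof.
move=> charL Slin SD A3 a B SB.
have n0 k : (k.+1%:R : L) != 0 by rewrite ((pcharf0P L).1 charL).
pose m i j := iter i (mulmx A^T) (iter j (mulmxr A) B).
pose D X := A^T *m X + X *m A.
have AT3 : A^T *m A^T *m A^T = 0 by rewrite -!trmx_mul mulmxA A3 trmx0.
have mi i j : A^T *m m i j = m i.+1 j by [].
have mj i j : m i j *m A = m i j.+1.
  by rewrite /m; elim: i => //= i IH; rewrite -mulmxA IH.
have m3 j : m 3 j = 0 by rewrite /m /= !mulmxA AT3 mul0mx.
have mj3 i : m i 3 = 0.
  by rewrite -!mj -!mulmxA (mulmxA A) A3 mulmx0.
have DD X Y : D (X + Y) = D X + D Y by rewrite /D mulmxDr mulmxDl addrACA.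
have Dm i j : D (m i j) = m i.+1 j + m i j.+1 by rewrite /D mi mj.
have e0 : B = m 0%N 0%N by [].
have e1 : D B = m 1%N 0%N + m 0%N 1%N by rewrite {1}e0 Dm.
have e2 : D (D B) = m 2 0%N + m 1%N 1%N *+ 2 + m 0%N 2.
  by rewrite e1 DD !Dm mulr2n !addrA.
have DMn X k : D (X *+ k) = D X *+ k.
    elim: k => [|k IH]; first by rewrite !mulr0n /D mulmx0 mul0mx addr0.
    by rewrite !mulrS DD IH.
have e3 : D (D (D B)) = m 2 1%N *+ 3 + m 1%N 2 *+ 3.
  rewrite e2 2!DD DMn !Dm m3 mj3; apply/matrixP => i j; rewrite !mxE; ring.
have e4 : D (D (D (D B))) = m 2 2 *+ 6.
  rewrite e3 DD !DMn !Dm m3 mj3; apply/matrixP => i j; rewrite !mxE; ring.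
have -> : a^T *m B *m a = (t ^+ 4 / 24%:R) *: D (D (D (D B))) +
   ((t ^+ 3 / 6%:R) *: D (D (D B)) + ((t ^+ 2 / 2%:R) *: D (D B) + (t *: D B + B))).
  pose c := t ^+ 2 / 2%:R.
  have Ba : B *m a = m 0%N 0%N + t *: m 0%N 1%N + c *: m 0%N 2.
    by rewrite /a !mulmxDr mulmx1 -!scalemxAr mulmxA.
  have aT : a^T = 1%:M + t *: A^T + c *: (A^T *m A^T).
    by rewrite !linearD /= trmx1 !linearZ /= trmx_mul.
  have am j : a^T *m m 0%N j = m 0%N j + t *: m 1%N j + c *: m 2 j.
    by rewrite aT !mulmxDl mul1mx -!scalemxAl -mulmxA.
  rewrite e4 e3 e2 e1 -mulmxA Ba !mulmxDr -!scalemxAr !am {1}e0 /c.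
  apply/matrixP => i j; rewrite !mxE; field.
  by rewrite (n0 1%N) (n0 5%N) (n0 23%N).
have S1 := SD _ SB; have S2 := SD _ S1; have S3 := SD _ S2; have S4 := SD _ S3.
by do 4 (apply: (Slin) => //).
Qed.

Section ConeRho26.
Variables (K L : fieldType) (iota : {rmorphism K -> L}).
Hypothesis charK : [pchar K] =i pred0.
Local Notation rhoL := (rho26 L).

Lemma rmorph_char0 : [pchar L] =i pred0.
Proof.
by apply/(pcharf0P L) => k; rewrite -(rmorph_nat iota) fmorph_eq0 ((pcharf0P K).1 charK).
Qed.

Lemma map_gform c : map_mx iota (gform K c) = gform L c.
Proof. exact: map_zmx. Qed.

Lemma peval_gquad c k l (phi : 'M[L]_(26, 3)) :
  peval iota (gquad K c k l) phi = (phi^T *m gform L c *m phi) k l.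
Proof.
rewrite gquadE peval_sum mxE.
under [RHS]eq_bigr => b _ do rewrite mxE mulr_suml.
rewrite [RHS]exchange_big /=; apply: eq_bigr => a _.
rewrite peval_sum; apply: eq_bigr => b _.
rewrite pevalZ pevalM !peval_gx [phi^T _ _]mxE -map_gform [map_mx _ _ _ _]mxE.
by rewrite mulrCA mulrA.
Qed.

Definition form_span (B : 'M[L]_26) : Prop :=
  exists u : 'I_79 -> L, B = \sum_c u c *: gform L c.

Lemma form_span_lin c X Y : form_span X -> form_span Y -> form_span (c *: X + Y).
Proof.
move=> [u ->] [w ->]; exists (fun i => c * u i + w i).
rewrite scaler_sumr -big_split; apply: eq_bigr => i _.
by rewrite scalerDl scalerA.
Qed.

Lemma form_span0 : form_span 0.
Proof. by exists (fun=> 0); rewrite big1 // => i _; rewrite scale0r. Qed.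

Lemma form_span_gform c : (c < 79)%N -> form_span (gform L c).
Proof.
move=> c79; exists (fun i => (i == Ordinal c79)%:R).
rewrite (bigD1 (Ordinal c79)) //= eqxx scale1r big1 ?addr0 // => i /negPf->.
by rewrite scale0r.
Qed.

Lemma form_spanD y B : form_span B -> form_span ((rhoL y)^T *m B + B *m rhoL y).
Proof.
move=> [u ->].
have -> : (rhoL y)^T *m (\sum_c u c *: gform L c) + (\sum_c u c *: gform L c) *m rhoL y =
    \sum_(c < 79) u c *: ((rhoL y)^T *m gform L c + gform L c *m rhoL y).
  rewrite mulmx_sumr mulmx_suml -big_split; apply: eq_bigr => c _.
  by rewrite scalerDr scalemxAl scalemxAr.
elim: (index_enum _) => [|c s IH]; first by rewrite big_nil; apply: form_span0.
rewrite big_cons; apply: form_span_lin => //.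
have [t [t79 e]] := gform_act L y (ltn_ord c).
rewrite -[X in form_span X]opprK e -scaleN1r -[_ *: _]addr0.
apply: form_span_lin; last exact: form_span0.
elim: t t79 {e} => [|x t IHt] t79; first by rewrite big_nil; apply: form_span0.
rewrite big_cons; apply: form_span_lin.
  by apply: form_span_gform; apply: t79; rewrite mem_head.
by apply: IHt => z zt; apply: t79; rewrite inE zt orbT.
Qed.

Lemma form_span_word g B : form_span B ->
  form_span ((gact iota (rho26 K) g)^T *m B *m gact iota (rho26 K) g).
Proof.
elim: g B => [|[[s i] t] g IH] B SB /=; first by rewrite trmx1 mul1mx mulmx1.
rewrite -/(letter_act iota (rho26 K) (s, i, t)); set a := letter_act _ _ _.
have -> : (a *m gact iota (rho26 K) g)^T *m B *m (a *m gact iota (rho26 K) g) =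
    (gact iota (rho26 K) g)^T *m (a^T *m B *m a) *m gact iota (rho26 K) g.
  by rewrite trmx_mul !mulmxA.
apply: IH; rewrite /a letter_rho26.
apply: exp_quadratic => //; first exact: rmorph_char0.
- exact: form_span_lin.
- by move=> X; apply: form_spanD.
- exact: rho26_nilp.
Qed.

Definition supp3 (x : 'cV[L]_26) : Prop := forall a : 'I_26, (2 < a)%N -> x a 0 = 0.

Lemma form_supp3 B x y : form_span B -> supp3 x -> supp3 y -> x^T *m B *m y = 0.
Proof.
move=> [u ->] x3 y3; rewrite mulmx_sumr mulmx_suml big1 // => c _.
rewrite -scalemxAr -scalemxAl; apply/eqP; rewrite scaler_eq0; apply/orP; right; apply/eqP.
apply/matrixP => i j; rewrite mxE [RHS]mxE big1 // => b _.
case: (ltnP 2 b) => b3; first by rewrite (ord1 j) y3 ?mulr0.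
rewrite mxE big1 ?mul0r // => a _; rewrite mxE (ord1 i).
case: (ltnP 2 a) => a3; first by rewrite x3 ?mul0r.
case: (ltnP c 52) => c52.
  by rewrite -[nat_of_ord c]/(val (Ordinal c52)) gform52 (form_base forms52_check) ?mulr0.
have c27 : (c - 52 < 27)%N by case: (c) c52 => c' /= ? ?; lia.
have -> : gform L c = formK forms27 L (Ordinal c27).
  by rewrite -gform27; congr gform; rewrite /=; lia.
by rewrite (form_base forms27_check) ?mulr0.
Qed.

End ConeRho26.

Lemma zmx_basis (R : pzRingType) n A (b b' : 'I_n) (c : int) :
  all (fun a => ient A a b == if a == b' then c else 0) (iota 0 n) ->
  zmx R n A *m delta_mx b (0 : 'I_1) = c%:~R *: delta_mx b' 0.
Proof.
move=> /allP chk; rewrite -colE; apply/colP => a; rewrite !mxE andbT.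
rewrite (eqP (chk _ (mem_iota0 a))) -val_eqE /=.
by case: eqP => _; rewrite ?mulr1 ?mulr0.
Qed.

(** * The fiber of R_3 at the base point *)

Section BaseFiber.
Variables (K L : fieldType) (iota : {rmorphism K -> L}).
Hypothesis charK : [pchar K] =i pred0.
Local Notation rhoL := (rho26 L).
Local Notation letter x := (letter_act iota (rho26 K) x).
Local Notation v0 := (delta_mx ord0 0 : 'cV[K]_26).

Definition bv (b : nat) : 'cV[L]_26 := delta_mx (inord b) 0.

Lemma rho26_bv s (i : 'I_4) b b' c : (b < 26)%N -> (b' < 26)%N ->
  all (fun a => ient ((if s then e26 else f26) i) a b == if a == b' then c else 0) (seq.iota 0 26) ->
  rhoL (root_gen s i) *m bv b = c%:~R *: bv b'.
Proof.
move=> b26 b'26 chk; have : rhoL (root_gen s i) = zmx L 26 ((if s then e26 else f26) i) by case: s {chk}.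
by move=> ->; apply: zmx_basis; rewrite !inordK.
Qed.

Lemma gact_cons y g (x : 'cV[L]_26) :
  gact iota (rho26 K) (y :: g) *m x = letter y *m (gact iota (rho26 K) g *m x).
Proof. exact: esym (mulmxA _ _ _). Qed.

Lemma letter_kill s i t (x : 'cV[L]_26) : rhoL (root_gen s i) *m x = 0 -> letter (s, i, t) *m x = x.
Proof.
move=> Ax; rewrite letter_rho26 !mulmxDl mul1mx -!scalemxAl -mulmxA Ax mulmx0.
by rewrite !scaler0 !addr0.
Qed.

Lemma letter_step s i t (x y : 'cV[L]_26) : rhoL (root_gen s i) *m x = y ->
  rhoL (root_gen s i) *m y = 0 -> letter (s, i, t) *m x = x + t *: y.
Proof.
move=> Ax Ay; rewrite letter_rho26 !mulmxDl mul1mx -!scalemxAl -mulmxA Ax Ay.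
by rewrite scaler0 addr0.
Qed.

Lemma supp3P (x : 'cV[L]_26) : supp3 x -> exists a b c, x = a *: bv 0 + b *: bv 1 + c *: bv 2.
Proof.
move=> x3; exists (x (inord 0) 0), (x (inord 1) 0), (x (inord 2) 0).
apply/colP => j; rewrite !mxE andbT -!val_eqE /= !inordK //.
case: j => -[|[|[|j]]] j26 /=.
- by rewrite !mulr0 !addr0 mulr1; congr (x _ 0); apply: val_inj; rewrite /= inordK.
- by rewrite !mulr0 addr0 add0r mulr1; congr (x _ 0); apply: val_inj; rewrite /= inordK.
- by rewrite !mulr0 !add0r mulr1; congr (x _ 0); apply: val_inj; rewrite /= inordK.
by rewrite x3 // !mulr0 !addr0.
Qed.

Lemma supp3_lin c x y : supp3 x -> supp3 y -> supp3 (c *: x + y : 'cV[L]_26).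
Proof. by move=> x3 y3 a a2; rewrite !mxE x3 // y3 // mulr0 addr0. Qed.

Lemma supp3_root s i (x : 'cV[L]_26) : i != node2 -> supp3 x -> supp3 (rhoL (root_gen s i) *m x).
Proof.
move=> i2 x3 a a2; rewrite mxE big1 // => b _.
case: (ltnP 2 b) => b2; first by rewrite x3 ?mulr0.
have /allP chk : all (fun i => (i != 1%N) ==> all (fun a => all (fun b =>
   (ient (e26 i) a b == 0) && (ient (f26 i) a b == 0)) (seq.iota 0 3)) (seq.iota 3 23))
   (seq.iota 0 4) by vm_compute.
have i1 : (i : nat) != 1%N.
  by apply: contraNneq i2 => e; apply/eqP/val_inj; rewrite /= e node2E.
have /implyP/(_ i1)/allP := chk _ (mem_iota0 i).
move=> /(_ a); rewrite mem_iota a2 ltn_ord => /(_ isT)/allP/(_ b).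
rewrite mem_iota ltnS b2 => /(_ isT)/andP[/eqP ce /eqP cf].
by case: s; rewrite mxE /= ?ce ?cf mul0r.
Qed.

Lemma supp3_letter s i t (x : 'cV[L]_26) : i != node2 -> supp3 x -> supp3 (letter (s, i, t) *m x).
Proof.
move=> i2 x3; have y3 := supp3_root s i2 x3; have z3 := supp3_root s i2 y3.
rewrite letter_rho26 !mulmxDl mul1mx -!scalemxAl -mulmxA addrC.
by apply: supp3_lin => //; rewrite addrC; apply: supp3_lin.
Qed.

(** The letters of this word do not preserve the span of e_0, e_1, e_2 one by one, since the
    lowering operator of the second simple root maps e_2 to e_3. The whole word is a torus element,
    and multiplies e_2 by t. *)
Lemma coroot_node2 t (x : 'cV[L]_26) : t != 0 -> supp3 x ->
  supp3 (gact iota (rho26 K) (coroot_word node2 t) *m x).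
Proof.
move=> t0 /supp3P[a [b [c ->]]]; set w := a *: bv 0 + b *: bv 1.
have n2 := node2E.
have ke s b' : (b' < 2)%N -> rhoL (root_gen s node2) *m bv b' = 0.
  move=> b2; rewrite (@rho26_bv s node2 b' b' 0) ?mulr0z ?scale0r //; try by lia.
  by rewrite n2; case: s; case: b' b2 => [|[|]] // _; vm_compute.
have kw s : rhoL (root_gen s node2) *m w = 0.
  by rewrite /w mulmxDr -!scalemxAr !ke // !scaler0 addr0.
have E2 : rhoL (root_gen true node2) *m bv 2 = 0.
  by rewrite (@rho26_bv true node2 2 2 0) ?mulr0z ?scale0r // n2; vm_compute.
have E3 : rhoL (root_gen true node2) *m bv 3 = bv 2.
  by rewrite (@rho26_bv true node2 3 2 1) ?scale1r // n2; vm_compute.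
have F2 : rhoL (root_gen false node2) *m bv 2 = bv 3.
  by rewrite (@rho26_bv false node2 2 3 1) ?scale1r // n2; vm_compute.
have F3 : rhoL (root_gen false node2) *m bv 3 = 0.
  by rewrite (@rho26_bv false node2 3 3 0) ?mulr0z ?scale0r // n2; vm_compute.
have w3 : supp3 w.
  move=> j j2; rewrite !mxE -!val_eqE /= !inordK //.
  by case: j j2 => -[|[|[|]]] //= *; rewrite !mulr0 !addr0.
move: (w) kw w3 => {}w kw w3.
have LE u p q : letter (true, node2, u) *m (w + p *: bv 2 + q *: bv 3) =
    w + (p + u * q) *: bv 2 + q *: bv 3.
  rewrite (@letter_step true node2 u _ (q *: bv 2)).
  - by rewrite scalerA scalerDl !addrA [RHS]addrAC.
  - by rewrite !mulmxDr kw -!scalemxAr E2 E3 scaler0 !add0r.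
  - by rewrite -scalemxAr E2 scaler0.
have LF u p q : letter (false, node2, u) *m (w + p *: bv 2 + q *: bv 3) =
    w + p *: bv 2 + (q + u * p) *: bv 3.
  rewrite (@letter_step false node2 u _ (p *: bv 3)).
  - by rewrite scalerA scalerDl !addrA.
  - by rewrite !mulmxDr kw -!scalemxAr F2 F3 scaler0 add0r addr0.
  - by rewrite -scalemxAr F3 scaler0.
rewrite /coroot_word 6!gact_cons -[gact _ _ [::]]/(1%:M) mul1mx.
pose l s u := letter (s, node2, u).
rewrite -!/(l _ _).
have {}LE u p q : l true u *m (w + p *: bv 2 + q *: bv 3) =
    w + (p + u * q) *: bv 2 + q *: bv 3 by exact: LE.
have {}LF u p q : l false u *m (w + p *: bv 2 + q *: bv 3) =
    w + p *: bv 2 + (q + u * p) *: bv 3 by exact: LF.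
move: (l) LE LF => {}l LE LF.
rewrite -[w + _]addr0 -[X in w + _ + X](scale0r (bv 3)) !(LE, LF).
have -> : 0 + 1 * (c + -1 * 0) = c by ring.
have -> : c + -1 * 0 + -1 * c = 0 by ring.
rewrite add0r; have -> : c + - t^-1 * (t * c) = 0 by rewrite mulNr mulKf ?subrr.
rewrite mulr0 addr0 scale0r addr0 => j j2.
rewrite !mxE w3 // -!val_eqE /= inordK //.
by case: j j2 => -[|[|[|]]] //= *; rewrite !mulr0 !addr0.
Qed.

Lemma levi_supp3 g (x : 'cV[L]_26) : levi node2 g -> supp3 x -> supp3 (gact iota (rho26 K) g *m x).
Proof.
move=> lg; elim: lg x => [|s i t g' i2 _ IH|i t g' t0 _ IH] x x3.
- by rewrite mul1mx.
- by rewrite gact_cons; apply: supp3_letter => //; apply: IH.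
rewrite gact_cat -mulmxA; have [->|i2] := eqVneq i node2.
  by apply: coroot_node2 => //; apply: IH.
rewrite /coroot_word !gact_cons [gact _ _ [::]]/= mul1mx.
by do 6! [apply: supp3_letter => //]; apply: IH.
Qed.

Lemma map_v0 : map_mx iota v0 = bv 0.
Proof. by rewrite map_delta_mx; congr delta_mx; apply: val_inj; rewrite /= inordK. Qed.

Lemma base_fiber_supp3 (x : 'cV[L]_26) : base_fiber iota (rho26 K) v0 x <-> supp3 x.
Proof.
split=> [[s [sl ->]]|].
  elim: s sl => [|y s IH] sl; first by rewrite big_nil => a _; rewrite mxE.
  rewrite big_cons; apply: supp3_lin; last first.
    by apply: IH => z zs; apply: sl; rewrite inE zs orbT.
  apply: levi_supp3; first by apply: sl; rewrite mem_head.
  rewrite map_v0 => a; rewrite mxE -val_eqE /= inordK //.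
  by case: a => -[].
move=> /supp3P[a [b [c ->]]].
pose g1 : gword L := [:: (false, node4, 1)].
pose g2 : gword L := (false, node3, 1) :: g1.
(* The three Levi elements send e_0 to e_0, e_0 + e_1 and e_0 + e_1 + e_2. *)
exists [:: (a - b, [::]); (b - c, g1); (c, g2)].
have n3 : node3 = 2%N :> nat by exact: inordK.
have n4 := node4E.
have neq (i : 'I_4) : (i : nat) != 1%N -> i != node2.
  by move=> i1; apply: contraNneq i1 => ->; rewrite node2E.
have l1 : levi node2 g1 by apply: levi_root; [apply: neq; rewrite n4 | apply: levi_nil].
split.
  move=> y; rewrite !inE => /or3P[] /eqP->; first exact: levi_nil.
  - exact: l1.
  - by apply: levi_root l1; apply: neq; rewrite n3.
rewrite big_cons big_cons big_seq1 map_v0 [gact _ _ [::]]/= mul1mx.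
have f (i : 'I_4) k b1 b' c' : (i : nat) = k -> (b1 < 26)%N -> (b' < 26)%N ->
   all (fun a => ient (f26 k) a b1 == if a == b' then c' else 0) (seq.iota 0 26) ->
   rhoL (root_gen false i) *m bv b1 = c'%:~R *: bv b'.
  by move=> ik b26 b'26; rewrite -ik; apply: (@rho26_bv false).
have f40 : rhoL (root_gen false node4) *m bv 0 = bv 1.
  by rewrite (f _ _ 0%N 1%N 1 n4) ?scale1r //; vm_compute.
have f41 : rhoL (root_gen false node4) *m bv 1 = 0.
  by rewrite (f _ _ 1%N 1%N 0 n4) ?mulr0z ?scale0r //; vm_compute.
have f30 : rhoL (root_gen false node3) *m bv 0 = 0.
  by rewrite (f _ _ 0%N 1%N 0 n3) ?mulr0z ?scale0r //; vm_compute.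
have f31 : rhoL (root_gen false node3) *m bv 1 = bv 2.
  by rewrite (f _ _ 1%N 2%N 1 n3) ?scale1r //; vm_compute.
have f32 : rhoL (root_gen false node3) *m bv 2 = 0.
  by rewrite (f _ _ 2%N 1%N 0 n3) ?mulr0z ?scale0r //; vm_compute.
have g1E : gact iota (rho26 K) g1 *m bv 0 = bv 0 + bv 1.
  by rewrite gact_cons [gact _ _ [::]]/= mul1mx (letter_step _ f40 f41) scale1r.
have g2E : gact iota (rho26 K) g2 *m bv 0 = bv 0 + bv 1 + bv 2.
  rewrite gact_cons g1E mulmxDr.
  by rewrite (letter_kill _ f30) (letter_step _ f31 f32) scale1r addrA.
rewrite [(_, g1).2]/= [(_, g2).2]/= [(_, g1).1]/= [(_, g2).1]/= [(_, [::]).1]/=.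
rewrite g1E g2E; apply/matrixP => i j; rewrite !mxE; ring.
Qed.

Lemma base_pt_inY : inY iota (rho26 K) v0 (base_pt L).
Proof.
exists (parabolic_coset iota node2 [::]), [::]; split=> // u.
exists (base_pt L *m u); last by rewrite mul1mx.
apply/base_fiber_supp3 => a a2; rewrite mxE big1 // => k _.
rewrite mxE; case: eqP => [ak|_]; last by rewrite mul0r.
by move: a2; rewrite ak ltnNge -ltnS ltn_ord.
Qed.

(** The group element g can be moved onto the form, which stays in the span and is then evaluated on
    the base fiber. *)
Lemma inY_forms B (phi : 'M[L]_(26, 3)) : form_span B -> inY iota (rho26 K) v0 phi ->
  phi^T *m B *m phi = 0.
Proof.
move=> SB [C [g [_ gP]]]; apply/matrixP => k l; rewrite [RHS]mxE.
have [y /base_fiber_supp3 y3 ey] := gP (delta_mx k 0).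
have [z /base_fiber_supp3 z3 ez] := gP (delta_mx l 0).
have -> : (phi^T *m B *m phi) k l = ((phi *m delta_mx k (0 : 'I_1))^T *m B *m (phi *m delta_mx l (0 : 'I_1))) 0 0.
  set M := _ *m phi; have -> : (phi *m delta_mx k (0 : 'I_1))^T *m B *m (phi *m delta_mx l (0 : 'I_1)) =
      delta_mx 0 k *m M *m delta_mx l 0 by rewrite trmx_mul trmx_delta !mulmxA.
  by rewrite -rowE -colE !mxE.
rewrite ey ez trmx_mul; set G := gact _ _ g.
have -> : y^T *m G^T *m B *m (G *m z) = y^T *m (G^T *m B *m G) *m z by rewrite !mulmxA.
by rewrite (form_supp3 (form_span_word iota charK g SB) y3 z3) mxE.
Qed.

End BaseFiber.

(** * The ideal of Y in the explicit model *)

Section IdealRho26.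
Variable K : fieldType.
Hypothesis charK : [pchar K] =i pred0.
Local Notation v0 := (delta_mx ord0 0 : 'cV[K]_26).
Local Notation I := (@idealY K 26 3 (rho26 K) v0).

Lemma idealY_subspace n r (rho : f4gen -> 'M[K]_n) v : is_subspace (@idealY K n r rho v).
Proof.
split=> [|c p q Ip Iq] L iota phi Yphi; first exact: peval0.
by rewrite pevalD pevalZ Ip // Iq // mulr0 addr0.
Qed.

(** The curve exp(-t A) phi stays in Y and is polynomial in t because A^3 = 0; its velocity at t = 0
    is the field of [Dg]. *)
Lemma idealY_root s i p : I p -> I (Dg (rho26 K (root_gen s i)) p).
Proof.
move=> Ip L iota phi Yphi; rewrite /Dg.
set A := rho26 L (root_gen s i); pose B := A *m phi; pose C := A *m B.
pose c : 'M[{poly L}]_(26, 3) := \matrix_(a, k)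
  ((phi a k)%:P - (B a k)%:P * 'X + (C a k / 2%:R)%:P * 'X^2).
apply: (vanish_tangent (rmorph_char0 iota charK) (c := c)) => [a k|a k|t].
- by rewrite mxE !hornerE /=; ring.
- rewrite [c a k]mxE !derivE !hornerE [RHS](_ : _ = - (A *m phi) a k) //.
  rewrite [(- _ : 'M_(_, _)) a k]mxE -scaleN1r pevalZ rmorphN1 mulN1r; congr (- _).
  rewrite cmx_gxE peval_sum mxE; apply: eq_bigr => b _.
  by rewrite pevalZ peval_gx /A -(map_rho26 iota) mxE.
suff -> : \matrix_(a, k) (c a k).[t] = letter_act iota (rho26 K) (s, i, - t) *m phi.
  exact/Ip/inY_letter.
rewrite letter_rho26 -/A !mulmxDl mul1mx -!scalemxAl -mulmxA -/B -/C.
move: (B) (C) @c => {}B {}C; apply/matrixP => a k; rewrite !mxE !hornerE /=.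
ring.
Qed.

Lemma idealY_Dg y p : I p -> I (Dg (rho26 K y) p).
Proof.
move=> Ip; case: y => i; [exact: (idealY_root true) | exact: (idealY_root false)|].
have EF := @idealY_root true i _ (@idealY_root false i _ Ip).
have FE := @idealY_root false i _ (@idealY_root true i _ Ip).
have [_ lin] := idealY_subspace 3 (rho26 K) v0.
have := lin (-1) _ _ FE EF.
by rewrite scaleN1r addrC (D_H_brk i p).
Qed.

(** Y is stable under right multiplication by every matrix, so the line phi (1 + t E_ab) serves also
    for a = b, where it is not a one-parameter group. *)
Lemma idealY_E a b p : I p -> I (Eop a b p).
Proof.
move=> Ip L iota phi Yphi; rewrite EopE.
pose c : 'M[{poly L}]_(26, 3) := \matrix_(i, k)
  ((phi i k)%:P + ((b == k)%:R * phi i a)%:P * 'X).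
apply: (vanish_tangent (rmorph_char0 iota charK) (c := c)) => [i k|i k|t].
- by rewrite mxE !hornerE /=; ring.
- rewrite [c i k]mxE !derivE !hornerE gx_deltaE pevalZ peval_gx rmorph_nat.
  by ring.
suff -> : \matrix_(i, k) (c i k).[t] = phi *m (1%:M + t *: delta_mx a b).
  exact/Ip/inY_mulmxr.
apply/matrixP => i k; rewrite mulmxDr mulmx1 -scalemxAr 4!mxE !hornerE; congr (_ + _).
rewrite mulrC; congr (_ * _).
rewrite mxE (bigD1 a) //= big1 => [|l la].
  by rewrite !mxE eqxx addr0 eq_sym mulrC.
by rewrite !mxE (negPf la) mulr0.
Qed.

Theorem idealY_rho26 p : I p <-> @J K p.
Proof.
split; last first.
  move=> [s [Qs ->]] L iota phi Yphi; rewrite peval_sum big1_seq // => y /andP[_ ys].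
  have [c [k [l [c79 e]]]] := Qs y ys.
  rewrite pevalM e peval_gquad (inY_forms charK (form_span_gform _ c79) Yphi).
  by rewrite mxE mulr0.
apply: (ideal_in_J charK).
- exact: idealY_subspace.
- by move=> y q; apply: idealY_Dg.
- by move=> a b q; apply: idealY_E.
- by move=> q Iq; apply: Iq; apply: base_pt_inY.
Qed.

End IdealRho26.

(** * Isomorphism of irreducible modules *)

Section LinearPredicates.
Variables (K : fieldType) (n : nat).

(** Irreducibility is stated for row spaces, while submodules arise below as predicates. A row space
    of maximal rank inside the predicate exhausts it. *)
Lemma linear_predicate_space (P : 'cV[K]_n -> Prop) : P 0 ->
  (forall c x y, P x -> P y -> P (c *: x + y)) ->
  exists U : 'M[K]_n, forall x, P x <-> (x^T <= U)%MS.
Proof.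
move=> P0 Plin.
suff H m (U : 'M[K]_n) : (n - \rank U <= m)%N -> (forall x : 'cV_n, (x^T <= U)%MS -> P x) ->
    exists U : 'M[K]_n, forall x, P x <-> (x^T <= U)%MS.
  apply: (H n 0); rewrite ?leq_subr // => x; rewrite submx0 trmx_eq0 => /eqP->.
  exact: P0.
elim: m U => [|m IH] U rU UP.
  have /row_fullP[W WU] : row_full U by rewrite /row_full eqn_leq rank_leq_col -subn_eq0 -leqn0.
  exists U => x; split=> [_|/UP//]; rewrite -[x^T]mulmx1 -WU mulmxA.
  exact: submxMl.
have [[x Px xU]|no] := classic (exists2 x : 'cV_n, P x & ~~ (x^T <= U)%MS); last first.
  exists U => x; split=> [Px|/UP//]; apply/negPn/negP => xU.
  by apply: no; exists x.
apply: (IH (U + x^T)%MS).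
  have : (\rank U < \rank (U + x^T)%MS)%N.
    rewrite ltn_neqAle mxrankS ?addsmxSl // andbT; apply: contraNneq xU => e.
    have := mxrank_leqif_sup (addsmxSl U x^T); rewrite e => -[_ /esym].
    by rewrite eqxx => eU; apply: submx_trans (addsmxSr U _) eU.
  lia.
move=> y /sub_addsmxP[[a b] /= e]; rewrite -[y]trmxK e linearD /= addrC.
have -> : (b *m x^T)^T = b 0 0 *: x.
  by apply/colP => i; rewrite [b]mx11_scalar mul_scalar_mx !mxE eqxx mulr1n.
apply: Plin => //; apply: UP; rewrite trmxK; exact: submxMl.
Qed.

Lemma irreducible_predicate (rho : f4gen -> 'M[K]_n) (P : 'cV[K]_n -> Prop) :
  irreducible_rep rho -> P 0 -> (forall c x y, P x -> P y -> P (c *: x + y)) ->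
  (forall X x, P x -> P (rho X *m x)) ->
  (forall x, P x -> x = 0) \/ (forall x, P x).
Proof.
move=> [_ irr] P0 Plin Pst; have [U PU] := linear_predicate_space P0 Plin.
have stU : stable_space rho U.
  move=> X; apply/row_subP => i; rewrite row_mul -[row i U]trmxK -trmx_mul.
  by apply/PU/Pst/PU; rewrite trmxK row_sub.
have [U0|/row_fullP[W WU]] := irr U stU; [left => x /PU | right => x; apply/PU].
  by rewrite U0 submx0 trmx_eq0 => /eqP.
by rewrite -[x^T]mulmx1 -WU mulmxA; apply: submxMl.
Qed.

End LinearPredicates.

(** * The submodule generated by a highest weight vector *)

Section Words.
Variables (K : fieldType) (n : nat) (rho : f4gen -> 'M[K]_n) (k : 'I_4) (u : 'cV[K]_n).
Hypothesis charK : [pchar K] =i pred0.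
Hypothesis rhoP : f4_rep rho.
Hypothesis eu : forall i, rho (Egen i) *m u = 0.
Hypothesis hu : forall i, rho (Hgen i) *m u = (i == k)%:R *: u.

Definition fword (w : seq 'I_4) : 'cV[K]_n := foldr (fun i x => rho (Fgen i) *m x) u w.

Definition word_span (x : 'cV[K]_n) : Prop :=
  exists s : seq (K * seq 'I_4), x = \sum_(t <- s) t.1 *: fword t.2.

Lemma word_span0 : word_span 0.
Proof. by exists [::]; rewrite big_nil. Qed.

Lemma word_span_lin c x y : word_span x -> word_span y -> word_span (c *: x + y).
Proof.
move=> [s ->] [t ->]; exists ([seq (c * z.1, z.2) | z <- s] ++ t).
rewrite big_cat big_map scaler_sumr; congr (_ + _).
by apply: eq_bigr => z _; rewrite scalerA.
Qed.

Lemma word_span_fword w : word_span (fword w).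
Proof. by exists [:: (1, w)]; rewrite big_seq1 scale1r. Qed.

Lemma word_span_sum X x : (forall w, word_span (rho X *m fword w)) ->
  word_span x -> word_span (rho X *m x).
Proof.
move=> Xw [s ->]; elim: s => [|t s IH]; first by rewrite big_nil mulmx0; apply: word_span0.
by rewrite big_cons mulmxDr -scalemxAr; apply: word_span_lin.
Qed.

Lemma h_fword i w : exists c, rho (Hgen i) *m fword w = c *: fword w.
Proof.
have [_ _ hf _] := rhoP.
elim: w => [|j w [c IH]]; first by exists (i == k)%:R; apply: hu.
exists (c - (cartanF4 j i)%:~R); have [_ e] := hf i j.
rewrite /= mulmxA -[rho (Hgen i) *m _](subrK (rho (Fgen j) *m rho (Hgen i))).
rewrite -/(brk _ _) e mulmxDl -scalemxAl -mulmxA IH -scalemxAr -scalerDl.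
by rewrite addrC.
Qed.

Lemma word_span_stable X x : word_span x -> word_span (rho X *m x).
Proof.
have [_ ef _ _] := rhoP.
apply: word_span_sum; case: X => i w.
- elim: w => [|j w IH]; first by rewrite /= eu; apply: word_span0.
  rewrite /= mulmxA -[rho (Egen i) *m _](subrK (rho (Fgen j) *m rho (Egen i))).
  rewrite -/(brk _ _) ef mulmxDl -[_ *m fword w]scale1r; apply: word_span_lin.
    case: eqP => _; last by rewrite mul0mx; apply: word_span0.
    have [c ->] := h_fword i w; rewrite -[_ *: _]addr0.
    by apply: word_span_lin; [apply: word_span_fword | apply: word_span0].
  rewrite -mulmxA; apply: word_span_sum IH => w'; exact: (word_span_fword (j :: w')).
- exact: (word_span_fword (i :: w)).
- have [c ->] := h_fword i w; rewrite -[_ *: _]addr0.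
  by apply: word_span_lin; [apply: word_span_fword | apply: word_span0].
Qed.

(* The coroot sum H with <alpha_j, H> = 2 for every simple root. *)
Definition height_coef (i : 'I_4) : K := (nth 0 [:: 22; 42; 30; 16] i)%:~R.
Definition height_op : 'M[K]_n := \sum_i height_coef i *: rho (Hgen i).

Lemma height_op_fword w :
  height_op *m fword w = (height_coef k - (size w).*2%:R) *: fword w.
Proof.
have [_ _ hf _] := rhoP.
elim: w => [|j w IH].
  rewrite subr0 mulmx_suml (bigD1 k) //= -scalemxAl hu eqxx scale1r big1 ?addr0 //.
  by move=> i /negPf ik; rewrite -scalemxAl hu ik scale0r scaler0.
have b : brk height_op (rho (Fgen j)) = - 2%:R *: rho (Fgen j).
  rewrite /brk /height_op mulmx_suml mulmx_sumr -sumrB.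
  under eq_bigr => i _ do
    rewrite -scalemxAl -scalemxAr -scalerBr -/(brk _ _) (proj2 (hf i j)) scalerA.
  rewrite -scaler_suml; congr (_ *: _).
  have e : \sum_(i < 4) (nth 0 [:: 22; 42; 30; 16] i * - cartN j i) = (-2 : int).
    by rewrite !big_ord_recl big_ord0; case: (j) => -[|[|[|[|//]]]].
  have -> : - 2%:R = (-2 : int)%:~R :> K by [].
  rewrite -e rmorph_sum; apply: eq_bigr => i _.
  by rewrite /= /height_coef cartanE intrM mulrNz.
rewrite /= mulmxA -[height_op *m _](subrK (rho (Fgen j) *m height_op)) -/(brk _ _) b.
rewrite mulmxDl -scalemxAl -mulmxA IH -scalemxAr -scalerDl; congr (_ *: _).
by rewrite [size _]/= doubleS -[(_.*2).+2]addn2 natrD; ring.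
Qed.

(** A word of length l has eigenvalue a - 2 l under the height operator H. The product of the H - (a
    - 2 l), for l from 1 to the maximal length, kills all words but the empty one and multiplies y
    by a nonzero scalar. *)
Lemma weight_line y : word_span y -> height_op *m y = height_coef k *: y ->
  exists c, y = c *: u.
Proof.
move=> [s ye] hy; pose a := height_coef k.
pose P (l : seq nat) : 'M[K]_n :=
  foldr (fun m M => M *m (height_op - (a - m.*2%:R)%:M)) 1%:M l.
have Pe l (x : 'cV_n) m : height_op *m x = (a - m.*2%:R) *: x ->
    P l *m x = (\prod_(i <- l) (i.*2%:R - m.*2%:R)) *: x.
  move=> hx; elim: l => [|i l IH] /=; first by rewrite mul1mx big_nil scale1r.
  rewrite -mulmxA mulmxBl hx mul_scalar_mx -scalerBl -scalemxAr IH scalerA big_cons.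
  by congr (_ *: _); congr (_ * _); rewrite opprB addrC addrA subrK.
pose l := seq.iota 1 (\max_(t <- s) size t.2).
pose d : K := \prod_(i <- l) i.*2%:R.
have d0 : d != 0.
  rewrite /d prodf_seq_neq0; apply/allP => i; rewrite mem_iota => /andP[i1 _].
  by rewrite ((pcharf0P K).1 charK) double_eq0 -lt0n.
have Py : P l *m y = d *: y.
  rewrite (Pe l y 0%N) ?subr0 //; congr (_ *: _).
  by apply: eq_bigr => i _; rewrite subr0.
have [c Pc] : exists c, P l *m y = c *: u.
  have sl : {in s, forall t, (size t.2 <= \max_(t <- s) size t.2)%N}.
    by move=> t ts; apply: leq_bigmax_seq.
  rewrite ye /l; move: (\max_(t <- s) _)%N sl => M {y ye hy l d d0 Py}.
  elim: s => [|t s IH] sl; first by exists 0; rewrite big_nil mulmx0 scale0r.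
  have [|c e] := IH; first by move=> z zs; apply: sl; rewrite inE zs orbT.
  rewrite big_cons mulmxDr e -scalemxAr (Pe _ _ _ (height_op_fword _)).
  have tM := sl t (mem_head _ _); case: t.2 tM => [|j w] tM.
    by eexists; rewrite scalerA -scalerDl.
  exists c; rewrite (_ : \prod_(i <- _) _ = 0) ?scale0r ?scaler0 ?add0r //.
  apply/eqP; rewrite prodf_seq_eq0; apply/hasP; exists (size (j :: w)); last by rewrite /= subrr eqxx.
  by rewrite mem_iota.
by exists (d^-1 * c); rewrite -scalerA -Pc Py scalerA mulVf // scale1r.
Qed.

End Words.

Lemma brk_block (K : fieldType) m n (A C : 'M[K]_m) (B D : 'M[K]_n) :
  brk (block_mx A 0 0 B) (block_mx C 0 0 D) = block_mx (brk A C) 0 0 (brk B D).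
Proof.
rewrite /brk !mulmx_block !mul0mx !mulmx0 !addr0 !add0r opp_block_mx add_block_mx.
by rewrite !subr0.
Qed.

Lemma sum_rep_f4 (K : fieldType) m n (rho : f4gen -> 'M[K]_m) (sigma : f4gen -> 'M[K]_n) :
  f4_rep rho -> f4_rep sigma -> f4_rep (sum_rep rho sigma).
Proof.
have it A B C D d : iter d (brk (block_mx A 0 0 B)) (block_mx C 0 0 D) =
    block_mx (iter d (brk A) C) 0 0 (iter d (brk B) D) :> 'M[K]_(m + n).
  by elim: d => //= d ->; rewrite brk_block.
have b0 : block_mx 0 0 0 0 = 0 :> 'M[K]_(m + n) by exact: block_mx0.
move=> [r1 r2 r3 r4] [s1 s2 s3 s4]; rewrite /sum_rep; split=> [i j|i j|i j|i j ij].
- by rewrite brk_block r1 s1.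
- by rewrite brk_block r2 s2; case: eqP.
- have [r31 r32] := r3 i j; have [s31 s32] := s3 i j.
  by rewrite !brk_block r31 r32 s31 s32 !scale_block_mx !scaler0.
- have [r41 r42] := r4 i j ij; have [s41 s42] := s4 i j ij.
  by rewrite !it r41 r42 s41 s42.
Qed.

Lemma linear_eq0P (K : fieldType) n (x y : 'cV[K]_n) : x = y <-> x - y = 0.
Proof. by split=> [->|/eqP]; [rewrite subrr | rewrite subr_eq0 => /eqP]. Qed.

(* The submodule generated by (v1, v2) in the sum of the two modules is the
   graph of an isomorphism. *)
Lemma irreducible_unique (K : fieldType) m n (rho1 : f4gen -> 'M[K]_m)
    (rho2 : f4gen -> 'M[K]_n) k v1 v2 : [pchar K] =i pred0 ->
  f4_rep rho1 -> irreducible_rep rho1 -> hw_vector rho1 k v1 ->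
  f4_rep rho2 -> irreducible_rep rho2 -> hw_vector rho2 k v2 ->
  exists P : 'M[K]_(n, m), [/\ forall X, rho2 X *m P = P *m rho1 X, P *m v1 = v2 &
    forall x : 'cV_m, P *m x = 0 -> x = 0].
Proof.
move=> charK rep1 irr1 [v10 ev1 hv1] rep2 irr2 [v20 ev2 hv2].
pose rho := sum_rep rho1 rho2; pose u := col_mx v1 v2.
have rhoE X (x : 'cV[K]_m) (y : 'cV[K]_n) : rho X *m col_mx x y = col_mx (rho1 X *m x) (rho2 X *m y) :> 'cV_(m + n).
  by rewrite /rho /sum_rep mul_block_col !mul0mx addr0 add0r.
have rep : f4_rep rho by apply: sum_rep_f4.
have eu i : rho (Egen i) *m u = 0 by rewrite /u rhoE ev1 ev2 col_mx0.
have hu i : rho (Hgen i) *m u = (i == k)%:R *: u by rewrite /u rhoE hv1 hv2 scale_col_mx.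
pose N := word_span rho u.
have Nlin c x y : N x -> N y -> N (c *: x + y) by exact: word_span_lin.
have N0 : N 0 by exact: word_span0.
have Nst X x : N x -> N (rho X *m x) by exact: word_span_stable rep eu hu X x.
have Nu : N u by exact: (word_span_fword rho u [::]).
have hE (x : 'cV[K]_m) (y : 'cV[K]_n) : height_op rho *m col_mx x y = col_mx (height_op rho1 *m x) (height_op rho2 *m y).
  rewrite !mulmx_suml; elim: (index_enum _) => [|i s IH]; first by rewrite !big_nil col_mx0.
  by rewrite !big_cons IH -!scalemxAl rhoE scale_col_mx add_col_mx.
have h1 : height_op rho1 *m v1 = height_coef K k *: v1.
  by rewrite (height_op_fword rep1 hv1 [::]) subr0.
have h2 : height_op rho2 *m v2 = height_coef K k *: v2.
  by rewrite (height_op_fword rep2 hv2 [::]) subr0.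
(* Otherwise N contains (v1, 0) by irreducibility. As this vector has the same eigenvalue as u under
   the height operator, it is a multiple of u by [weight_line], which is impossible for nonzero v1
   and v2. *)
have inj1 x : N (col_mx x 0) -> x = 0.
  pose P0 y := N (col_mx y 0).
  have p0 : P0 0 by rewrite /P0 col_mx0.
  have plin c y w : P0 y -> P0 w -> P0 (c *: y + w).
    by move=> Ny Nw; have := Nlin c _ _ Ny Nw; rewrite scale_col_mx add_col_mx scaler0 addr0.
  have pst X y : P0 y -> P0 (rho1 X *m y).
    by move=> Ny; have := Nst X _ Ny; rewrite rhoE mulmx0.
  have [inj|full] := irreducible_predicate irr1 p0 plin pst; first exact: inj.
  have [|c] := weight_line charK rep hu (full v1).
    by rewrite hE h1 mulmx0 scale_col_mx scaler0.
  rewrite /u scale_col_mx => /eq_col_mx[e1 /eqP].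
  rewrite eq_sym scaler_eq0 (negPf v20) orbF => /eqP c0.
  by move: v10; rewrite e1 c0 scale0r eqxx.
have inj2 x : N (col_mx 0 x) -> x = 0.
  pose P0 y := N (col_mx 0 y).
  have p0 : P0 0 by rewrite /P0 col_mx0.
  have plin c y w : P0 y -> P0 w -> P0 (c *: y + w).
    by move=> Ny Nw; have := Nlin c _ _ Ny Nw; rewrite scale_col_mx add_col_mx scaler0 addr0.
  have pst X y : P0 y -> P0 (rho2 X *m y).
    by move=> Ny; have := Nst X _ Ny; rewrite rhoE mulmx0.
  have [inj|full] := irreducible_predicate irr2 p0 plin pst; first exact: inj.
  have [|c] := weight_line charK rep hu (full v2).
    by rewrite hE h2 mulmx0 scale_col_mx scaler0.
  rewrite /u scale_col_mx => /eq_col_mx[/eqP e1 e2]; move: e1.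
  rewrite eq_sym scaler_eq0 (negPf v10) orbF => /eqP c0.
  by move: v20; rewrite e2 c0 scale0r eqxx.
have surj x : exists y, N (col_mx x y).
  pose P0 z := exists y, N (col_mx z y).
  have p0 : P0 0 by exists 0; rewrite col_mx0.
  have plin c z w : P0 z -> P0 w -> P0 (c *: z + w).
    move=> [y Ny] [y' Ny']; exists (c *: y + y').
    by have := Nlin c _ _ Ny Ny'; rewrite scale_col_mx add_col_mx.
  have pst X z : P0 z -> P0 (rho1 X *m z).
    by move=> [y Ny]; exists (rho2 X *m y); rewrite -rhoE; apply: Nst.
  have [z0|full] := irreducible_predicate irr1 p0 plin pst; last exact: full.
  by move: v10; rewrite (z0 v1) ?eqxx //; exists v2.
have fsurj : forall a : 'I_m, exists y, N (col_mx (delta_mx a 0) y) by move=> a; apply: surj.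
have [F NF] := fin_all_exists fsurj.
pose P : 'M[K]_(n, m) := \matrix_(i, a) F a i 0.
have NP x : N (col_mx x (P *m x)).
  have -> : col_mx x (P *m x) = \sum_a x a 0 *: col_mx (delta_mx a 0) (F a).
    apply: etrans (_ : col_mx (\sum_a x a 0 *: delta_mx a 0) (\sum_a x a 0 *: F a) = _).
      congr col_mx; apply/colP => i; rewrite summxE.
        rewrite (bigD1 i) //= big1 ?addr0 => [|a ai]; first by rewrite !mxE !eqxx mulr1.
        by rewrite !mxE eq_sym (negPf ai) mulr0.
      by rewrite mxE; apply: eq_bigr => a _; rewrite !mxE mulrC.
    elim: (index_enum _) => [|a s IH]; first by rewrite !big_nil col_mx0.
    by rewrite !big_cons -IH scale_col_mx add_col_mx.
  elim: (index_enum _) => [|a s IH]; first by rewrite big_nil.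
  by rewrite big_cons; apply: Nlin.
have uniq x y y' : N (col_mx x y) -> N (col_mx x y') -> y = y'.
  move=> Ny Ny'; apply/linear_eq0P/inj2; have := Nlin (-1) _ _ Ny' Ny.
  by rewrite scale_col_mx add_col_mx !scaleN1r addNr [- y' + _]addrC.
exists P; split.
- move=> X; apply/matrixP => i a.
  have e : rho2 X *m (P *m delta_mx a (0 : 'I_1)) = P *m (rho1 X *m delta_mx a 0).
    by apply: uniq (NP _); rewrite -rhoE; apply: Nst.
  by move: e; rewrite !mulmxA -!colE => /colP/(_ i); rewrite !mxE.
- by apply: uniq (NP _) _.
- by move=> x Px; apply: inj1; rewrite -Px.
Qed.

(** * Transport to an arbitrary model *)

Section Transport.
Variables (K L : fieldType) (iota : {rmorphism K -> L}) (n r : nat).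
Variables (rho1 rho2 : f4gen -> 'M[K]_n) (v1 : 'cV[K]_n) (P : 'M[K]_n).
Hypothesis rhoP : forall X, rho2 X *m P = P *m rho1 X.
Local Notation PL := (map_mx iota P).

Lemma mx_exp_conj (A1 A2 : 'M[L]_n) : A2 *m PL = PL *m A1 ->
  mx_exp A2 *m PL = PL *m mx_exp A1.
Proof.
move=> e; rewrite /mx_exp mulmx_suml mulmx_sumr; apply: eq_bigr => k _.
rewrite -scalemxAl -scalemxAr; congr (_ *: _).
elim: (k : nat) => [|d IH]; first by rewrite !expr0 mul1mx mulmx1.
by rewrite !exprSr -!mulmxE -mulmxA e mulmxA IH -mulmxA.
Qed.

Lemma gact_conj g : gact iota rho2 g *m PL = PL *m gact iota rho1 g.
Proof.
elim: g => [|[[s i] t] g IH] /=; first by rewrite mul1mx mulmx1.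
rewrite -mulmxA IH !mulmxA; congr (_ *m _); apply: mx_exp_conj.
by rewrite -scalemxAl -scalemxAr -!map_mxM rhoP.
Qed.

Lemma base_fiber_conj x : base_fiber iota rho1 v1 x -> base_fiber iota rho2 (P *m v1) (PL *m x).
Proof.
move=> [s [sl ->]]; exists s; split=> //; rewrite mulmx_sumr.
apply: eq_bigr => y _; rewrite -scalemxAr map_mxM; congr (_ *: _).
by rewrite [LHS]mulmxA -gact_conj [RHS]mulmxA.
Qed.

Lemma inY_conj (phi : 'M[L]_(n, r)) : inY iota rho1 v1 phi -> inY iota rho2 (P *m v1) (PL *m phi).
Proof.
move=> [C [g [CE gP]]]; exists C, g; split=> // u; have [y yb e] := gP u.
exists (PL *m y); first exact: base_fiber_conj.
by rewrite mulmxA gact_conj -!mulmxA e.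
Qed.

End Transport.

(** * Linear substitutions and quadratic polynomials *)

Section Substitution.
Variables (K : fieldType) (n r : nat).
Local Notation S := {mpoly K[n * r]}.
Local Notation gx := (gx K n r).
Local Notation cmx := (cmx n r).

Definition lsubst (Q : 'M[K]_n) (p : S) : S :=
  mmap (@mpolyC (n * r) K) (fun i => mxvec (cmx Q *m gx) 0 i) p.

Lemma lsubstM Q p q : lsubst Q (p * q) = lsubst Q p * lsubst Q q.
Proof. exact: rmorphM. Qed.

Lemma lsubstD Q p q : lsubst Q (p + q) = lsubst Q p + lsubst Q q.
Proof. exact: rmorphD. Qed.

Lemma lsubst1 Q : lsubst Q 1 = 1.
Proof. exact: rmorph1. Qed.

Lemma lsubstZ Q c p : lsubst Q (c *: p) = c *: lsubst Q p.
Proof. by rewrite /lsubst mmapZ mul_mpolyC. Qed.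

Lemma lsubst_sum Q (T : Type) (s : seq T) (F : T -> S) :
  lsubst Q (\sum_(t <- s) F t) = \sum_(t <- s) lsubst Q (F t).
Proof. exact: rmorph_sum. Qed.

Lemma lsubst_gx Q a k : lsubst Q (gx a k) = (cmx Q *m gx) a k.
Proof. by rewrite /lsubst [gx a k]mxE mmapX mmap1U mxvecE. Qed.

Lemma peval_lsubst (L : fieldType) (iota : {rmorphism K -> L}) Q p (phi : 'M[L]_(n, r)) :
  peval iota (lsubst Q p) phi = peval iota p (map_mx iota Q *m phi).
Proof.
elim/mpoly_mul_ind: p => [|c p q IHp IHq|a k p IH].
- by rewrite lsubst1 !peval1.
- by rewrite lsubstD lsubstZ !pevalD !pevalZ IHp IHq.
rewrite lsubstM !pevalM IH; congr (_ * _).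
rewrite lsubst_gx peval_gx cmx_gxE peval_sum mxE; apply: eq_bigr => b _.
by rewrite pevalZ peval_gx mxE.
Qed.

Lemma lsubstK Q Q' p : Q' *m Q = 1%:M -> lsubst Q (lsubst Q' p) = p.
Proof.
move=> QQ; elim/mpoly_mul_ind: p => [|c p q IHp IHq|a k p IH].
- by rewrite !lsubst1.
- by rewrite !lsubstD !lsubstZ IHp IHq.
rewrite !lsubstM IH; congr (_ * _); rewrite lsubst_gx cmx_gxE lsubst_sum.
have -> : gx a k = (cmx (Q' *m Q) *m gx) a k by rewrite QQ /cmx map_mx1 mul1mx.
rewrite /cmx map_mxM -mulmxA mxE; apply: eq_bigr => b _.
by rewrite lsubstZ lsubst_gx [map_mx _ _ _ _]mxE mul_mpolyC.
Qed.

Definition qform (B : 'M[K]_n) (k l : 'I_r) : S :=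
  \sum_a \sum_b B a b *: (gx a k * gx b l).

Lemma qformE B k l : qform B k l = (gx^T *m cmx B *m gx) k l.
Proof. exact: esym (quadE _ _ _). Qed.

Lemma peval_qform (L : fieldType) (iota : {rmorphism K -> L}) B k l (phi : 'M[L]_(n, r)) :
  peval iota (qform B k l) phi = (phi^T *m map_mx iota B *m phi) k l.
Proof.
rewrite peval_sum mxE.
under [RHS]eq_bigr => b _ do rewrite mxE mulr_suml.
rewrite [RHS]exchange_big /=; apply: eq_bigr => a _.
rewrite peval_sum; apply: eq_bigr => b _.
rewrite pevalZ pevalM !peval_gx [phi^T _ _]mxE [map_mx _ _ _ _]mxE.
by rewrite mulrCA mulrA.
Qed.

Lemma lsubst_qform Q B k l : lsubst Q (qform B k l) = qform (Q^T *m B *m Q) k l.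
Proof.
apply: esym; apply: etrans (qformE _ k l) _.
have -> : gx^T *m cmx (Q^T *m B *m Q) *m gx = (cmx Q *m gx)^T *m cmx B *m (cmx Q *m gx).
  by rewrite trmx_mul /cmx !map_mxM map_trmx !mulmxA.
rewrite mxE /qform lsubst_sum.
under eq_bigr => b _ do rewrite mxE mulr_suml.
rewrite exchange_big /=; apply: eq_bigr => a _.
rewrite lsubst_sum; apply: eq_bigr => b _.
rewrite lsubstZ lsubstM !lsubst_gx -mul_mpolyC [_^T _ _]mxE [cmx B _ _]mxE.
ring.
Qed.

Lemma qform_homog B k l : qform B k l \is 2.-homog.
Proof.
rewrite rpred_sum // => a _; rewrite rpred_sum // => b _; apply: dhomogZ.
by rewrite !mxE -[2%N]/(1 + 1)%N; apply: dhomogM; rewrite dhomogX /= mdeg1.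
Qed.

Lemma quadricE S B : quadric S B = \sum_k \sum_l S k l *: qform B k l.
Proof.
apply: eq_bigr => k _; apply: eq_bigr => l _; rewrite scaler_sumr.
apply: eq_bigr => a _; rewrite scaler_sumr; apply: eq_bigr => b _.
by rewrite !mxE scalerA.
Qed.

Lemma quadric_delta k l B : quadric (delta_mx k l) B = qform B k l.
Proof.
rewrite quadricE (bigD1 k) //= [X in _ + X]big1 ?addr0 => [|i ik]; last first.
  by rewrite big1 // => j _; rewrite mxE (negPf ik) scale0r.
rewrite (bigD1 l) //= big1 ?addr0 => [|j jl]; first by rewrite mxE !eqxx scale1r.
by rewrite mxE (negPf jl) andbF scale0r.
Qed.

Lemma quadric_linear c (S T : 'M[K]_r) (B : 'M[K]_n) :
  quadric (c *: S + T) B = c *: quadric S B + quadric T B.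
Proof.
rewrite !quadricE scaler_sumr -big_split; apply: eq_bigr => k _.
rewrite scaler_sumr -big_split; apply: eq_bigr => l _.
by rewrite !mxE scalerDl scalerA.
Qed.

Lemma qform_tr B k l : qform B^T k l = qform B l k.
Proof.
rewrite /qform exchange_big; apply: eq_bigr => a _; apply: eq_bigr => b _.
by rewrite mxE mulrC.
Qed.

Lemma qformZ c B k l : qform (c *: B) k l = c *: qform B k l.
Proof.
rewrite scaler_sumr; apply: eq_bigr => a _; rewrite scaler_sumr.
by apply: eq_bigr => b _; rewrite mxE scalerA.
Qed.

Lemma qformD B C k l : qform (B + C) k l = qform B k l + qform C k l.
Proof.
rewrite -big_split; apply: eq_bigr => a _; rewrite -big_split.
by apply: eq_bigr => b _; rewrite mxE scalerDl.
Qed.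

(** Only the constant term of c contributes in degree d. For a combination of quadrics, taking the
    part of degree 2 thus replaces the polynomial coefficients by scalars. *)
Lemma pihomog_mul_homog d (c q : S) : q \is d.-homog -> pihomog mdeg d (c * q) = c@_0 *: q.
Proof.
move=> qd; elim/mpolyind: c => [|a m c _ _ IH].
  by rewrite mul0r mcoeff0 scale0r pihomog0.
rewrite mulrDl pihomogD IH mcoeffD scalerDl; congr (_ + _).
rewrite -scalerAl linearZ /= mcoeffZ mcoeffX.
have [->|m0] := eqVneq m 0%MM; first by rewrite mpolyX0 mul1r mulr1 pihomog_dE.
rewrite mulr0 scale0r (@pihomog_ne0 _ _ _ (mdeg m + d)) ?scaler0 //.
  by rewrite -[d in _ != d]add0n eqn_add2r mdeg_eq0.
by apply: dhomogM; rewrite ?dhomogX.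
Qed.

End Substitution.

(** * Embeddings of modules in the space of bilinear forms *)

Section FormMap.
Variables (K : fieldType) (m : nat) (E F H : nat -> seq (seq int)) (sgn : int).
Variables (forms : seq (seq (seq int))) (dual : seq (seq (nat * nat * int))).
Hypothesis charK : [pchar K] =i pred0.
Hypothesis chk : form_check m E F H sgn forms dual.
Variables (rho : f4gen -> 'M[K]_26) (sigma : f4gen -> 'M[K]_m).
Variables (P Q : 'M[K]_26) (T T' : 'M[K]_m).
Hypothesis QP : Q *m P = 1%:M.
Hypothesis Qrho : forall X, Q *m rho X = rho26 K X *m Q.
Hypothesis TT : T' *m T = 1%:M.
Hypothesis Tsigma : forall X, T *m sigma X = formrep m E F H K X *m T.

(** T identifies sigma with the module of the explicit forms, and these are pulled back to V along
    the isomorphism Q from V to the model. *)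
Definition form_map (w : 'cV[K]_m) : 'M[K]_26 :=
  Q^T *m (\sum_c (T *m w) c 0 *: formK forms K c) *m Q.

Lemma form_map_is_linear : linear form_map.
Proof.
move=> c u w; rewrite /form_map scalemxAl scalemxAr -mulmxDl -mulmxDr.
congr (_ *m _ *m _); rewrite scaler_sumr -big_split; apply: eq_bigr => i _.
by rewrite linearP !mxE scalerDl scalerA.
Qed.
HB.instance Definition _ := GRing.isLinear.Build K 'cV[K]_m 'M[K]_26 _ form_map form_map_is_linear.

Lemma form_map_embedding : form_embedding sigma rho form_map.
Proof.
split=> [|X w].
  apply: raddf_inj => w /(congr1 (fun A => P^T *m A *m P)).
  rewrite mulmx0 mul0mx /form_map !mulmxA -trmx_mul QP trmx1 mul1mx -mulmxA QP mulmx1.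
  move=> /(form_free chk charK) z; rewrite -[w]mul1mx -TT -mulmxA.
  suff -> : T *m w = 0 by rewrite mulmx0.
  by apply/colP => c; rewrite z mxE.
have -> : - ((rho X)^T *m form_map w + form_map w *m rho X) =
    Q^T *m (- ((rho26 K X)^T *m (\sum_c (T *m w) c 0 *: formK forms K c) +
      (\sum_c (T *m w) c 0 *: formK forms K c) *m rho26 K X)) *m Q.
  rewrite /form_map mulmxN mulNmx mulmxDr mulmxDl -!mulmxA Qrho !mulmxA -!trmx_mul.
  by rewrite Qrho.
rewrite /form_map; congr (_ *m _ *m _); rewrite mulmxA Tsigma -mulmxA.
set u := T *m w; rewrite mulmx_sumr mulmx_suml -big_split -sumrN.
transitivity (\sum_c u c 0 *: \sum_r formrep m E F H K X r c *: formK forms K r).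
  under [RHS]eq_bigr => c _ do rewrite scaler_sumr.
  rewrite exchange_big; apply: eq_bigr => r _ /=.
  rewrite mxE scaler_suml; apply: eq_bigr => c _.
  by rewrite scalerA mulrC.
apply: eq_bigr => c _; rewrite -(form_checkP chk) /= -scalemxAl -scalemxAr -scalerDr.
by rewrite scalerN.
Qed.

Lemma form_map_tr w : (form_map w)^T = sgn%:~R *: form_map w.
Proof.
rewrite /form_map !trmx_mul trmxK mulmxA scalemxAl scalemxAr; congr (_ *m _ *m _).
rewrite linear_sum scaler_sumr; apply: eq_bigr => c _ /=.
by rewrite linearZ /= (form_tr chk) !scalerA mulrC.
Qed.

End FormMap.

Lemma ient_dense n s i j : (n <= i)%N || (n <= j)%N -> ient (dense n s) i j = 0.
Proof.
rewrite /ient /dense; case: (leqP n i) => [ni _|i_n /= nj].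
  by rewrite (nth_default [::]) ?size_mkseq // nth_nil.
by rewrite nth_mkseq // nth_default ?size_mkseq.
Qed.

Lemma ient_ldiag n f i j : (n <= i)%N || (n <= j)%N -> ient (ldiag n f) i j = 0.
Proof.
rewrite /ient /ldiag; case: (leqP n i) => [ni _|i_n /= nj].
  by rewrite (nth_default [::]) ?size_mkseq // nth_nil.
by rewrite nth_mkseq // nth_default ?size_mkseq.
Qed.

(** Read with size 27, the data of V acquire a zero row and a zero column, which is the trivial
    summand carrying the invariant form. *)
Lemma formrep27 (K : fieldType) X :
  formrep 27 e26 f26 h26 K X = sum_rep (rho26 K) (@trivial_rep K) X.
Proof.
have [A [-> rA Aout]] : exists A, [/\ formrep 27 e26 f26 h26 K X = zmx K 27 A,
    rho26 K X = zmx K 26 A & forall i j, (26 <= i)%N || (26 <= j)%N -> ient A i j = 0].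
  case: X => i; [exists (e26 i) | exists (f26 i) | exists (h26 i)]; split=> // a b.
  - exact: ient_dense.
  - exact: ient_dense.
  - exact: ient_ldiag.
rewrite /sum_rep rA /trivial_rep; apply/matrixP => i j; rewrite [RHS]mxE [LHS]mxE.
case: splitP => i' ei; rewrite [RHS]mxE; case: splitP => j' ej; rewrite [RHS]mxE.
- by rewrite ei ej.
- by rewrite Aout // ej leq_addr orbT.
- by rewrite Aout // ei leq_addr.
- by rewrite Aout // ei leq_addr.
Qed.

(** * The ideal of Y and its quadrics for a general V *)

Section TransportedCone.
Variable K : fieldType.
Hypothesis charK : [pchar K] =i pred0.
Variables (rho : f4gen -> 'M[K]_26) (v : 'cV[K]_26) (P Q : 'M[K]_26).
Local Notation v0 := (delta_mx ord0 0 : 'cV[K]_26).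
Hypothesis QP : Q *m P = 1%:M.
Hypothesis Prho : forall X, rho X *m P = P *m rho26 K X.
Hypothesis Pv : P *m v0 = v.

Lemma PQ1 : P *m Q = 1%:M. Proof. exact: mulmx1C. Qed.

Lemma Qrho X : Q *m rho X = rho26 K X *m Q.
Proof. by rewrite -[rho X]mulmx1 -PQ1 (mulmxA (rho X)) Prho !mulmxA QP mul1mx. Qed.

Lemma Qv : Q *m v = v0. Proof. by rewrite -Pv mulmxA QP mul1mx. Qed.

Definition tform c : 'M[K]_26 := Q^T *m gform K c *m Q.

Definition tquads (q : {mpoly K[26 * 3]}) : Prop :=
  exists c k l, (c < 79)%N /\ q = qform (tform c) k l.

Lemma tquads_idealY q : tquads q -> idealY rho v q.
Proof.
move=> [c [k [l [c79 ->]]]] L iota phi Yphi; rewrite peval_qform.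
have Y26 : inY iota (rho26 K) v0 (map_mx iota Q *m phi).
  by rewrite -Qv; apply: inY_conj Yphi => X; rewrite Qrho.
have := inY_forms charK (form_span_gform L c79) Y26.
rewrite -(map_gform iota) => /matrixP/(_ k l); rewrite [RHS]mxE => e.
apply: etrans e; congr (_ k l); rewrite /tform !map_mxM trmx_mul map_trmx.
by rewrite !mulmxA.
Qed.

(** Substituting P x moves p to the explicit model, where [idealY_rho26] applies, and substituting Q
    x moves the result back. *)
Lemma idealY_tquads p : idealY rho v p <-> ideal_span tquads p.
Proof.
split=> [Ip|[s [Qs ->]] L iota phi Yphi]; last first.
  rewrite peval_sum big1_seq // => y /andP[_ ys].
  by rewrite pevalM (tquads_idealY (Qs y ys)) ?mulr0.
have I26 : idealY (rho26 K) v0 (lsubst P p).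
  move=> L iota phi Yphi; rewrite peval_lsubst; apply: Ip; rewrite -Pv.
  exact: inY_conj Yphi.
have [s [Qs e]] := (idealY_rho26 charK _).1 I26.
rewrite -(lsubstK p PQ1) e lsubst_sum; apply: ideal_span_sum => y ys.
rewrite lsubstM; apply/ideal_spanM/ideal_span_mem.
have [c [k [l [c79 ->]]]] := Qs y ys; exists c, k, l; split=> //.
by rewrite -lsubst_qform; congr lsubst; rewrite gquadE.
Qed.

Lemma idealY2_lin c (p q : {mpoly K[26 * 3]}) : idealY2 rho v p -> idealY2 rho v q -> idealY2 rho v (c *: p + q).
Proof.
move=> [Ip p2] [Iq q2]; have [_ lin] := idealY_subspace 3 rho v.
by split; [apply: lin | apply: rpredD => //; apply: dhomogZ].
Qed.

Lemma idealY2_0 : idealY2 rho v (0 : {mpoly K[26 * 3]}).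
Proof. by split; [have [] := idealY_subspace 3 rho v | apply: rpred0]. Qed.

Lemma tquads_idealY2 q : tquads q -> idealY2 rho v q.
Proof.
move=> tq; split; first exact: tquads_idealY.
by have [c [k [l [_ ->]]]] := tq; apply: qform_homog.
Qed.

Lemma idealY_idealY2 p : idealY rho v p <-> ideal_span (@idealY2 K 26 3 rho v) p.
Proof.
split=> [/idealY_tquads[s [Qs ->]]|[s [Qs ->]] L iota phi Yphi].
  by exists s; split=> // y /Qs; apply: tquads_idealY2.
rewrite peval_sum big1_seq // => y /andP[_ ys].
by have [Iy _] := Qs y ys; rewrite pevalM Iy ?mulr0.
Qed.

Lemma idealY2_quadric m (forms : seq (seq (seq int))) (T : 'M[K]_m) (d : nat) S w :
  (forall c : 'I_m, formK forms K c = gform K (d + c)) -> (d + m <= 79)%N ->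
  @idealY2 K 26 3 rho v (quadric S (form_map forms Q T w)).
Proof.
move=> fg dm; rewrite quadricE.
have I2 k l : @idealY2 K 26 3 rho v (qform (form_map forms Q T w) k l).
  rewrite /form_map mulmx_sumr mulmx_suml.
  apply: (big_ind (fun B => @idealY2 K 26 3 rho v (qform B k l))) => [|B C IB IC|c _].
  - rewrite -(scale0r (0 : 'M_26)) qformZ scale0r; exact: idealY2_0.
  - by rewrite qformD -[X in X + _]scale1r; apply: idealY2_lin.
  rewrite -scalemxAr -scalemxAl qformZ -[_ *: _]addr0; apply: idealY2_lin idealY2_0.
  apply: tquads_idealY2; exists (d + c)%N, k, l; rewrite fg; split=> //.
  by apply: leq_trans dm; rewrite ltn_add2l.
have I2D (p q : {mpoly K[26 * 3]}) : idealY2 rho v p -> idealY2 rho v q -> idealY2 rho v (p + q).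
  by move=> Ip Iq; rewrite -[p]scale1r; apply: idealY2_lin.
apply: (big_ind (@idealY2 K 26 3 rho v)) => [|//|k _]; first exact: idealY2_0.
apply: (big_ind (@idealY2 K 26 3 rho v)) => [|//|l _]; first exact: idealY2_0.
by rewrite -[_ *: _]addr0; apply: idealY2_lin idealY2_0.
Qed.

Definition skew_forms : {linear 'cV[K]_52 -> 'M[K]_26} := form_map forms52 Q 1%:M.
Definition sym_forms : {linear 'cV[K]_(26 + 1) -> 'M[K]_26} :=
  form_map forms27 Q (block_mx Q 0 0 1%:M).

Lemma skew_forms_delta (c : 'I_52) : skew_forms (delta_mx c 0) = tform c.
Proof.
rewrite -[skew_forms _]/(form_map forms52 Q 1%:M (delta_mx c 0)) /form_map mul1mx (bigD1 c) //= big1 => [|i /negPf ic].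
  by rewrite mxE !eqxx scale1r addr0 -gform52.
by rewrite mxE ic scale0r.
Qed.

Lemma sym_forms_delta (c : 'I_(26 + 1)) : exists w, sym_forms w = tform (52 + c).
Proof.
exists (block_mx P 0 0 1%:M *m delta_mx c 0).
rewrite -[sym_forms _]/(form_map forms27 Q (block_mx Q 0 0 1%:M)
  (block_mx P 0 0 1%:M *m delta_mx c 0)) /form_map mulmxA mulmx_block !mul0mx !mulmx0 !addr0 !add0r QP mul1mx.
rewrite -scalar_mx_block mul1mx (bigD1 c) //= big1 => [|i /negPf ic].
  by rewrite mxE !eqxx scale1r addr0 -gform27.
by rewrite mxE ic scale0r.
Qed.

Definition in_forms (p : {mpoly K[26 * 3]}) : Prop :=
  exists p1 p2, [/\ ext_quadrics skew_forms p1, sym_quadrics sym_forms p2 & p = p1 + p2].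

Lemma in_forms0 : in_forms 0.
Proof. by exists 0, 0; split; rewrite ?addr0 //; exists [::]; rewrite big_nil. Qed.

Lemma in_forms_lin c p q : in_forms p -> in_forms q -> in_forms (c *: p + q).
Proof.
move=> [p1 [p2 [[s [sS ->]] [t [tS ->]] ->]]] [q1 [q2 [[s' [sS' ->]] [t' [tS' ->]] ->]]].
have lin m (j : {linear 'cV[K]_m -> 'M[K]_26}) (a b : seq ('M[K]_3 * 'cV[K]_m)) :
    c *: (\sum_(y <- a) quadric y.1 (j y.2)) + \sum_(y <- b) quadric y.1 (j y.2) =
    \sum_(y <- [seq (c *: y.1, y.2) | y <- a] ++ b) quadric y.1 (j y.2) :> {mpoly K[26 * 3]}.
  rewrite big_cat big_map scaler_sumr; congr (_ + _); apply: eq_bigr => y _.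
  rewrite -[c *: y.1]addr0 quadric_linear -[X in _ = _ + X](_ : 0 = _) ?addr0 //.
  by rewrite quadricE big1 // => k _; rewrite big1 // => l _; rewrite mxE scale0r.
rewrite scalerDr addrACA !lin; do 2! eexists; split; last reflexivity.
- exists ([seq (c *: y.1, y.2) | y <- s] ++ s'); split=> // y.
  rewrite mem_cat => /orP[/mapP[z zs ->]|/sS' //].
  by rewrite /skew_mx linearZ /= (sS z zs) scalerN.
- exists ([seq (c *: y.1, y.2) | y <- t] ++ t'); split=> // y.
  rewrite mem_cat => /orP[/mapP[z zt ->]|/tS' //].
  by rewrite /sym_mx linearZ /= (tS z zt).
Qed.

Lemma skew_formsT w : skew_mx (skew_forms w).
Proof. by rewrite /skew_mx (form_map_tr forms52_check) scaleN1r. Qed.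

Lemma sym_formsT w : sym_mx (sym_forms w).
Proof. by rewrite /sym_mx (form_map_tr forms27_check) scale1r. Qed.

Lemma tquads_in_forms q : tquads q -> in_forms q.
Proof.
move=> [c [k [l [c79 ->]]]].
have two0 : 2%:R != 0 :> K by rewrite ((pcharf0P K).1 charK).
(* A form of sign e under transposition only sees the part of the same sign of the matrix unit, so a
   skew or symmetric matrix can take its place. *)
have split_sign (e : K) (B : 'M[K]_26) : B^T = e *: B -> e * e = 1 ->
    qform B k l = quadric (2%:R^-1 *: (e *: delta_mx l k + delta_mx k l)) B.
  move=> BT ee; rewrite -[2%:R^-1 *: _]addr0 quadric_linear quadric_linear !quadric_delta.
  rewrite -(qform_tr B k l) BT qformZ scalerA ee scale1r -mulr2n -scaler_nat scalerA mulVf // scale1r.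
  rewrite quadricE big1 ?addr0 // => i _; rewrite big1 // => j _.
  by rewrite mxE scale0r.
case: (ltnP c 52) => c52.
  have e := skew_forms_delta (Ordinal c52).
  exists (qform (tform c) k l), 0; split; rewrite ?addr0 //; last first.
    by exists [::]; rewrite big_nil.
  have skew := skew_formsT (delta_mx (Ordinal c52) 0).
  exists [:: (2%:R^-1 *: (- 1 *: delta_mx l k + delta_mx k l), delta_mx (Ordinal c52) 0)].
  rewrite big_seq1; split.
    move=> y; rewrite inE => /eqP ->.
    by rewrite /skew_mx linearZ /= linearD linearZ /= !trmx_delta -scalerN; congr (_ *: _);
      rewrite opprD !scaleN1r opprK addrC.
  rewrite e; apply: split_sign; last by rewrite mulrNN mulr1.
  by rewrite -[tform c]/(tform (Ordinal c52)) -e skew scaleN1r.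
have c27 : (c - 52 < 26 + 1)%N by lia.
have [w e] := sym_forms_delta (Ordinal c27).
have {}e : sym_forms w = tform c by rewrite e /= subnKC.
exists 0, (qform (tform c) k l); split; rewrite ?add0r //.
  by exists [::]; rewrite big_nil.
have sym := sym_formsT w.
exists [:: (2%:R^-1 *: (1 *: delta_mx l k + delta_mx k l), w)].
rewrite big_seq1; split.
  move=> y; rewrite inE => /eqP ->.
  by rewrite /sym_mx linearZ /= linearD linearZ /= !trmx_delta !scale1r addrC.
by rewrite e; apply: split_sign; rewrite ?mulr1 // -e sym scale1r.
Qed.

Lemma idealY2_in_forms (p : {mpoly K[26 * 3]}) : idealY2 rho v p <-> in_forms p.
Proof.
split=> [[Ip p2]|[p1 [p2 [[s [_ ->]] [t [_ ->]] ->]]]].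
  have [s [Qs e]] := (idealY_tquads p).1 Ip.
  rewrite -(pihomog_dE p2) e raddf_sum; elim: s Qs {e} => [|y s IH] Qs.
    by rewrite big_nil; apply: in_forms0.
  rewrite big_cons /= pihomog_mul_homog; last first.
    by have [] := tquads_idealY2 (Qs y (mem_head _ _)).
  apply: in_forms_lin; first by apply/tquads_in_forms/Qs/mem_head.
  by apply: IH => z zs; apply: Qs; rewrite inE zs orbT.
have sum m (j : 'cV[K]_m -> 'M[K]_26) (a : seq ('M[K]_3 * 'cV[K]_m)) :
    (forall S w, @idealY2 K 26 3 rho v (quadric S (j w))) ->
    @idealY2 K 26 3 rho v (\sum_(y <- a) quadric y.1 (j y.2)).
  move=> Ij; apply: (big_ind (@idealY2 K 26 3 rho v)) => [|q q' Iq Iq'|y _].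
  - exact: idealY2_0.
  - by rewrite -[q]scale1r; apply: idealY2_lin.
  - exact: Ij.
rewrite -[X in X + _]scale1r; apply: idealY2_lin; apply: sum => S w.
  by apply: (@idealY2_quadric _ _ _ 0) => // c; rewrite -gform52.
by apply: (@idealY2_quadric _ _ _ 52) => // c; rewrite -gform27.
Qed.

Lemma skew_forms_embedding : form_embedding (rho52 K) rho skew_forms.
Proof.
apply: (form_map_embedding charK forms52_check QP Qrho (T' := 1%:M)); first exact: mulmx1.
by move=> X; rewrite mul1mx mulmx1.
Qed.

Lemma sym_forms_embedding : form_embedding (sum_rep rho (@trivial_rep K)) rho sym_forms.
Proof.
have TT : block_mx P 0 0 1%:M *m block_mx Q 0 0 1%:M = 1%:M :> 'M[K]_(26 + 1).
  by rewrite mulmx_block !mul0mx !mulmx0 !addr0 !add0r PQ1 mul1mx -scalar_mx_block.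
have TX X : block_mx Q 0 0 1%:M *m sum_rep rho (@trivial_rep K) X =
    sum_rep (rho26 K) (@trivial_rep K) X *m block_mx Q 0 0 1%:M :> 'M[K]_(26 + 1).
  by rewrite /sum_rep /trivial_rep !mulmx_block !mul0mx !mulmx0 !addr0 Qrho.
apply: (form_map_embedding charK forms27_check QP Qrho TT) => X.
by rewrite formrep27; apply: TX.
Qed.

End TransportedCone.

Theorem theorem6p7 (K : fieldType) (charK : [pchar K] =i pred0)
    (rho : f4gen -> 'M[K]_26) (Vomega4 : fundamental_rep node4 rho)
    (v : 'cV[K]_26) (hwv : hw_vector rho node4 v) :
  (forall p : {mpoly K[26 * 3]},
     idealY rho v p <-> ideal_span (idealY2 rho v) p) /\
  (exists (m : nat) (sigma : f4gen -> 'M[K]_m)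
          (j1 : {linear 'cV[K]_m -> 'M[K]_26})
          (j2 : {linear 'cV[K]_(26 + 1) -> 'M[K]_26}),
     [/\ fundamental_rep node1 sigma,
         form_embedding sigma rho j1 /\ (forall w, skew_mx (j1 w)),
         form_embedding (sum_rep rho (@trivial_rep K)) rho j2 /\
           (forall w, sym_mx (j2 w)) &
         forall p : {mpoly K[26 * 3]},
           idealY2 rho v p <->
           exists p1 p2, [/\ ext_quadrics j1 p1, sym_quadrics j2 p2 &
                             p = p1 + p2]]).
Proof.
have [rep irr _] := Vomega4; have [irr0 hw0] := rho26_fundamental charK.
have [P [Prho Pv Pinj]] := irreducible_unique charK (rho26_rep K) irr0 hw0 rep irr hwv.
have Punit : P \in unitmx.
  rewrite -unitmx_tr -row_free_unit; apply/inj_row_free => x xP.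
  by apply: trmx_inj; rewrite trmx0; apply: Pinj; rewrite -[P]trmxK -trmx_mul xP trmx0.
have QP := mulVmx Punit.
split; first by move=> p; apply: (idealY_idealY2 charK QP Prho Pv).
exists 52, (rho52 K), (skew_forms (invmx P)), (sym_forms (invmx P)).
have [irr52 hw52] := rho52_fundamental charK.
split.
- by split; [exact: rho52_rep | exact: irr52 | exists (delta_mx ord0 0); exact: hw52].
- by split; [exact: (skew_forms_embedding charK QP Prho) | exact: skew_formsT].
- by split; [exact: (sym_forms_embedding charK QP Prho) | exact: sym_formsT].
- by move=> p; apply: (idealY2_in_forms charK QP Prho Pv).
Qed.
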